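(* The problem of deciding, given an $\mathcal{L}_{A_m}^{\Box}$-formula $\varphi$, whether $\varphi$ is $\mathsf{K(A)}$-valid is in EXPTIME.
   Context: $\mathcal{L}_{A_m}^{\Box}$-formulas are built from a countably infinite set $\mathrm{Var}$ of variables using binary $\to$ and unary $\Box$. A $\mathsf{K(A)}$-model $\langle W,R,V\rangle$ has nonempty $W$, $R\subseteq W\times W$, $V\colon\mathrm{Var}\times W\to[-r,r]$ for some real $r\ge0$, extended by $V(\varphi\to\psi,x)=V(\psi,x)-V(\varphi,x)$ and $V(\Box\varphi,x)=\inf_{\mathbb{R}}\{V(\varphi,y):Rxy\}$ (empty infimum $=0$). $\varphi$ is $\mathsf{K(A)}$-valid if $V(\varphi,x)\ge0$ at all worlds of all models. *)

(* Defs.v *)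
From Stdlib Require Import Reals.
From mathcomp Require Import all_boot all_order all_algebra.
From mathcomp Require Import boolp classical_sets reals Rstruct.


Import Order.TTheory GRing.Theory Num.Theory.
Local Open Scope classical_set_scope.
Local Open Scope ring_scope.

Inductive form : Type :=
  | FVar : nat -> form
  | FImp : form -> form -> form
  | FBox : form -> form.

Record KAmodel : Type := {
  world : Type;
  world_nonempty : inhabited world;
  acc : world -> world -> Prop;
  val : nat -> world -> R;
  bound : R;
  bound_ge0 : 0 <= bound;
  val_bound : forall (p : nat) (x : world), - bound <= val p x <= bound
}.

(* inf over R of a set of reals; [inf set0 = 0] in mathcomp-analysis,
   matching the convention "empty infimum = 0". *)
Fixpoint eval (M : KAmodel) (phi : form) (x : world M) : R :=
  match phi with
  | FVar p => val M p x
  | FImp a b => eval M b x - eval M a x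
  | FBox a => inf ((fun y => eval M a y) @` [set y | acc M x y])
  end.

Definition KA_valid (phi : form) : Prop :=
  forall (M : KAmodel) (x : world M), 0 <= eval M phi x.

(* Polish (prefix) notation; a variable p is written 'v' followed by   *)
(* the binary digits of p+1 (leading 1 omitted, little-endian).         *)
Inductive sym : Type := Sv | Si | Sb | S0 | S1.

Fixpoint pos_bits (p : positive) : seq sym :=
  match p with
  | xH => [::]
  | xO q => S0 :: pos_bits q
  | xI q => S1 :: pos_bits q
  end.

Fixpoint enc (phi : form) : seq sym :=
  match phi with
  | FVar p => Sv :: pos_bits (Pos.of_succ_nat p)
  | FImp a b => Si :: enc a ++ enc b
  | FBox a => Sb :: enc a
  end.

Inductive dir : Type := DL | DR | DN.

Record TM : Type := {
  tm_state : finType;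
  tm_sym : finType;
  tm_blank : tm_sym;
  tm_input : sym -> tm_sym;
  tm_start : tm_state;
  (* [inr b]: halt with answer b; [inl (q', g, d)]: write g, move d, go to q' *)
  tm_delta : tm_state -> tm_sym -> (tm_state * tm_sym * dir) + bool
}.

(* configuration: state, left part (nearest cell first), head cell, right part *)
Definition config (M : TM) : Type :=
  (tm_state M * seq (tm_sym M) * tm_sym M * seq (tm_sym M))%type.

Definition tm_move (M : TM) (d : dir) (l : seq (tm_sym M)) (a : tm_sym M)
    (r : seq (tm_sym M)) : seq (tm_sym M) * tm_sym M * seq (tm_sym M) :=
  match d with
  | DN => (l, a, r)
  | DL => match l with
          | [::] => ([::], tm_blank M, a :: r)
          | x :: l' => (l', x, a :: r)
          end
  | DR => match r with
          | [::] => (a :: l, tm_blank M, [::])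
          | x :: r' => (a :: l, x, r')
          end
  end.

Definition tm_step (M : TM) (c : config M) : config M + bool :=
  let: (q, l, a, r) := c in
  match tm_delta M q a with
  | inr b => inr b
  | inl (q', g, d) => let: (l', a', r') := tm_move M d l g r in inl (q', l', a', r')
  end.

Fixpoint tm_run (M : TM) (n : nat) (c : config M) : option bool :=
  match n with
  | 0 => None
  | n'.+1 => match tm_step M c with
             | inr b => Some b
             | inl c' => tm_run M n' c'
             end
  end.

Definition tm_init (M : TM) (w : seq sym) : config M :=
  let t := map (tm_input M) w in
  (tm_start M, [::], head (tm_blank M) t, behead t).

(* Main.v *)
(* Invalidity of phi is rephrased as feasibility of a homogeneous system of
   strict linear inequalities of exponential size.  Every node of the full tree
   of depth and branching degree the number of boxed subformulas of phi carries
   a value for each variable and a lower and an upper bound for each boxed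
   subformula; these bounds propagate through implications as in interval
   arithmetic, and the slack between them makes all inequalities strict.

   Strict feasibility of A x > 0 is decided in polynomial time by a perceptron
   with rescaling.  The rows are kept in the tableau A' C^-1, where A' is A with
   rows multiplied by powers of 2 and C is made of rows of A'.  An entry of
   absolute value at least 2 is removed by pivoting, which at least doubles
   |det C|.  Otherwise the perceptron runs in the coordinates given by C: it
   finds a solution, or it hits some row so often that the slack of this row is
   at most half of the maximal slack for every solution, and that row is doubled.
   If the system is feasible, a vertex solution bounds the slacks, hence the
   number of doublings, the determinant and the number of pivots.  All entries of
   the integral tableau are minors of A', so their size stays polynomial.

   The procedure is written with total functions on binary trees that are closed
   under bounded iteration and compiled to a machine with five stacks, each of
   which is a track on the tape of a one-tape Turing machine. *)

From Stdlib Require Import Reals.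
From HB Require Import structures.
From mathcomp Require Import all_boot all_order all_fingroup all_algebra.
From mathcomp Require Import boolp classical_sets reals Rstruct.
From mathcomp Require Import zify ring lra.
Require Import Defs.
Set Implicit Arguments.
Unset Strict Implicit.
Unset Printing Implicit Defensive.
Import Order.TTheory GRing.Theory Num.Theory.
Bind Scope ring_scope with R.

(** An infimum over infinitely many successors need not be attained, so the values of boxed
    subformulas cannot simply be equated with values at finitely many children. Strict bounds
    tolerate near-minimizers, with slacks that shrink geometrically with the depth. Full branching
    is no restriction: by the convention on empty infima, a world without successors acts like a
    reflexive world at which every formula has value 0.

    The rules for polynomial time quantify over all trees, whereas tableau entries are known to be
    small only along genuine runs. Hence all quotients are read off with a fixed width [W], which
    bounds their size unconditionally; that the width suffices belongs to the correctness proof.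
    With m rows, a feasible system allows at most 8 m^3 pivots and doublings, separated by fewer
    than m * 16 m^4 perceptron updates, which gives the limit of m^16 rounds. After t rounds the
    entries are at most 2^(2 m^2 + t m), which gives the width m^18.

    Only parsing and the generation of the nodes have exponential bounds; the rest is polynomial in
    the size of the list of nodes. *)

Definition sym_code (a : sym) : option (option (option (option unit))) :=
  match a with
  | Sv => None | Si => Some None | Sb => Some (Some None)
  | S0 => Some (Some (Some None)) | S1 => Some (Some (Some (Some tt)))
  end.
Definition sym_decode (c : option (option (option (option unit)))) : sym :=
  match c with
  | None => Sv | Some None => Si | Some (Some None) => Sb
  | Some (Some (Some None)) => S0 | _ => S1
  end.
Lemma sym_codeK : cancel sym_code sym_decode. Proof. by case. Qed.
HB.instance Definition _ := Finite.copy sym (can_type sym_codeK).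

(** * Machines with five stacks and their simulation on one tape *)

Inductive stk := K0 | K1 | K2 | K3 | K4.

Record stacks := Stacks
  { st0 : seq sym; st1 : seq sym; st2 : seq sym; st3 : seq sym; st4 : seq sym }.

Definition sget (k : stk) (s : stacks) : seq sym :=
  match k with K0 => st0 s | K1 => st1 s | K2 => st2 s | K3 => st3 s | K4 => st4 s end.
Definition sset (k : stk) (v : seq sym) (s : stacks) : stacks :=
  let: Stacks a b c d e := s in
  match k with
  | K0 => Stacks v b c d e | K1 => Stacks a v c d e | K2 => Stacks a b v d e
  | K3 => Stacks a b c v e | K4 => Stacks a b c d v
  end.
Definition spush k a s := sset k (a :: sget k s) s.

Definition height (s : stacks) : nat :=
  size (st0 s) + size (st1 s) + size (st2 s) + size (st3 s) + size (st4 s).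

Inductive instr (X : Type) :=
  | INop : X -> instr X
  | IPush : stk -> sym -> X -> instr X
  | IPop : stk -> (option sym -> X) -> instr X.

Definition imap X Y (f : X -> Y) (i : instr X) : instr Y :=
  match i with
  | INop x => INop (f x)
  | IPush k a x => IPush k a (f x)
  | IPop k g => IPop k (fun o => f (g o))
  end.

Section Machine.
Variables (Q : finType) (code : Q -> instr (Q + bool)).

Definition mstep (q : Q) (s : stacks) : (Q + bool) * stacks :=
  match code q with
  | INop o => (o, s)
  | IPush k a o => (o, spush k a s)
  | IPop k f => match sget k s with
                | [::] => (f None, s)
                | a :: l => (f (Some a), sset k l s)
                end
  end.

Inductive mruns : Q + bool -> stacks -> Q + bool -> stacks -> nat -> Prop :=
  | mruns0 o s : mruns o s o s 0
  | mrunsS q s o s' n :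
      mruns (mstep q s).1 (mstep q s).2 o s' n -> mruns (inl q) s o s' n.+1.

Lemma mruns_trans o1 s1 o2 s2 o3 s3 n m :
  mruns o1 s1 o2 s2 n -> mruns o2 s2 o3 s3 m -> mruns o1 s1 o3 s3 (n + m).
Proof.
by elim=> [//|q s o s' k _ IH /IH H]; rewrite addSn; apply: mrunsS.
Qed.

Lemma mruns_inv o s b s' n : mruns o s (inr b) s' n ->
  match o with
  | inl q => exists2 n', n = n'.+1 & mruns (mstep q s).1 (mstep q s).2 (inr b) s' n'
  | inr b' => b = b' /\ n = 0
  end.
Proof.
move E: (inr b) => ob H; case: H E => [o1 s1 <- //|q s1 o1 s2 k H E]; subst o1.
by exists k.
Qed.

(* Each tape cell carries a home mark and one track per stack; the stacks grow
   rightwards from the home cell, where the head rests between instructions. *)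
Definition cell : finType :=
  (bool * (option sym * option sym * option sym * option sym * option sym))%type.
Definition cget (k : stk) (c : cell) : option sym :=
  let: (_, (a, b, c, d, e)) := c in
  match k with K0 => a | K1 => b | K2 => c | K3 => d | K4 => e end.
Definition cset (k : stk) (v : option sym) (c : cell) : cell :=
  let: (h, (a, b, c, d, e)) := c in
  (h, match k with
      | K0 => (v, b, c, d, e) | K1 => (a, v, c, d, e) | K2 => (a, b, v, d, e)
      | K3 => (a, b, c, v, e) | K4 => (a, b, c, d, v)
      end).

Definition mstate : finType := option ((Q + Q) + (Q + bool))%type.
Definition qstart : mstate := None.
Definition qscan (q : Q) : mstate := Some (inl (inl q)).
Definition qread (q : Q) : mstate := Some (inl (inr q)).
Definition qback (o : Q + bool) : mstate := Some (inr o).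

Variable q0 : Q.

(** [qscan] walks right to the first free cell of the track, [qread] stands on the top symbol to be
    removed, and [qback] returns home. A free track at the home cell means an empty stack. Input
    cells carry no mark, so the start state marks the home cell. *)
Definition mdelta (q : mstate) (c : cell) : (mstate * cell * dir) + bool :=
  match q with
  | None => inl (qscan q0, (true, c.2), DN)
  | Some (inl (inl p)) =>
      match code p with
      | INop o => inl (qback o, c, DN)
      | IPush k a o =>
          if cget k c is None then inl (qback o, cset k (Some a) c, DN)
          else inl (qscan p, c, DR)
      | IPop k f =>
          if cget k c is None
          then if c.1 then inl (qback (f None), c, DN) else inl (qread p, c, DL)
          else inl (qscan p, c, DR)
      end
  | Some (inl (inr p)) =>
      match code p with
      | IPop k f => inl (qback (f (cget k c)), cset k None c, DN)
      | _ => inr false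
      end
  | Some (inr o) =>
      if c.1 then match o with inl p => inl (qscan p, c, DN) | inr b => inr b end
      else inl (qback o, c, DL)
  end.

Definition blank_cell : cell := (false, (None, None, None, None, None)).
(** The input is already the content of track [K4], with its last symbol on top; this is why runs
    start with [rev w] on that stack. *)
Definition stack_TM : TM :=
  @Build_TM mstate cell blank_cell (fun a => cset K4 (Some a) blank_cell) qstart mdelta.

(** The tape is viewed as a function of the cell number, so that blanks stored explicitly at the
    right end and blanks not yet visited are identified. *)
Definition tape_at (q : mstate) (j : nat) (F : nat -> cell) (c : config stack_TM) :=
  exists l a r, [/\ c = (q, l, a, r), size l = j
    & forall i, nth blank_cell (rev l ++ a :: r) i = F i].

Inductive tsteps : config stack_TM -> config stack_TM -> nat -> Prop :=
  | tsteps0 c : tsteps c c 0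
  | tstepsS c c1 c2 n : tm_step stack_TM c = inl c1 -> tsteps c1 c2 n -> tsteps c c2 n.+1.

Lemma tsteps_trans c1 c2 c3 n m :
  tsteps c1 c2 n -> tsteps c2 c3 m -> tsteps c1 c3 (n + m).
Proof. by elim=> [//|c c' c'' k Hs _ IH /IH H]; rewrite addSn; apply: tstepsS Hs _. Qed.

Lemma tsteps1 c c' : tm_step stack_TM c = inl c' -> tsteps c c' 1.
Proof. by move=> H; apply: tstepsS H (tsteps0 _). Qed.

Lemma tm_run_tsteps c c' n m : tsteps c c' n -> tm_run stack_TM (n + m) c = tm_run stack_TM m c'.
Proof. by elim=> [//|c1 c2 c3 k Hs _ IH]; rewrite addSn /= Hs IH. Qed.

Definition upd (F : nat -> cell) j v := fun i => if i == j then v else F i.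

Lemma tape_head q q' j F l a r : tape_at q j F (q', l, a, r) -> a = F j.
Proof.
by move=> [l' [a' [r' [[_ <- <- <-] sz /(_ j)]]]]; rewrite nth_cat size_rev sz ltnn subnn.
Qed.

Lemma nth_upd_mid (l r : seq cell) a g i :
  nth blank_cell (rev l ++ g :: r) i =
  if i == size l then g else nth blank_cell (rev l ++ a :: r) i.
Proof.
rewrite !nth_cat size_rev; case: eqP => [->|ne]; first by rewrite ltnn subnn.
by case: ltnP => // le; case E: (i - size l) => [|n] //; lia.
Qed.

Lemma tape_stay q q' j F c g :
  tape_at q j F c -> mdelta q (F j) = inl (q', g, DN) ->
  exists2 c', tm_step stack_TM c = inl c' & tape_at q' j (upd F j g) c'.
Proof.
case: c => [[[q1 l] a] r] H Hd; move: (H) => [l' [a' [r' [[? <- <- <-] sz E]]]]; subst q1.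
have Ha := tape_head H.
exists (q', l, g, r); first by rewrite /tm_step /= Ha Hd.
by exists l, g, r; split=> // i; rewrite (nth_upd_mid _ _ a) sz E.
Qed.

Lemma tape_right q q' j F c g :
  tape_at q j F c -> mdelta q (F j) = inl (q', g, DR) ->
  exists2 c', tm_step stack_TM c = inl c' & tape_at q' j.+1 (upd F j g) c'.
Proof.
case: c => [[[q1 l] a] r] H Hd; move: (H) => [l' [a' [r' [[? <- <- <-] sz E]]]]; subst q1.
have Ha := tape_head H.
have Eg i : nth blank_cell (rev l ++ g :: r) i = upd F j g i.
  by rewrite (nth_upd_mid _ _ a) sz E.
case: r H E Eg => [|x r] H E Eg.
  exists (q', g :: l, blank_cell, [::]); first by rewrite /tm_step /= Ha Hd.
  exists (g :: l), blank_cell, [::]; split=> //=; first by rewrite sz.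
  by move=> i; rewrite -Eg rev_cons !cats1 nth_rcons_default.
exists (q', g :: l, x, r); first by rewrite /tm_step /= Ha Hd.
exists (g :: l), x, r; split=> //=; first by rewrite sz.
by move=> i; rewrite -Eg rev_cons cat_rcons.
Qed.

Lemma tape_left q q' j F c g :
  tape_at q j.+1 F c -> mdelta q (F j.+1) = inl (q', g, DL) ->
  exists2 c', tm_step stack_TM c = inl c' & tape_at q' j (upd F j.+1 g) c'.
Proof.
case: c => [[[q1 l] a] r] H Hd; move: (H) => [l' [a' [r' [[? <- <- <-] sz E]]]]; subst q1.
have Ha := tape_head H.
have Eg i : nth blank_cell (rev l ++ g :: r) i = upd F j.+1 g i.
  by rewrite (nth_upd_mid _ _ a) sz E.
case: l sz H E Eg => [//|x l] [sz] H E Eg.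
exists (q', l, x, g :: r); first by rewrite /tm_step /= Ha Hd.
by exists l, x, (g :: r); split=> // i; rewrite -Eg rev_cons cat_rcons.
Qed.

Lemma tape_at_ext q j F G c : F =1 G -> tape_at q j F c -> tape_at q j G c.
Proof.
move=> E [l [a [r [-> sz H]]]]; exists l, a, r; split=> // i; by rewrite H E.
Qed.

Lemma upd_same F j : upd F j (F j) =1 F.
Proof. by move=> i; rewrite /upd; case: eqP => [->|]. Qed.

(** Stacks are lists with the top first, while tracks start with the bottom at the home cell; hence
    [rev]. *)
Definition rep (s : stacks) (F : nat -> cell) :=
  forall i, (F i).1 = (i == 0) /\
    forall k, cget k (F i) = nth None (map Some (rev (sget k s))) i.

Lemma cget_set k k' v c : cget k (cset k' v c) = 
  match k, k' with
  | K0, K0 | K1, K1 | K2, K2 | K3, K3 | K4, K4 => v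
  | _, _ => cget k c
  end.
Proof. by case: c => [h [[[[a b] d] e] f]]; case: k; case: k'. Qed.

Lemma cset1 k v c : (cset k v c).1 = c.1.
Proof. by case: c => [h [[[[a b] d] e] f]]; case: k. Qed.

Lemma sget_set k k' v s : sget k (sset k' v s) = 
  match k, k' with
  | K0, K0 | K1, K1 | K2, K2 | K3, K3 | K4, K4 => v
  | _, _ => sget k s
  end.
Proof. by case: s; case: k; case: k'. Qed.

Lemma sset_height k v s : height (sset k v s) + size (sget k s) = height s + size v.
Proof. case: s => a b c d e; rewrite /height; case: k => /=; lia. Qed.

Lemma size_sget k s : size (sget k s) <= height s.
Proof. case: s => a b c d e; rewrite /height; case: k => /=; lia. Qed.

Lemma rep_set s F k v j o :
  rep s F ->
  (forall i, nth None (map Some (rev v)) i =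
     if i == j then o else nth None (map Some (rev (sget k s))) i) ->
  rep (sset k v s) (upd F j (cset k o (F j))).
Proof.
move=> R E i; have [m c] := R i; rewrite /upd; split.
  by case: eqP => [->|//]; rewrite cset1; have [] := R j.
move=> k'; rewrite sget_set; have := c k'; have := E i; case: eqP => [<-|_] Ei ck.
  by rewrite cget_set; case: k {R E} Ei => Ei; case: k' ck => //= ->; rewrite Ei.
by case: k {R E} Ei => Ei; case: k' ck => //= ->; rewrite Ei.
Qed.

Lemma nth_push (l : seq sym) a i :
  nth None (map Some (rev (a :: l))) i =
  if i == size l then Some a else nth None (map Some (rev l)) i.
Proof.
rewrite rev_cons map_rcons nth_rcons size_map size_rev.
by case: ltngtP => // gt; rewrite nth_default // size_map size_rev ltnW.
Qed.

Lemma nth_pop (l : seq sym) a i :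
  nth None (map Some (rev l)) i =
  if i == size l then None else nth None (map Some (rev (a :: l))) i.
Proof.
rewrite nth_push; case: eqP => // ->; by rewrite nth_default // size_map size_rev.
Qed.

Lemma nth_top (l : seq sym) i :
  (nth None (map Some (rev l)) i == None) = (size l <= i).
Proof.
case: leqP => le; first by rewrite nth_default ?eqxx // size_map size_rev.
by rewrite (nth_map Sv) ?size_rev.
Qed.

Lemma scan_right p j d F c :
  (forall i, i < d -> mdelta (qscan p) (F (j + i)) = inl (qscan p, F (j + i), DR)) ->
  tape_at (qscan p) j F c ->
  exists2 c', tsteps c c' d & tape_at (qscan p) (j + d) F c'.
Proof.
elim: d j c => [|d IH] j c H Hc; first by exists c; [apply: tsteps0|rewrite addn0].
have H0 := H 0 isT; rewrite addn0 in H0.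
have [c1 S1 A1] := tape_right Hc H0.
have [|c2 S2 A2] := IH j.+1 c1 _ (tape_at_ext (upd_same _ _) A1).
  by move=> i lt; rewrite addSnnS; apply: H.
by exists c2; [apply: tstepsS S1 S2|rewrite addnS -addSn].
Qed.

Lemma scan_left o d F c : (forall i, (F i).1 = (i == 0)) ->
  tape_at (qback o) d F c ->
  exists2 c', tsteps c c' d & tape_at (qback o) 0 F c'.
Proof.
move=> H; elim: d c => [|d IH] c Hc; first by exists c; [apply: tsteps0|].
have Hd : mdelta (qback o) (F d.+1) = inl (qback o, F d.+1, DL) by rewrite /= H.
have [c1 S1 A1] := tape_left Hc Hd.
have [c2 S2 A2] := IH c1 (tape_at_ext (upd_same _ _) A1).
by exists c2; [apply: tstepsS S1 S2|].
Qed.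

Lemma back_steps o d F c s : rep s F -> tape_at (qback o) d F c ->
  match o with
  | inl p => exists2 c', tsteps c c' d.+1 & tape_at (qscan p) 0 F c'
  | inr b => forall n, tm_run stack_TM (d + n.+1) c = Some b
  end.
Proof.
move=> R Hc; have [|c1 S1 A1] := scan_left _ Hc; first by move=> i; have [] := R i.
have [h0 _] := R 0.
case: o Hc S1 A1 => [p|b] Hc S1 A1.
  have Hd : mdelta (qback (inl p)) (F 0) = inl (qscan p, F 0, DN) by rewrite /= h0.
  have [c2 S2 A2] := tape_stay A1 Hd.
  exists c2; last exact: tape_at_ext (upd_same _ _) A2.
  by rewrite -addn1; apply: tsteps_trans S1 (tsteps1 S2).
move=> n; rewrite (tm_run_tsteps _ S1) /=.
case: c1 A1 {S1} => [[[q l] a] r] A1; have Ea := tape_head A1.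
case: A1 => [? [? [? [[-> _ _ _] _ _]]]].
by rewrite /tm_step /= Ea h0.
Qed.

(** An instruction costs one walk to the top of a single stack, so its cost is linear in the total
    height. The distance [d] is kept because the way back is charged separately. *)
Lemma mstep_sim q s F c :
  rep s F -> tape_at (qscan q) 0 F c ->
  exists F' c' d t,
    [/\ rep (mstep q s).2 F', tape_at (qback (mstep q s).1) d F' c', tsteps c c' t,
        d <= height s & t <= (height s).+2].
Proof.
move=> R A; rewrite /mstep; case Hq: (code q) => [o|k a o|k f].
- have Hd : mdelta (qscan q) (F 0) = inl (qback o, F 0, DN) by rewrite /= Hq.
  have [c1 S1 A1] := tape_stay A Hd.
  exists F, c1, 0, 1; split=> //=; last exact: tsteps1.
  exact: tape_at_ext (upd_same _ _) A1.
- have [|c1 S1 A1] := @scan_right q 0 (size (sget k s)) F c _ A.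
    move=> i lt; rewrite /= Hq; have [_ /(_ k) E] := R (0 + i).
    have := nth_top (sget k s) (0 + i); rewrite -E leqNgt lt /=.
    by case: (cget k _).
  rewrite add0n in A1; set d := size _ in S1 A1 *.
  have Hd : mdelta (qscan q) (F d) = inl (qback o, cset k (Some a) (F d), DN).
    rewrite /= Hq; have [_ /(_ k) E] := R d.
    by have := nth_top (sget k s) d; rewrite -E leqnn; case: (cget k _).
  have [c2 S2 A2] := tape_stay A1 Hd.
  exists (upd F d (cset k (Some a) (F d))), c2, d, (d + 1); split=> //.
  + by apply: rep_set => // i; rewrite nth_push.
  + exact: tsteps_trans S1 (tsteps1 S2).
  + exact: size_sget.
  + by have := size_sget k s; rewrite -/d; lia.
have [|c1 S1 A1] := @scan_right q 0 (size (sget k s)) F c _ A.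
  move=> i lt; rewrite /= Hq; have [_ /(_ k) E] := R (0 + i).
  have := nth_top (sget k s) (0 + i); rewrite -E leqNgt lt /=.
  by case: (cget k _).
rewrite add0n in A1; have hs := size_sget k s.
have [m E] := R (size (sget k s)); have := nth_top (sget k s) (size (sget k s)).
rewrite -E leqnn; case Ek: (cget k _) => [//|] _.
case Hs: (sget k s) S1 A1 hs m E Ek => [|a l] S1 A1 hs m E Ek.
  have Hd : mdelta (qscan q) (F 0) = inl (qback (f None), F 0, DN).
    by rewrite /= Hq Ek m.
  have [c2 S2 A2] := tape_stay A1 Hd.
  exists F, c2, 0, 1; split=> //=; last exact: tsteps_trans S1 (tsteps1 S2).
  exact: tape_at_ext (upd_same _ _) A2.
have Hd : mdelta (qscan q) (F (size l).+1) = inl (qread q, F (size l).+1, DL).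
  by rewrite /= Hq Ek m.
have [c2 S2 A2] := tape_left A1 Hd.
have {}A2 := tape_at_ext (upd_same _ _) A2.
have [_ /(_ k) El] := R (size l).
rewrite Hs nth_push eqxx in El.
have Hd2 : mdelta (qread q) (F (size l)) =
    inl (qback (f (Some a)), cset k None (F (size l)), DN) by rewrite /= Hq El.
have [c3 S3 A3] := tape_stay A2 Hd2.
exists (upd F (size l) (cset k None (F (size l)))), c3, (size l), (size (a :: l) + (1 + 1)).
split=> //.
- by apply: rep_set => // i; rewrite Hs; apply: nth_pop.
- exact: tsteps_trans S1 (tsteps_trans (tsteps1 S2) (tsteps1 S3)).
- by move: hs => /=; lia.
- by move: hs => /=; lia.
Qed.

Lemma mstep_height q s : height (mstep q s).2 <= (height s).+1.
Proof.
rewrite /mstep; case: (code q) => [o|k a o|k f] //=.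
  by have := sset_height k (a :: sget k s) s; rewrite /spush /=; lia.
case E: (sget k s) => [|a l] //=.
by have := sset_height k l s; rewrite E /=; lia.
Qed.

(** The height grows by at most one per instruction, so it stays below [h + n], and an instruction
    with its way back costs at most twice that plus a constant. *)
Lemma mruns_sim q s b s' n F c m h :
  mruns (inl q) s (inr b) s' n -> rep s F -> tape_at (qscan q) 0 F c ->
  height s <= h ->
  n * (2 * (h + n) + 4) <= m -> tm_run stack_TM m c = Some b.
Proof.
elim: n q s F c m h => [|n IH] q s F c m h /mruns_inv[n' // [<-] H] R A hh hm.
have [F' [c' [d [t [R' A' S' hd ht]]]]] := mstep_sim R A.
have hs := mstep_height q s.
have B := back_steps R' A'.
move: H B R' A' hs; case: (mstep q s) => [o s1] /= H B R' A' hs.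
case: o H B A' => [p|b'] H B A'.
  case: B => c2 S2 A2.
  have -> : m = t + (d.+1 + (m - t - d.+1)) by nia.
  rewrite (tm_run_tsteps _ S') (tm_run_tsteps _ S2).
  apply: (IH _ _ _ _ _ h.+1 H R' A2); nia.
have [-> _] := mruns_inv H.
have -> : m = t + (d + (m - t - d).-1.+1) by nia.
by rewrite (tm_run_tsteps _ S') B.
Qed.

Lemma tm_init_sim w b s' n m : w != [::] ->
  mruns (inl q0) (Stacks [::] [::] [::] [::] (rev w)) (inr b) s' n ->
  n * (2 * (size w + n) + 4) < m -> tm_run stack_TM m (tm_init stack_TM w) = Some b.
Proof.
case: w => [//|a w] _ H; case: m => [//|m] hm.
set s := Stacks _ _ _ _ _ in H.
set F0 := fun i => nth blank_cell (map (fun a => cset K4 (Some a) blank_cell) (a :: w)) i.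
have A0 : tape_at qstart 0 F0 (tm_init stack_TM (a :: w)).
  by exists [::], (cset K4 (Some a) blank_cell), (map (tm_input stack_TM) w).
have Hd : mdelta qstart (F0 0) = inl (qscan q0, (true, (F0 0).2), DN) by [].
have [c1 S1 A1] := tape_stay A0 Hd.
rewrite -[m.+1]/(1 + m) (tm_run_tsteps _ (tsteps1 S1)).
apply: (mruns_sim H _ A1 (h := size (a :: w))) => //; last 1 first.
- by rewrite /height /= size_rev /=; lia.
move=> i; rewrite /upd; split.
  case: eqP => // _; rewrite /F0.
  case: (ltnP i (size (a :: w))) => lt; first by rewrite (nth_map Sv).
  by rewrite nth_default ?size_map.
move=> k.
have -> : cget k (if i == 0 then (true, (F0 0).2) else F0 i) = cget k (F0 i).
  by case: eqP => [->|//]; case: k.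
rewrite /F0; case: (ltnP i (size (a :: w))) => lt.
  rewrite (nth_map Sv) //; case: k => /=; rewrite ?nth_nil //.
  by rewrite revK (nth_map Sv).
rewrite nth_default ?size_map //; case: k => /=; rewrite ?nth_nil //.
by rewrite revK nth_default // size_map.
Qed.

End Machine.

(** * Structured programs and their compilation *)

Inductive stmt :=
  | Skip : stmt
  | Push : stk -> sym -> stmt
  | Pop : stk -> (option sym -> stmt) -> stmt
  | Seq : stmt -> stmt -> stmt
  | Loop : stk -> (sym -> stmt) -> stmt.

Inductive sem : stmt -> stacks -> stacks -> nat -> Prop :=
  | sem_skip s : sem Skip s s 1
  | sem_push k a s : sem (Push k a) s (spush k a s) 1
  | sem_pop0 k f s s' n : sget k s = [::] -> sem (f None) s s' n ->
      sem (Pop k f) s s' n.+1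
  | sem_pop k f a l s s' n : sget k s = a :: l -> sem (f (Some a)) (sset k l s) s' n ->
      sem (Pop k f) s s' n.+1
  | sem_seq p q s1 s2 s3 n m : sem p s1 s2 n -> sem q s2 s3 m ->
      sem (Seq p q) s1 s3 (n + m)
  | sem_loop0 k f s : sget k s = [::] -> sem (Loop k f) s s 1
  | sem_loop k f a l s s1 s2 n m : sget k s = a :: l ->
      sem (f a) (sset k l s) s1 n -> sem (Loop k f) s1 s2 m ->
      sem (Loop k f) s s2 (n + m).+1.

(** Control points follow the structure of the program and thus form a [finType]; the branches of a
    pop give a dependent sum over the finitely many symbols. [None] is the point at which the pop
    itself is executed. *)
Fixpoint points (p : stmt) : finType :=
  match p with
  | Skip | Push _ _ => unit
  | Pop k f => option {o : option sym & points (f o)}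
  | Seq p q => (points p + points q)%type
  | Loop k f => option {a : sym & points (f a)}
  end.

Fixpoint entry (p : stmt) : points p :=
  match p with
  | Skip | Push _ _ => tt
  | Pop k f => None
  | Seq p q => inl (entry p)
  | Loop k f => None
  end.

Fixpoint pcode (p : stmt) : points p -> instr (option (points p)) :=
  match p with
  | Skip => fun _ => INop None
  | Push k a => fun _ => IPush k a None
  | Pop k f => fun x =>
      match x with
      | None => IPop k (fun o => Some (Some (existT (fun o => points (f o)) o (entry (f o)))))
      | Some (existT o y) =>
          imap (omap (fun z => Some (existT (fun o => points (f o)) o z))) (pcode y)
      end
  | Seq p q => fun x =>
      match x with
      | inl y => imap (fun o => Some (if o is Some z then inl z else inr (entry q))) (pcode y)
      | inr y => imap (omap inr) (pcode y)
      end
  | Loop k f => fun x =>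
      match x with
      | None => IPop k (fun o =>
          if o is Some a then Some (Some (existT (fun a => points (f a)) a (entry (f a))))
          else None)
      | Some (existT a y) =>
          imap (fun o => Some (if o is Some z
                               then Some (existT (fun a => points (f a)) a z) else None))
               (pcode y)
      end
  end.

Section Embed.
Variables (Q : finType) (code : Q -> instr (Q + bool)).

Definition ext (p : stmt) (e : points p -> Q) (x : Q + bool) (o : option (points p)) :
  Q + bool := if o is Some y then inl (e y) else x.

(** The embedding [e] and the exit [x] are arbitrary, so that the code of a subprogram can be
    recognized inside the code of the program that contains it. *)
Definition embeds p (e : points p -> Q) (x : Q + bool) :=
  forall y, match pcode y, code (e y) with
    | INop o, INop o' => o' = ext e x o
    | IPush k a o, IPush k' a' o' => [/\ k' = k, a' = a & o' = ext e x o]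
    | IPop k f, IPop k' f' => k' = k /\ forall o, f' o = ext e x (f o)
    | _, _ => False
    end.

Lemma sem_mruns p s s' n : sem p s s' n -> forall (e : points p -> Q) x,
  embeds e x -> mruns code (inl (e (entry p))) s x s' n.
Proof.
elim=> {p s s' n}.
- move=> s e x /(_ tt) /=; case E: (code _) => [o'|k' a' o'|k' f'] // Eo.
  by apply: mrunsS; rewrite /mstep E Eo; apply: mruns0.
- move=> k a s e x /(_ tt) /=; case E: (code _) => [o'|k' a' o'|k' f'] // [? ? ?].
  by subst; apply: mrunsS; rewrite /mstep E; apply: mruns0.
- move=> k f s s' n Hs _ IH e x He; apply: mrunsS; have := He None.
  rewrite /= /mstep; case E: (code _) => [||k' f'] //= [-> Ef]; rewrite Hs /= Ef /=.
  apply: (IH (fun y => e (Some (existT _ None y)))) => y.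
  have := He (Some (existT _ None y)); rewrite /=.
  case: (pcode y) => [o|k1 a1 o|k1 f1] /=; case: (code _) => [o'|k2 a2 o'|k2 f2] //=.
  + by move->; case: o.
  + by move=> [-> -> ->]; case: o.
  + by move=> [-> H]; split=> // o; rewrite H; case: (f1 o).
- move=> k f a l s s' n Hs _ IH e x He; apply: mrunsS; have := He None.
  rewrite /= /mstep; case E: (code _) => [||k' f'] //= [-> Ef]; rewrite Hs /= Ef /=.
  apply: (IH (fun y => e (Some (existT _ (Some a) y)))) => y.
  have := He (Some (existT _ (Some a) y)); rewrite /=.
  case: (pcode y) => [o|k1 a1 o|k1 f1] /=; case: (code _) => [o'|k2 a2 o'|k2 f2] //=.
  + by move->; case: o.
  + by move=> [-> -> ->]; case: o.
  + by move=> [-> H]; split=> // o; rewrite H; case: (f1 o).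
- move=> p q s1 s2 s3 n m _ IHp _ IHq e x He.
  apply: mruns_trans (IHp (fun y => e (inl y)) (inl (e (inr (entry q)))) _)
                     (IHq (fun y => e (inr y)) x _) => y.
    have := He (inl y); rewrite /=.
    case: (pcode y) => [o|k1 a1 o|k1 f1] /=; case: (code _) => [o'|k2 a2 o'|k2 f2] //=.
    + by move->; case: o.
    + by move=> [-> -> ->]; case: o.
    + by move=> [-> H]; split=> // o; rewrite H; case: (f1 o).
  have := He (inr y); rewrite /=.
  case: (pcode y) => [o|k1 a1 o|k1 f1] /=; case: (code _) => [o'|k2 a2 o'|k2 f2] //=.
  + by move->; case: o.
  + by move=> [-> -> ->]; case: o.
  + by move=> [-> H]; split=> // o; rewrite H; case: (f1 o).
- move=> k f s Hs e x He; apply: mrunsS; have := He None.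
  rewrite /= /mstep; case E: (code _) => [||k' f'] //= [-> Ef]; rewrite Hs /= Ef /=.
  exact: mruns0.
- move=> k f a l s s1 s2 n m Hs _ IH1 _ IH2 e x He; apply: mrunsS; have := He None.
  rewrite /= /mstep; case E: (code _) => [||k' f'] //= [-> Ef]; rewrite Hs /= Ef /=.
  apply: mruns_trans (IH1 (fun y => e (Some (existT _ a y))) (inl (e None)) _) (IH2 e x He).
  move=> y; have := He (Some (existT _ a y)); rewrite /=.
  case: (pcode y) => [o|k1 a1 o|k1 f1] /=; case: (code _) => [o'|k2 a2 o'|k2 f2] //=.
  + by move->; case: o.
  + by move=> [-> -> ->]; case: o.
  + by move=> [-> H]; split=> // o; rewrite H; case: (f1 o).
Qed.
End Embed.

(** The test for [S1] at the exit reads off the answer: a serialized tree starts with [S1] exactly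
    if it is an inner node. *)
Definition wcode (p : stmt) (x : option (points p)) :
    instr (option (points p) + bool) :=
  if x is Some y then imap (fun o => inl o) (pcode y)
  else IPop K0 (fun o => inr (o == Some S1)).

Theorem stmt_TM (p : stmt) : exists M : TM, forall w a l s' n m,
  w != [::] ->
  sem p (Stacks [::] [::] [::] [::] (rev w)) s' n -> st0 s' = a :: l ->
  n.+1 * (2 * (size w + n.+1) + 4) < m ->
  tm_run M m (tm_init M w) = Some (a == S1).
Proof.
exists (stack_TM (@wcode p) (Some (entry p))) => w a l s' n m Hw Hs Ha Hm.
apply: (@tm_init_sim _ (@wcode p) (Some (entry p)) w (a == S1) (sset K0 l s') n.+1) => //.
rewrite -addn1; apply: mruns_trans.
  apply: (sem_mruns Hs (e := Some) (x := inl None)) => y /=.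
  by case: (pcode y) => [[|]|? ? [|]|k f] //=; split=> // o; case: (f o).
by apply: mrunsS; rewrite /mstep /= Ha; apply: mruns0.
Qed.

(** * Binary trees as data, and stack programs on serialized trees *)

Inductive tree := Lf | Nd of tree & tree.

Definition hd t := if t is Nd a _ then a else Lf.
Definition tl t := if t is Nd _ b then b else Lf.
Definition isnd t := if t is Nd _ _ then true else false.
Definition tru := Nd Lf Lf.

Fixpoint tree_eq (s t : tree) : bool :=
  match s, t with
  | Lf, Lf => true
  | Nd a b, Nd c d => tree_eq a c && tree_eq b d
  | _, _ => false
  end.
Lemma tree_eqP : Equality.axiom tree_eq.
Proof.
move=> s t; apply: (iffP idP) => [|<-]; last by elim: s => //= a -> b ->.
by elim: s t => [|a IHa b IHb] [|c d] //= /andP[/IHa-> /IHb->].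
Qed.
HB.instance Definition _ := hasDecEq.Build tree tree_eqP.

(** A prefix code, so several trees can lie on one stack without separators. *)
Fixpoint ser (t : tree) : seq sym :=
  if t is Nd a b then S1 :: ser a ++ ser b else [:: S0].
Definition sz t := size (ser t).
Fixpoint len t := if t is Nd _ b then (len b).+1 else 0.

Lemma sz_Nd a b : sz (Nd a b) = (sz a + sz b).+1.
Proof. by rewrite /sz /= size_cat. Qed.
Lemma sz_gt0 t : 0 < sz t. Proof. by case: t. Qed.
Lemma len_sz t : len t < sz t.
Proof. elim: t => //= a _ b IH; rewrite sz_Nd; lia. Qed.
Lemma sz_hd t : sz (hd t) <= sz t.
Proof. by case: t => //= a b; rewrite sz_Nd; lia. Qed.
Lemma sz_tl t : sz (tl t) <= sz t.
Proof. by case: t => //= a b; rewrite sz_Nd; lia. Qed.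

Lemma ser_cat_inj s t u v : ser s ++ u = ser t ++ v -> s = t /\ u = v.
Proof.
elim: s t u v => [|a IHa b IHb] [|c d] u v //=; first by case.
by case; rewrite -!catA => /IHa[-> /IHb[-> ->]].
Qed.
Lemma ser_inj : injective ser.
Proof. by move=> s t E; case: (@ser_cat_inj s t [::] [::]); rewrite ?cats0. Qed.

Definition pushes (k : stk) (l : seq sym) : stmt := foldr (fun a p => Seq (Push k a) p) Skip l.

Section Prims.
Implicit Types (x y : tree) (r a b c d e l : seq sym).

(* Transfers one serialized tree from K0 to stack k (reversed); K2 counts the
   subtrees still to be read. *)
Definition move_body k : stmt := Pop K0 (fun o => match o with
  | None => Skip
  | Some S1 => Seq (Push k S1) (Seq (Push K2 S1) (Push K2 S1))
  | Some s => Seq (Push k s) (Seq Skip Skip) end).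
Definition move k : stmt := Seq (Push K2 S1) (Loop K2 (fun _ => move_body k)).

Lemma sem_eq p s s1 s2 n n1 : sem p s s1 n -> s1 = s2 -> n = n1 -> sem p s s2 n1.
Proof. by move=> H <- <-. Qed.

Definition dst k b d l := match k with K1 => (l ++ b, d) | _ => (b, l ++ d) end.

(** A forest is the right invariant: reading [S1] replaces the pending tree by its two subtrees. The
    number of trees may thus grow, and the induction is on the total size. *)
Lemma move_forest k (f : seq tree) r b d e : k = K1 \/ k = K3 ->
  sem (Loop K2 (fun _ => move_body k))
    (Stacks (flatten (map ser f) ++ r) b (nseq (size f) S1) d e)
    (Stacks r (dst k b d (rev (flatten (map ser f)))).1 [::]
       (dst k b d (rev (flatten (map ser f)))).2 e)
    ((5 * sumn (map sz f)).+1).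
Proof.
move=> Hk; have [n] := ubnP (sumn (map sz f)); elim: n f r b d => // n IH f r b d lt.
case: f lt => [|t f] lt.
  by apply: (@sem_eq _ _ _ _ _ _ (sem_loop0 _ _)) => //=; case: Hk => ->.
case: t lt => [|x y] lt.
- have H1 : sem (move_body k) (Stacks (S0 :: flatten (map ser f) ++ r) b (nseq (size f) S1) d e)
      (Stacks (flatten (map ser f) ++ r) (dst k b d [:: S0]).1 (nseq (size f) S1) (dst k b d [:: S0]).2 e) 4.
    apply: sem_pop; first by [].
    apply: sem_eq; first (apply: sem_seq; [exact: sem_push|apply: sem_seq; exact: sem_skip]).
      by case: Hk => ->.
    by [].
  apply: sem_eq; first (apply: (@sem_loop _ _ S1); [by []|exact: H1|apply: IH]).
  + by move: lt => /=; rewrite /sz /=; lia.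
  + by case: Hk => -> /=; rewrite !rev_cons -cats1 -!catA.
  + by move=> /=; rewrite /sz /=; lia.
have H1 : sem (move_body k) (Stacks (S1 :: ser x ++ ser y ++ flatten (map ser f) ++ r) b (nseq (size f) S1) d e)
      (Stacks (ser x ++ ser y ++ flatten (map ser f) ++ r) (dst k b d [:: S1]).1
         (nseq (size [:: x, y & f]) S1) (dst k b d [:: S1]).2 e) 4.
  apply: sem_pop; first by [].
  apply: sem_eq; first (apply: sem_seq; [exact: sem_push|apply: sem_seq; exact: sem_push]).
    by case: Hk => ->.
  by [].
apply: sem_eq; first (apply: (@sem_loop _ _ S1); [by []| |]).
+ by rewrite /= -!catA; exact: H1.
+ have := IH [:: x, y & f] r (dst k b d [:: S1]).1 (dst k b d [:: S1]).2.
  rewrite /= -!catA; apply; move: lt => /=; rewrite sz_Nd; lia.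
+ by case: Hk => -> /=; rewrite !rev_cons -cats1 -!catA.
+ by move=> /=; rewrite sz_Nd; lia.
Qed.

Lemma move_sem k x r b d e : k = K1 \/ k = K3 ->
  sem (move k) (Stacks (ser x ++ r) b [::] d e)
    (Stacks r (dst k b d (rev (ser x))).1 [::] (dst k b d (rev (ser x))).2 e)
    (5 * sz x + 2).
Proof.
move=> Hk; have := @move_forest k [:: x] r b d e Hk; rewrite /= cats0 addn0 => H.
by apply: sem_eq; first (apply: sem_seq; [exact: sem_push|exact: H]); last lia.
Qed.

Definition clear1 : stmt := Loop K1 (fun _ => Skip).
Definition drain1 : stmt := Loop K1 (fun z => Push K0 z).
Definition drain3 : stmt := Loop K3 (fun z => Push K0 z).
Definition drain31 : stmt := Loop K3 (fun z => Push K1 z).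
Definition drain103 : stmt := Loop K1 (fun z => Seq (Push K0 z) (Push K3 z)).

Lemma clear1_sem a b c d e :
  sem clear1 (Stacks a b c d e) (Stacks a [::] c d e) (2 * size b + 1).
Proof.
elim: b => [|x b IH]; first exact: sem_loop0.
by apply: sem_eq; first (apply: sem_loop; [by []|exact: sem_skip|exact: IH]); last (simpl; lia).
Qed.

Lemma drain1_sem a b c d e :
  sem drain1 (Stacks a b c d e) (Stacks (rev b ++ a) [::] c d e) (2 * size b + 1).
Proof.
elim: b a => [|x b IH] a; first exact: sem_loop0.
apply: sem_eq; first (apply: sem_loop; [by []|exact: sem_push|exact: IH]); last (simpl; lia).
by rewrite /= rev_cons cat_rcons.
Qed.

Lemma drain3_sem a b c d e :
  sem drain3 (Stacks a b c d e) (Stacks (rev d ++ a) b c [::] e) (2 * size d + 1).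
Proof.
elim: d a => [|x d IH] a; first exact: sem_loop0.
apply: sem_eq; first (apply: sem_loop; [by []|exact: sem_push|exact: IH]); last (simpl; lia).
by rewrite /= rev_cons cat_rcons.
Qed.

Lemma drain31_sem a b c d e :
  sem drain31 (Stacks a b c d e) (Stacks a (rev d ++ b) c [::] e) (2 * size d + 1).
Proof.
elim: d b => [|x d IH] b; first exact: sem_loop0.
apply: sem_eq; first (apply: sem_loop; [by []|exact: sem_push|exact: IH]); last (simpl; lia).
by rewrite /= rev_cons cat_rcons.
Qed.

Lemma drain103_sem a b c d e :
  sem drain103 (Stacks a b c d e) (Stacks (rev b ++ a) [::] c (rev b ++ d) e) (3 * size b + 1).
Proof.
elim: b a d => [|x b IH] a d; first exact: sem_loop0.
apply: sem_eq.
- apply: sem_loop; [by []|apply: sem_seq; exact: sem_push|exact: IH].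
- by rewrite /= rev_cons !cat_rcons.
- by simpl; lia.
Qed.

Definition main r : stacks := Stacks r [::] [::] [::] [::].

Definition drop_top : stmt := Seq (move K1) clear1.
Lemma drop_top_sem x r : sem drop_top (main (ser x ++ r)) (main r) (7 * sz x + 3).
Proof.
apply: sem_eq; first (apply: sem_seq; [apply: move_sem; by left|exact: clear1_sem]).
  by [].
rewrite /= cats0 size_rev -/(sz x); lia.
Qed.

Definition dup_top : stmt := Seq (move K1) (Seq drain103 (Seq drain31 drain1)).
Lemma dup_top_sem x r :
  sem dup_top (main (ser x ++ r)) (main (ser x ++ ser x ++ r)) (12 * sz x + 5).
Proof.
apply: sem_eq.
- apply: sem_seq; first by apply: move_sem; left.
  apply: sem_seq; first exact: drain103_sem.
  apply: sem_seq; [exact: drain31_sem|exact: drain1_sem].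
- by rewrite /= !cats0 !revK.
- rewrite /= !cats0 !size_rev -/(sz x); lia.
Qed.

Definition swap_top : stmt := Seq (move K1) (Seq (move K3) (Seq drain1 drain3)).
Lemma swap_top_sem x y r :
  sem swap_top (main (ser x ++ ser y ++ r)) (main (ser y ++ ser x ++ r)) (7 * (sz x + sz y) + 6).
Proof.
apply: sem_eq.
- apply: sem_seq; first by apply: move_sem; left.
  apply: sem_seq; first by apply: move_sem; right.
  apply: sem_seq; [exact: drain1_sem|exact: drain3_sem].
- by rewrite /= !cats0 !revK.
- rewrite /= !cats0 !size_rev -/(sz x) -/(sz y); lia.
Qed.

Definition cmp_loop : stmt := Loop K1 (fun z => Pop K3 (fun o =>
  if o == Some z then Skip else Push K2 S1)).
(** A mismatch only leaves a mark on [K2], so the loop always runs until [K1] is empty. The compared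
    stacks agree exactly if neither a mark was added nor a remainder is left on [K3]. *)
Lemma cmp_loop_sem a b c d e : exists b' d' n,
  [/\ sem cmp_loop (Stacks a b c d e) (Stacks a [::] b' d' e) n,
      (nilp b' && nilp d') = nilp c && (b == d), n <= 3 * size b + 1,
      size b' <= size c + size b & size d' <= size d].
Proof.
elim: b c d => [|x b IH] c d.
  exists c, d, 1; split=> //; [exact: sem_loop0|by case: d|lia].
case: d => [|y d].
  have [b' [d' [n [H1 H2 H3 H4 H5]]]] := IH (S1 :: c) [::].
  exists b', d', (2 + n).+1; split.
  - apply: sem_loop; [by []| |exact: H1]; apply: sem_pop0; [by []|exact: sem_push].
  - by rewrite H2 andbF.
  - by move=> /=; lia.
  - by move: H4 => /=; lia.
  - by [].
have [E|ne] := altP (x =P y).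
  have [b' [d' [n [H1 H2 H3 H4 H5]]]] := IH c d.
  exists b', d', (2 + n).+1; split.
  - apply: sem_loop; [by []| |exact: H1]; apply: sem_pop; first by [].
    by rewrite E eqxx; exact: sem_skip.
  - by rewrite H2 eqseq_cons E eqxx.
  - by move=> /=; lia.
  - by move: H4 => /=; lia.
  - by move: H5 => /=; lia.
have [b' [d' [n [H1 H2 H3 H4 H5]]]] := IH (S1 :: c) d.
exists b', d', (2 + n).+1; split.
- apply: sem_loop; [by []| |exact: H1]; apply: sem_pop; first by [].
  have -> : (Some y == Some x) = false by apply/negbTE; apply: contra ne => /eqP[->].
  exact: sem_push.
- by rewrite H2 eqseq_cons (negbTE ne) /= andbF.
- by move=> /=; lia.
- by move: H4 => /=; lia.
- by move: H5 => /=; lia.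
Qed.

Definition beq x y := if x == y then tru else Lf.

Definition fin_true : stmt := Seq (Push K0 S0) (Seq (Push K0 S0) (Push K0 S1)).
Definition cmp : stmt :=
  Seq (move K1) (Seq (move K3) (Seq cmp_loop
  (Seq (Loop K3 (fun _ => Push K2 S1))
   (Pop K2 (fun o => if o is None then fin_true
                     else Seq (Loop K2 (fun _ => Skip)) (Push K0 S0)))))).

Lemma loop3_sem a c d e :
  sem (Loop K3 (fun _ => Push K2 S1)) (Stacks a [::] c d e)
      (Stacks a [::] (nseq (size d) S1 ++ c) [::] e) (2 * size d + 1).
Proof.
elim: d c => [|x d IH] c; first exact: sem_loop0.
apply: sem_eq; first (apply: sem_loop; [by []|exact: sem_push|exact: IH]); last (simpl; lia).
by rewrite /=; congr Stacks; elim: (size d) => //= n ->.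
Qed.

Lemma loop2_sem a c :
  sem (Loop K2 (fun _ => Skip)) (Stacks a [::] c [::] [::]) (main a) (2 * size c + 1).
Proof.
elim: c => [|x c IH]; first exact: sem_loop0.
by apply: sem_eq; first (apply: sem_loop; [by []|exact: sem_skip|exact: IH]); last (simpl; lia).
Qed.

Lemma cmp_sem x y r : exists2 n, n <= 50 * (sz x + sz y) &
  sem cmp (main (ser x ++ ser y ++ r)) (main (ser (beq x y) ++ r)) n.
Proof.
have [b' [d' [n [H1 H2 H3 H4 H5]]]] :=
  cmp_loop_sem r (rev (ser x)) [::] (rev (ser y)) [::].
have E : (x == y) = nilp (nseq (size d') S1 ++ b').
  have -> : nilp (nseq (size d') S1 ++ b') = nilp b' && nilp d' by case: (d'); case: (b').
  rewrite H2 /=; apply/eqP/eqP => [->//|/(can_inj revK)]; exact: ser_inj.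
move: H3 H4 H5; rewrite !size_rev -/(sz x) -/(sz y) => H3 H4 H5.
have szx := sz_gt0 x; have szy := sz_gt0 y.
rewrite /beq E; have Hc : size (nseq (size d') S1 ++ b') <= sz x + sz y.
  by rewrite size_cat size_nseq; move: H4 => /=; lia.
have H0 := loop3_sem r b' d' [::].
case: (nseq _ _ ++ b') E H0 Hc => [|c0 c] E H0 Hc.
  eexists; last first.
    apply: sem_seq; first by apply: move_sem; left.
    apply: sem_seq; first by apply: move_sem; right.
    rewrite /= !cats0.
    apply: sem_seq; first exact: H1.
    apply: sem_seq; first exact: H0.
    apply: sem_pop0; first by [].
    apply: sem_seq; first exact: sem_push.
    by apply: sem_seq; exact: sem_push.
  lia.
eexists; last first.
  apply: sem_seq; first by apply: move_sem; left.
  apply: sem_seq; first by apply: move_sem; right.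
  rewrite /= !cats0.
  apply: sem_seq; first exact: H1.
  apply: sem_seq; first exact: H0.
  apply: sem_pop; first by [].
  apply: sem_seq; first exact: loop2_sem.
  exact: sem_push.
move: Hc => /=; lia.
Qed.

End Prims.

(** * Functions on trees with running times *)

(** The rest [r] of the stack is arbitrary, so intermediate results can be parked below the current
    argument; the other four stacks are free again after each call. *)
Definition Comp (F : tree -> tree) (T : tree -> nat) :=
  exists p, forall x r, exists2 n, n <= T x & sem p (main (ser x ++ r)) (main (ser (F x) ++ r)) n.

Lemma main_Nd a b r : main (ser (Nd a b) ++ r) = main (S1 :: ser a ++ ser b ++ r).
Proof. by rewrite /= -catA. Qed.

Lemma Comp_ext F G T U : F =1 G -> (forall x, T x <= U x) -> Comp F T -> Comp G U.
Proof.
move=> E le [p H]; exists p => x r; rewrite -E; have [n h1 h2] := H x r.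
by exists n => //; apply: leq_trans h1 (le x).
Qed.

Lemma Comp_id : Comp id (fun => 1).
Proof. by exists Skip => x r; exists 1 => //; apply: sem_skip. Qed.

Lemma Comp_comp F G T U : Comp F T -> Comp G U ->
  Comp (fun x => F (G x)) (fun x => U x + T (G x)).
Proof.
move=> [p H] [q K]; exists (Seq q p) => x r.
have [n hn Hn] := K x r; have [m hm Hm] := H (G x) r.
by exists (n + m); [lia|apply: sem_seq Hn Hm].
Qed.

Lemma Comp_Lf : Comp (fun => Lf) (fun x => 8 * sz x + 4).
Proof.
exists (Seq drop_top (Push K0 S0)) => x r; exists (7 * sz x + 3 + 1); first lia.
by apply: sem_seq (drop_top_sem _ _) (sem_push _ _ _).
Qed.

Lemma Comp_hd : Comp hd (fun x => 16 * sz x + 20).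
Proof.
exists (Pop K0 (fun o => if o == Some S1 then Seq swap_top drop_top else Push K0 S0)).
case=> [|a b] r.
  by exists 2 => //; apply: sem_pop; [by []|exact: sem_push].
exists (7 * (sz a + sz b) + 6 + (7 * sz b + 3)).+1; first by rewrite sz_Nd; lia.
rewrite main_Nd; apply: sem_pop; first by [].
exact: sem_seq (swap_top_sem _ _ _) (drop_top_sem _ _).
Qed.

Lemma Comp_tl : Comp tl (fun x => 8 * sz x + 4).
Proof.
exists (Pop K0 (fun o => if o == Some S1 then drop_top else Push K0 S0)).
case=> [|a b] r.
  by exists 2 => //; apply: sem_pop; [by []|exact: sem_push].
exists (7 * sz a + 3).+1; first by rewrite sz_Nd; lia.
by rewrite main_Nd; apply: sem_pop; [by []|exact: drop_top_sem].
Qed.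

Lemma Comp_Nd F G T U : Comp F T -> Comp G U ->
  Comp (fun x => Nd (F x) (G x)) (fun x => T x + U x + 40 * (sz x + sz (F x) + sz (G x))).
Proof.
move=> [p H] [q K]; exists (Seq dup_top (Seq p (Seq swap_top (Seq q (Seq swap_top (Push K0 S1)))))) => x r.
have [n hn Hn] := H x (ser x ++ r); have [m hm Hm] := K x (ser (F x) ++ r).
eexists; last first.
  apply: sem_seq; first exact: dup_top_sem.
  apply: sem_seq; first exact: Hn.
  apply: sem_seq; first exact: swap_top_sem.
  apply: sem_seq; first exact: Hm.
  apply: sem_seq; first exact: swap_top_sem.
  apply: sem_eq; [exact: sem_push| |by []].
  by rewrite /= -catA.
have := sz_gt0 x; have := sz_gt0 (F x); lia.
Qed.

Lemma Comp_beq F G T U : Comp F T -> Comp G U ->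
  Comp (fun x => beq (F x) (G x)) (fun x => T x + U x + 100 * (sz x + sz (F x) + sz (G x))).
Proof.
move=> [p H] [q K]; exists (Seq dup_top (Seq p (Seq swap_top (Seq q (Seq swap_top cmp))))) => x r.
have [n hn Hn] := H x (ser x ++ r); have [m hm Hm] := K x (ser (F x) ++ r).
have [l hl Hl] := cmp_sem (F x) (G x) r.
eexists; last first.
  apply: sem_seq; first exact: dup_top_sem.
  apply: sem_seq; first exact: Hn.
  apply: sem_seq; first exact: swap_top_sem.
  apply: sem_seq; first exact: Hm.
  apply: sem_seq; first exact: swap_top_sem.
  exact: Hl.
have := sz_gt0 x; have := sz_gt0 (F x); lia.
Qed.

Lemma Comp_if C F G T U V : Comp C T -> Comp F U -> Comp G V ->
  Comp (fun x => if isnd (C x) then F x else G x)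
       (fun x => T x + U x + V x + 30 * (sz x + sz (C x))).
Proof.
move=> [c H] [p K] [q L].
exists (Seq dup_top (Seq c (Pop K0 (fun o => if o == Some S1
    then Seq (Push K0 S1) (Seq drop_top p) else q)))) => x r.
have [n hn Hn] := H x (ser x ++ r).
have [m hm Hm] := K x r; have [l hl Hl] := L x r; have szx := sz_gt0 x.
case: (C x) Hn => [|a b] Hn.
  exists (12 * sz x + 5 + (n + l.+1)); first lia.
  apply: sem_seq (dup_top_sem _ _) _; apply: sem_seq Hn _.
  by apply: sem_pop; [by []|exact: Hl].
exists (12 * sz x + 5 + (n + (1 + (7 * sz (Nd a b) + 3 + m)).+1)); first lia.
apply: sem_seq (dup_top_sem _ _) _; apply: sem_seq Hn _.
rewrite main_Nd; apply: sem_pop; first by [].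
apply: sem_seq; first exact: sem_push.
by rewrite /= -[Stacks _ _ _ _ _]/(main _) -main_Nd; exact: sem_seq (drop_top_sem (Nd a b) _) Hm.
Qed.

(** The only loops are over stacks, so [K2] is used as a flag: [peek] strips the root of the counter
    and raises the flag if the counter is a node. The loop has consumed the flag when the program
    for [F] runs, which therefore finds [K2] empty. *)
Lemma Comp_iter F T : Comp F T ->
  Comp (fun x => iter (len (hd x)) F (tl x))
       (fun x => \sum_(i < len (hd x)) T (iter i F (tl x)) +
          50 * (len (hd x)).+1 * (sz x + \max_(i < (len (hd x)).+1) sz (iter i F (tl x)))).
Proof.
move=> [p H].
pose peek := Pop K0 (fun o => if o == Some S1 then Push K2 S1 else Skip).
pose body := Seq drop_top (Seq swap_top (Seq p (Seq swap_top peek))).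
exists (Pop K0 (fun o => if o == Some S1 then Seq peek (Loop K2 (fun _ => body)) else Push K0 S0)).
have loopP t : forall x r, exists2 n,
    n <= \sum_(i < len t) T (iter i F x) +
         40 * (len t).+1 * (sz t + \max_(i < (len t).+1) sz (iter i F x)) &
    exists2 n1, n1 <= 2 & exists2 s, sem peek (main (ser t ++ ser x ++ r)) s n1 &
    sem (Loop K2 (fun _ => body)) s (main (ser (iter (len t) F x) ++ r)) n.
  elim: t => [|a _ b IH] x r.
    exists 1; first by have := sz_gt0 Lf; lia.
    exists 2 => //; exists (main (ser x ++ r)); last exact: sem_loop0.
    by apply: sem_pop; [by []|exact: sem_skip].
  have [n hn [n1 hn1 [s Hs1 Hs2]]] := IH (F x) r.
  have [m hm Hm] := H x (ser b ++ r).
  pose M := \max_(i < (len b).+2) sz (iter i F x).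
  have M0 : sz x <= M by apply: (leq_bigmax (F := fun i : 'I__ => sz (iter i F x)) ord0).
  have M1 : sz (F x) <= M.
    by apply: (leq_bigmax (F := fun i : 'I_(len b).+2 => sz (iter i F x)) (inord 1) _)
       || (have := leq_bigmax (F := fun i : 'I_(len b).+2 => sz (iter i F x)) (inord 1);
           rewrite inordK).
  have hM : \max_(i < (len b).+1) sz (iter i F (F x)) <= M.
    apply/bigmax_leqP => i _; rewrite -iterSr.
    exact: (leq_bigmax (F := fun i : 'I_(len b).+2 => sz (iter i F x)) (lift ord0 i)).
  have hS : \sum_(i < (len b).+1) T (iter i F x) = T x + \sum_(i < len b) T (iter i F (F x)).
    by rewrite big_ord_recl; congr (_ + _); apply: eq_bigr => i _; rewrite -iterSr.
  exists ((7 * sz a + 3 + (7 * (sz b + sz x) + 6 + (m + (7 * (sz (F x) + sz b) + 6 + n1)))) + n).+1.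
    rewrite [len _]/= -/M hS sz_Nd.
    have hp : 40 * (len b).+1 * (sz b + \max_(i < (len b).+1) sz (iter i F (F x)))
           <= 40 * (len b).+1 * (sz b + M) by rewrite leq_mul2l leq_add2l hM orbT.
    have -> : 40 * (len b).+2 * ((sz a + sz b).+1 + M) =
       40 * (len b).+1 * (sz b + M) + 40 * (len b).+1 * (sz a).+1 + 40 * ((sz a + sz b).+1 + M).
      nia.
    lia.
  exists 2 => //; exists (Stacks (ser a ++ ser b ++ ser x ++ r) [::] [:: S1] [::] [::]).
    by rewrite main_Nd; apply: sem_pop; [by []|apply: sem_eq; first exact: sem_push].
  rewrite [len _]/= iterSr.
  apply: sem_loop; [by []| |exact: Hs2].
  apply: sem_seq; first exact: drop_top_sem.
  apply: sem_seq; first exact: swap_top_sem.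
  apply: sem_seq; first exact: Hm.
  by apply: sem_seq; first exact: swap_top_sem.
case=> [|t x] r.
  exists 2; first by have := sz_gt0 Lf; simpl; lia.
  by apply: sem_pop; [by []|exact: sem_push].
have [n hn [n1 hn1 [s Hs1 Hs2]]] := loopP t x r.
exists (n1 + n).+1.
  rewrite [hd _]/= [tl _]/= sz_Nd.
  have : 40 * (len t).+1 * (sz t + \max_(i < (len t).+1) sz (iter i F x)) + 10
     <= 50 * (len t).+1 * ((sz t + sz x).+1 + \max_(i < (len t).+1) sz (iter i F x)).
    by nia.
  lia.
rewrite main_Nd; apply: sem_pop; first by [].
exact: sem_seq Hs1 Hs2.
Qed.

(** * Closure properties of polynomial time *)

Lemma leq_expl m n k : m <= n -> m ^ k <= n ^ k.
Proof. by case: k => // k le; rewrite leq_exp2r. Qed.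

Section PolyBounded.
Variables (A : Type) (mu : A -> nat).

(** The base is at least 2, so sums and constants are absorbed by a larger exponent and no
    coefficients are needed. *)
Definition poly_bounded (f : A -> nat) := exists k, forall x, f x <= (mu x + 2) ^ k.

Lemma exp_mu_leq x k l : k <= l -> (mu x + 2) ^ k <= (mu x + 2) ^ l.
Proof. by move=> le; rewrite leq_exp2l // addn2. Qed.

Lemma pb_le f g : (forall x, f x <= g x) -> poly_bounded g -> poly_bounded f.
Proof. by move=> le [k H]; exists k => x; apply: leq_trans (H x). Qed.

Lemma pb_const c : poly_bounded (fun => c).
Proof.
exists c => x; apply: leq_trans (ltnW (ltn_expl c (isT : 1 < 2))) _.
by apply: leq_expl; rewrite leq_addl.
Qed.

Lemma pb_mu : poly_bounded mu.
Proof. by exists 1 => x; rewrite expn1 leq_addr. Qed.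

Lemma pb_mul f g : poly_bounded f -> poly_bounded g -> poly_bounded (fun x => f x * g x).
Proof. by move=> [k H] [l K]; exists (k + l) => x; rewrite expnD leq_mul. Qed.

Lemma pb_add f g : poly_bounded f -> poly_bounded g -> poly_bounded (fun x => f x + g x).
Proof.
move=> [k H] [l K]; exists (maxn k l).+1 => x.
apply: (@leq_trans ((mu x + 2) ^ maxn k l + (mu x + 2) ^ maxn k l)).
  apply: leq_add; first exact: leq_trans (H x) (exp_mu_leq _ (leq_maxl _ _)).
  exact: leq_trans (K x) (exp_mu_leq _ (leq_maxr _ _)).
rewrite addnn -mul2n expnS leq_mul2r; apply/orP; right; lia.
Qed.

Lemma pb_exp f k : poly_bounded f -> poly_bounded (fun x => f x ^ k).
Proof.
move=> Hf; elim: k => [|k IH]; first exact: pb_const.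
by apply: pb_le (pb_mul Hf IH) => x; rewrite expnS.
Qed.

Lemma pb_len (F : A -> tree) :
  poly_bounded (fun x => sz (F x)) -> poly_bounded (fun x => len (F x)).
Proof. by apply: pb_le => x; apply: ltnW; apply: len_sz. Qed.
End PolyBounded.

Lemma pb_comp A (mu : A -> nat) f G : poly_bounded sz f -> poly_bounded mu (fun x => sz (G x)) ->
  poly_bounded mu (fun x => f (G x)).
Proof.
move=> [k H] HG.
apply: (pb_le (g := fun x => (sz (G x) + 2) ^ k)) => [x|]; first exact: H.
exact: pb_exp (pb_add HG (pb_const _ 2)).
Qed.

(** The size of the value is bounded as well, since a composition evaluates the time bound of the
    outer function at the value of the inner one. *)
Definition FP (F : tree -> tree) :=
  (exists2 T, Comp F T & poly_bounded sz T) /\ poly_bounded sz (fun x => sz (F x)).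

Lemma FP_sz F : FP F -> poly_bounded sz (fun x => sz (F x)). Proof. by case. Qed.

Ltac pb := repeat first [exact: pb_mu | assumption | apply: FP_sz; assumption
  | apply: pb_const | apply: pb_add | apply: pb_mul
  | apply: pb_len | apply: pb_exp ].

Lemma FP_id : FP (fun x => x).
Proof. by split; [exists (fun => 1); [exact: Comp_id|pb]|pb]. Qed.

Lemma FP_comp F G : FP F -> FP G -> FP (fun x => F (G x)).
Proof.
move=> [[T HT pT] pF] [[U HU pU] pG]; split; last exact: (@pb_comp _ sz (fun x => sz (F x))).
exists (fun x => U x + T (G x)); first exact: Comp_comp.
by apply: pb_add => //; apply: (@pb_comp _ sz T).
Qed.

Lemma FP_Lf : FP (fun => Lf).
Proof. by split; [exists (fun x => 8 * sz x + 4); [exact: Comp_Lf|pb]|pb]. Qed.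

Lemma FP_Nd F G : FP F -> FP G -> FP (fun x => Nd (F x) (G x)).
Proof.
move=> [[T HT pT] pF] [[U HU pU] pG]; split.
  by exists (fun x => T x + U x + 40 * (sz x + sz (F x) + sz (G x))); [exact: Comp_Nd|pb].
by apply: (pb_le (g := fun x => sz (F x) + sz (G x) + 1)) => [x|]; [rewrite sz_Nd; lia|pb].
Qed.

Lemma FP_const t : FP (fun => t).
Proof. by elim: t => [|a IHa b IHb]; [exact: FP_Lf|exact: FP_Nd]. Qed.

Lemma FP_hd F : FP F -> FP (fun x => hd (F x)).
Proof.
apply: (@FP_comp hd); split; first by exists (fun x => 16 * sz x + 20); [exact: Comp_hd|pb].
by apply: pb_le (pb_mu sz) => x; exact: sz_hd.
Qed.

Lemma FP_tl F : FP F -> FP (fun x => tl (F x)).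
Proof.
apply: (@FP_comp tl); split; first by exists (fun x => 8 * sz x + 4); [exact: Comp_tl|pb].
by apply: pb_le (pb_mu sz) => x; exact: sz_tl.
Qed.

Lemma FP_beq F G : FP F -> FP G -> FP (fun x => beq (F x) (G x)).
Proof.
move=> [[T HT pT] pF] [[U HU pU] pG]; split.
  by exists (fun x => T x + U x + 100 * (sz x + sz (F x) + sz (G x))); [exact: Comp_beq|pb].
by apply: (pb_le (g := fun => 3)) => [x|]; [rewrite /beq; case: ifP|pb].
Qed.

Definition tif (c a b : tree) := if isnd c then a else b.

Lemma FP_tif C F G : FP C -> FP F -> FP G -> FP (fun x => tif (C x) (F x) (G x)).
Proof.
move=> [[T HT pT] pC] [[U HU pU] pF] [[V HV pV] pG]; split.
  by exists (fun x => T x + U x + V x + 30 * (sz x + sz (C x))); [exact: Comp_if|pb].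
by apply: (pb_le (g := fun x => sz (F x) + sz (G x))) => [x|];
   [rewrite /tif; case: ifP; lia|pb].
Qed.

Definition un n := iter n (Nd Lf) Lf.
Lemma len_un n : len (un n) = n. Proof. by elim: n => //= n ->. Qed.
Lemma sz_un n : sz (un n) = n.*2.+1.
Proof. by elim: n => //= n IH; rewrite sz_Nd IH /sz /=; lia. Qed.

(** The index runs downwards to 0, so that the remaining unary loop counter is itself the index
    passed to [F]; [iter_for] is this observation. *)
Definition tfor (n : tree) (F : tree -> tree -> tree) (a : tree) : tree :=
  foldr (fun i acc => F (un i) acc) a (iota 0 (len n)).

Definition tfor_states (N : nat) (F : tree -> tree -> tree) a (S : nat) :=
  forall l, all (fun i => i < N) l -> size l <= N ->
    sz (foldr (fun i acc => F (un i) acc) a l) <= S.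

Lemma Comp_unlen : exists2 T, Comp (fun x => un (len x)) T & poly_bounded sz T.
Proof.
pose st (x : tree) := Nd x Lf.
have [[T HT pT] pS] : FP (fun x => Nd Lf x) by apply: FP_Nd; [exact: FP_Lf|exact: FP_id].
have [[U HU pU] _] : FP st by apply: FP_Nd; [exact: FP_id|exact: FP_Lf].
have H := Comp_comp (Comp_iter HT) HU.
eexists; first exact: H.
have pst : poly_bounded sz (fun x => sz (st x)).
  by apply: (pb_le (g := fun x => sz x + 2)) => [x|]; [rewrite sz_Nd /sz /=; lia|pb].
have [k Hk] := pT.
apply: (pb_le (g := fun x => U x + (sz x * (2 * sz x + 4) ^ k + 50 * (sz x + 1) * (sz (st x) + (2 * sz x + 4))))).
  move=> x /=; have lx := len_sz x; rewrite leq_add2l; apply: leq_add.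
    apply: (@leq_trans (\sum_(i < len x) (2 * sz x + 4) ^ k)).
      apply: leq_sum => i _; apply: leq_trans (Hk _) _; apply: leq_expl.
      by rewrite -[iter i _ _]/(un i) sz_un; have := ltn_ord i; lia.
    by rewrite sum_nat_const card_ord leq_mul2r; apply/orP; right; lia.
  apply: leq_mul; first by rewrite leq_mul2l; lia.
  rewrite leq_add2l; apply/bigmax_leqP => i _; rewrite -[iter i _ _]/(un i) sz_un; have := ltn_ord i; lia.
pb.
Qed.

Lemma FP_unlen F : FP F -> FP (fun x => un (len (F x))).
Proof.
apply: (@FP_comp (fun x => un (len x))); split; first exact: Comp_unlen.
apply: (pb_le (g := fun x => 2 * sz x)) => [x|]; last by pb.
by rewrite sz_un; have := len_sz x; lia.
Qed.

Lemma iter_for (F : tree -> tree -> tree -> tree) x a m c :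
  iter m (fun p => Nd (hd p) (Nd (tl (hd (tl p)))
      (F (hd p) (tl (hd (tl p))) (tl (tl p))))) (Nd x (Nd (un (c + m)) a)) =
  Nd x (Nd (un c) (foldr (fun i acc => F x (un i) acc) a (iota c m))).
Proof.
by elim: m c => [|m IH] c; rewrite ?addn0 // iterS addnS -addSn IH.
Qed.

Definition FP2 (F : tree -> tree -> tree) := FP (fun p => F (hd p) (tl p)).
Definition FP3 (F : tree -> tree -> tree -> tree) :=
  FP (fun p => F (hd p) (hd (tl p)) (tl (tl p))).

(** Separate from [FP_tfor] because the bound [S] on the intermediate results may be exponential, as
    it is for parsing and for the list of nodes. *)
Lemma Comp_tfor n F a : FP n -> FP3 F -> FP a ->
  exists T k, Comp (fun x => tfor (n x) (F x) (a x)) T /\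
    forall x S, tfor_states (len (n x)) (F x) (a x) S -> T x <= (sz x + S + 2) ^ k.
Proof.
move=> Hn HF Ha.
pose step p := Nd (hd p) (Nd (tl (hd (tl p))) (F (hd p) (tl (hd (tl p))) (tl (tl p)))).
have Hstep : FP step.
  apply: FP_Nd; first exact: FP_hd FP_id.
  have HH := FP_hd (FP_tl FP_id).
  apply: FP_Nd; first exact: FP_tl HH.
  have HG : FP (fun p => Nd (hd p) (Nd (tl (hd (tl p))) (tl (tl p)))).
    apply: FP_Nd; [exact: FP_hd FP_id|apply: FP_Nd; [exact: FP_tl HH|exact: FP_tl (FP_tl FP_id)]].
  exact: (FP_comp HF HG).
pose G x := Nd (n x) (Nd x (Nd (un (len (n x))) (a x))).
have HG : FP G.
  apply: FP_Nd => //; apply: FP_Nd; first exact: FP_id.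
  by apply: FP_Nd => //; apply: FP_unlen.
case: HG => [[U HU pU] pG]; case: Hstep => [[T HT pT] _].
have pn := pb_len (FP_sz Hn).
have H1 := Comp_comp (Comp_iter HT) HU.
have H2 := Comp_comp Comp_tl H1; have H3 := Comp_comp Comp_tl H2.
have E x i : i <= len (n x) -> iter i step (tl (G x)) =
    Nd x (Nd (un (len (n x) - i)) (foldr (fun i acc => F x (un i) acc) (a x) (iota (len (n x) - i) i))).
  by move=> le; have := iter_for F x (a x) i (len (n x) - i); rewrite subnK // => ->.
have Ef x : tl (tl (iter (len (hd (G x))) step (tl (G x)))) = tfor (n x) (F x) (a x).
  by rewrite E //= subnn.
pose Tf x := 8 * sz (tl (iter (len (hd (G x))) step (tl (G x)))) + 4 +
   (8 * sz (iter (len (hd (G x))) step (tl (G x))) + 4 + (U x +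
    (\sum_(i < len (hd (G x))) T (iter i step (tl (G x))) +
          50 * (len (hd (G x))).+1 * (sz (G x) + \max_(i < (len (hd (G x))).+1) sz (iter i step (tl (G x))))))).
(* Pairing the argument with [S] makes [S] a second size parameter, so that the calculus of
   [poly_bounded] yields one exponent for all [S]. *)
pose mu2 (z : tree * nat) := sz z.1 + z.2.
have lift f : poly_bounded sz f -> poly_bounded mu2 (fun z => f z.1).
  move=> [k H]; exists k => z; apply: leq_trans (H _) _; apply: leq_expl; rewrite /mu2; lia.
have [kT HkT] := pT.
pose M (z : tree * nat) := sz z.1 + (2 * len (n z.1)) + z.2 + 3.
have pM : poly_bounded mu2 M.
  have P1 : poly_bounded mu2 (fun z => sz z.1) by apply: (lift sz); exact: pb_mu.
  have P2 : poly_bounded mu2 (fun z => len (n z.1)) by apply: (lift (fun x => len (n x))).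
  have P3 : poly_bounded mu2 (fun z => z.2) by apply: pb_le (pb_mu mu2) => z; rewrite /mu2; lia.
  by rewrite /M; pb.
have [k Hk] : poly_bounded mu2 (fun z => 16 * M z + 8 + U z.1 + len (n z.1) * (M z + 2) ^ kT
      + 50 * (len (n z.1) + 1) * (sz (G z.1) + M z)).
  have P1 := lift _ pU; have P2 := lift _ pG; have P3 := lift _ pn.
  by pb.
exists Tf, k; split.
  by apply: Comp_ext H3 => [x|x]; [exact: Ef|rewrite /Tf; lia].
move=> x S HS; apply: leq_trans (Hk (x, S)); rewrite /=.
have Hst i : i <= len (n x) -> sz (iter i step (tl (G x))) <= M (x, S).
  move=> le; rewrite E // !sz_Nd sz_un /M /=.
  have := HS (iota (len (n x) - i) i); rewrite size_iota => /(_ _ le) H.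
  have {H} := H _; rewrite (_ : all _ _) => [/(_ isT)|]; first lia.
  by apply/allP => j; rewrite mem_iota; lia.
have HstN := Hst _ (leqnn _).
rewrite /Tf [hd (G x)]/=.
have h1 : sz (tl (iter (len (n x)) step (tl (G x)))) <= M (x, S).
  exact: leq_trans (sz_tl _) HstN.
have h2 : \sum_(i < len (n x)) T (iter i step (tl (G x))) <= len (n x) * (M (x, S) + 2) ^ kT.
  rewrite -[X in _ <= X * _]card_ord -sum_nat_const; apply: leq_sum => i _.
  apply: leq_trans (HkT _) _; apply: leq_expl; rewrite leq_add2r; apply: Hst; exact: ltnW.
have h3 : \max_(i < (len (n x)).+1) sz (iter i step (tl (G x))) <= M (x, S).
  by apply/bigmax_leqP => i _; apply: Hst; rewrite -ltnS.
have h4 : 50 * (len (n x)).+1 * (sz (G x) + \max_(i < (len (n x)).+1) sz (iter i step (tl (G x))))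
  <= 50 * (len (n x) + 1) * (sz (G x) + M (x, S)).
  by rewrite addn1 leq_mul2l leq_add2l h3 orbT.
lia.
Qed.

Lemma FP_tfor n F a : FP n -> FP3 F -> FP a ->
  (exists2 S, poly_bounded sz S & forall x, tfor_states (len (n x)) (F x) (a x) (S x)) ->
  FP (fun x => tfor (n x) (F x) (a x)).
Proof.
move=> Hn HF Ha [S pS HS]; have [T [k [HT Hk]]] := Comp_tfor Hn HF Ha; split.
  exists T => //.
  by apply: (pb_le (g := fun x => (sz x + S x + 2) ^ k)) => [x|]; [exact: Hk|pb].
apply: pb_le pS => x; apply: HS; last by rewrite size_iota.
by apply/allP => i; rewrite mem_iota.
Qed.

(* The general way to bound a loop: a measure [mu] of the accumulator that
   grows additively, and that controls its size. *)
Lemma FP_tfor_mu (mu : tree -> nat) n F a : FP n -> FP3 F -> FP a ->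
  poly_bounded sz (fun x => mu (a x)) ->
  (exists2 P, poly_bounded sz P & forall x i acc, i < len (n x) ->
     mu (F x (un i) acc) <= mu acc + P x) ->
  (exists k, forall x i acc, i < len (n x) ->
     sz (F x (un i) acc) <= (mu (F x (un i) acc) + sz x + 2) ^ k) ->
  FP (fun x => tfor (n x) (F x) (a x)).
Proof.
move=> Hn HF Ha pa [P pP HP] [k Hk]; apply: FP_tfor => //.
have pn := pb_len (FP_sz Hn); have pas := FP_sz Ha.
exists (fun x => sz (a x) + (mu (a x) + len (n x) * P x + sz x + 2) ^ k); first by pb.
move=> x l; case: l => [|i l] /=; first by lia.
move=> /andP[lti Hl] lsz; apply: leq_trans (Hk _ _ _ lti) _.
apply: leq_trans (leq_addl _ _); apply: leq_expl; rewrite !leq_add2r.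
apply: leq_trans (HP _ _ _ lti) _.
have {lsz} lsz : (size l).+1 * P x <= len (n x) * P x by rewrite leq_mul2r lsz orbT.
suff : mu (foldr (fun i acc => F x (un i) acc) (a x) l) <= mu (a x) + size l * P x by lia.
elim: l Hl {lsz} => [|j l IH] /=; first by lia.
move=> /andP[ltj /IH H]; have := HP _ _ (foldr (fun i acc => F x (un i) acc) (a x) l) ltj; lia.
Qed.

Lemma sz_Lf : sz Lf = 1. Proof. by []. Qed.

Lemma FP_bound2 F : FP2 F -> exists k, forall x i, sz (F x i) <= (sz x + sz i + 3) ^ k.
Proof. by move=> [_ [k H]]; exists k => x i; have := H (Nd x i); rewrite sz_Nd addSnnS. Qed.

(** The increment does not depend on the accumulator, which is what keeps the result polynomial; a
    constant factor per round would already allow exponential growth. *)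
Lemma FP_tfor_add n F a : FP n -> FP3 F -> FP a ->
  (exists k, forall x i acc, sz (F x i acc) <= sz acc + (sz x + sz i + 3) ^ k) ->
  FP (fun x => tfor (n x) (F x) (a x)).
Proof.
move=> Hn HF Ha [k Hk]; have pn := pb_len (FP_sz Hn).
apply: (FP_tfor_mu (mu := sz)) => //; first exact: FP_sz.
  exists (fun x => (sz x + 2 * len (n x) + 3) ^ k); first by pb.
  move=> x i acc lt; apply: leq_trans (Hk _ _ _) _; rewrite leq_add2l; apply: leq_expl.
  by rewrite sz_un; lia.
by exists 1 => x i acc _; rewrite expn1; lia.
Qed.

(* Goals are matched syntactically: up to conversion, [FP_tl] would also apply
   to functions that merely unfold to a tail. *)
Ltac fp_custom := fail.
Ltac fp1 := match goal with
  | |- FP (fun x => x) => apply: FP_id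
  | |- FP (fun x => ?c) => apply: (@FP_const c)
  | |- FP (fun x => hd (@?f x)) => apply: (@FP_hd f)
  | |- FP (fun x => tl (@?f x)) => apply: (@FP_tl f)
  | |- FP (fun x => Nd (@?f x) (@?g x)) => apply: (@FP_Nd f g)
  | |- FP (fun x => tif (@?c x) (@?f x) (@?g x)) => apply: (@FP_tif c f g)
  | |- FP (fun x => beq (@?f x) (@?g x)) => apply: (@FP_beq f g)
  | |- FP hd => exact: FP_hd FP_id
  | |- FP tl => exact: FP_tl FP_id
  | H : FP ?F |- FP (fun x => ?F (@?g x)) => apply: (@FP_comp F g H)
  | |- FP2 _ => rewrite /FP2
  | |- FP3 _ => rewrite /FP3
  | _ => fp_custom
  end.
Ltac fp := repeat (cbv beta; first [assumption | fp1]).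

(** * Lists as right spines of trees *)

Definition tab n F := tfor n (fun i acc => Nd (F i) acc) Lf.

Lemma FP3_of2 F : FP2 F -> FP (fun p => F (hd p) (hd (tl p))).
Proof.
move=> H; have G : FP (fun p => Nd (hd p) (hd (tl p))) by fp.
exact: (FP_comp H G).
Qed.

Lemma FP_tab n F : FP n -> FP2 F -> FP (fun x => tab (n x) (F x)).
Proof.
move=> Hn HF; have H3 := FP3_of2 HF.
apply: FP_tfor_add => //; [by fp|by fp|].
have [k Hk] := FP_bound2 HF; exists k.+1 => x i acc; rewrite sz_Nd expnS.
have := Hk x i; have : 0 < (sz x + sz i + 3) ^ k by rewrite expn_gt0 addn3.
nia.
Qed.

Lemma FP_tfor_step n f a : FP n -> FP f -> FP a ->
  (exists c, forall st, sz (f st) <= sz st + c) ->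
  FP (fun x => tfor (n x) (fun _ st => f st) (a x)).
Proof.
move=> Hn Hf Ha [c Hc]; apply: (@FP_tfor_add n (fun _ _ st => f st)) => //.
  have G : FP (fun p => tl (tl p)) by fp.
  exact: (FP_comp Hf G).
exists c => x i acc; apply: leq_trans (Hc _) _; rewrite leq_add2l.
apply: leq_trans (ltnW (ltn_expl c (isT : 1 < 2))) (leq_expl _ _); lia.
Qed.

Lemma tfor_iter n f a : tfor n (fun _ st => f st) a = iter (len n) f a.
Proof.
by rewrite /tfor -[len n in RHS](size_iota 0); elim: (iota _ _) => //= _ l ->.
Qed.

Lemma sz_hd_tl t : sz (hd t) + sz (tl t) <= sz t + 1.
Proof. by case: t => [|a b]; rewrite ?sz_Nd ?sz_Lf /=; lia. Qed.

Definition uadd n m := tfor n (fun _ acc => Nd Lf acc) m.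
Lemma FP_uadd F G : FP F -> FP G -> FP (fun x => uadd (F x) (G x)).
Proof.
move=> HF HG; apply: (FP_tfor_step (f := fun st => Nd Lf st)) => //; first by fp.
by exists 2 => st; rewrite sz_Nd sz_Lf; lia.
Qed.
Lemma len_uadd n m : len (uadd n m) = len n + len m.
Proof. by rewrite /uadd tfor_iter; elim: (len n) => //= k ->. Qed.

Lemma uaddE n m : uadd n m = iter (len n) (Nd Lf) m.
Proof. exact: tfor_iter. Qed.

Definition tnth l i := hd (tfor i (fun _ acc => tl acc) l).
Lemma FP_tnth F G : FP F -> FP G -> FP (fun x => tnth (F x) (G x)).
Proof.
move=> HF HG; apply: FP_hd; apply: (FP_tfor_step (f := tl)) => //; first exact: FP_tl FP_id.
by exists 0 => st; rewrite addn0 sz_tl.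
Qed.

Fixpoint sp t := if t is Nd a b then a :: sp b else [::].
Fixpoint lst s := if s is a :: l then Nd a (lst l) else Lf.
Lemma spK : cancel sp lst. Proof. by elim=> //= a _ b ->. Qed.
Lemma lstK : cancel lst sp. Proof. by elim=> //= a b ->. Qed.
Lemma size_sp t : size (sp t) = len t. Proof. by elim: t => //= a _ b ->. Qed.

Lemma sp_tl t : sp (tl t) = behead (sp t). Proof. by case: t. Qed.

Lemma tnthE l i : tnth l i = nth Lf (sp l) (len i).
Proof.
rewrite /tnth tfor_iter -[len i in RHS]addn0 -nth_drop.
have -> : drop (len i) (sp l) = sp (iter (len i) tl l).
  elim: (len i) => [|k IH]; first by rewrite drop0.
  by rewrite iterS sp_tl -IH -drop1 drop_drop add1n.
by case: (iter _ _ _).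
Qed.

Lemma sp_tab n F : sp (tab n F) = mkseq (fun i => F (un i)) (len n).
Proof. by rewrite /tab /tfor /mkseq; elim: (iota _ _) => //= i l ->. Qed.

Lemma tnth_tab n F i : i < len n -> tnth (tab n F) (un i) = F (un i).
Proof. by move=> lt; rewrite tnthE sp_tab len_un nth_mkseq. Qed.

Definition tcat a b := tfor a (fun i acc => Nd (tnth a i) acc) b.
Lemma sp_tcat a b : sp (tcat a b) = sp a ++ sp b.
Proof.
rewrite /tcat /tfor -[sp a in RHS](mkseq_nth Lf) size_sp /mkseq.
elim: (iota _ _) => //= i l ->; by rewrite tnthE len_un.
Qed.

Lemma sz_sp t : sz t = (sumn (map (fun u => (sz u).+1) (sp t))).+1.
Proof. by elim: t => //= a _ b IH; rewrite sz_Nd IH; lia. Qed.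

Lemma sz_nth t i : sz (nth Lf (sp t) i) <= sz t.
Proof.
elim: t i => [|a _ b IH] [|i] //=; rewrite sz_Nd; first by lia.
have := IH i; lia.
Qed.

Lemma FP_tcat F G : FP F -> FP G -> FP (fun x => tcat (F x) (G x)).
Proof.
move=> HF HG; apply: (@FP_tfor_add F (fun x i acc => Nd (tnth (F x) i) acc)) => //.
  have H1 : FP (fun p => F (hd p)) by apply: FP_comp HF _; fp.
  by apply: FP_Nd; [apply: FP_tnth; fp|fp].
have [k Hk] := FP_sz HF.
exists k.+1 => x i acc; rewrite sz_Nd tnthE.
have le := sz_nth (F x) (len i).
have le2 : (sz x + 2) ^ k <= (sz x + sz i + 3) ^ k by apply: leq_expl; lia.
have := Hk x; have : 0 < (sz x + sz i + 3) ^ k by rewrite expn_gt0 addn3.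
by rewrite expnS; nia.
Qed.

Lemma sz_tcat a b : sz (tcat a b) <= sz a + sz b.
Proof. by rewrite !sz_sp sp_tcat map_cat sumn_cat; lia. Qed.

Definition tflat n F := tfor n (fun i acc => tcat (F i) acc) Lf.
Lemma FP_tflat n F : FP n -> FP2 F -> FP (fun x => tflat (n x) (F x)).
Proof.
move=> Hn HF; have H3 := FP3_of2 HF.
apply: FP_tfor_add => //; [by apply: FP_tcat; fp|by fp|].
have [k Hk] := FP_bound2 HF; exists k => x i acc.
by have := sz_tcat (F x i) acc; have := Hk x i; lia.
Qed.
Lemma sp_tflat n F : sp (tflat n F) = flatten (mkseq (fun i => sp (F (un i))) (len n)).
Proof. by rewrite /tflat /tfor /mkseq; elim: (iota _ _) => //= i l; rewrite sp_tcat => ->. Qed.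

(** The index is wrapped in a node, since the index 0 is [Lf] and would otherwise look like
    failure. *)
Definition tfind n P := tfor n (fun i acc => tif (P i) (Nd i Lf) acc) Lf.
Lemma FP_tfind n F : FP n -> FP2 F -> FP (fun x => tfind (n x) (F x)).
Proof.
move=> Hn HF; have H3 := FP3_of2 HF.
apply: FP_tfor_add => //; [by fp|by fp|].
exists 1 => x i acc; rewrite /tif expn1; case: ifP => _; rewrite ?sz_Nd ?sz_Lf; lia.
Qed.
Variant tfind_spec n P : tree -> Prop :=
  | TFound i : i < len n -> isnd (P (un i)) -> tfind_spec n P (Nd (un i) Lf)
  | TNone : (forall i, i < len n -> ~~ isnd (P (un i))) -> tfind_spec n P Lf.
Lemma tfindP n P : tfind_spec n P (tfind n P).
Proof.
rewrite /tfind /tfor.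
have : {subset iota 0 (len n) <= fun i => i < len n} by move=> i; rewrite mem_iota.
have : forall i, i < len n -> (i \in iota 0 (len n)) || ~~ isnd (P (un i)).
  by move=> i lt; rewrite mem_iota lt.
elim: (iota _ _) => [|i l IH] H1 H2 /=.
  by apply: TNone => i /H1.
rewrite {1}/tif; case: ifP => Hi.
  by apply: TFound => //; apply: H2; rewrite mem_head.
apply: IH => j; last by move=> Hj; apply: H2; rewrite in_cons Hj orbT.
move=> /H1; rewrite in_cons; case: eqP => [->|//] _; by rewrite Hi orbT.
Qed.

Fixpoint catrev l acc := if l is Nd b l' then catrev l' (Nd b acc) else acc.
Definition trev l := tl (tfor l (fun _ st => Nd (tl (hd st)) (Nd (hd (hd st)) (tl st))) (Nd l Lf)).
Lemma FP_trev F : FP F -> FP (fun x => trev (F x)).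
Proof.
move=> HF; apply: FP_tl.
apply: (FP_tfor_step (f := fun st => Nd (tl (hd st)) (Nd (hd (hd st)) (tl st)))) => //; try by fp.
exists 5 => st; rewrite !sz_Nd; have := sz_hd_tl st; have := sz_hd_tl (hd st); lia.
Qed.
Lemma trevE l : trev l = catrev l Lf.
Proof.
rewrite /trev tfor_iter; set f := fun st => _.
suff H acc : tl (iter (len l) f (Nd l acc)) = catrev l acc by exact: H.
by elim: l acc => // a _ b IH acc; rewrite [len _]/= iterSr; exact: IH.
Qed.

Ltac fp_custom ::= match goal with
  | |- FP (fun x => uadd (@?f x) (@?g x)) => apply: (@FP_uadd f g)
  | |- FP (fun x => tnth (@?f x) (@?g x)) => apply: (@FP_tnth f g)
  | |- FP (fun x => tcat (@?f x) (@?g x)) => apply: (@FP_tcat f g)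
  | |- FP (fun x => trev (@?f x)) => apply: (@FP_trev f)
  | |- FP (fun x => tab (@?f x) (@?g x)) => apply: (@FP_tab f g)
  | |- FP (fun x => tflat (@?f x) (@?g x)) => apply: (@FP_tflat f g)
  | |- FP (fun x => tfind (@?f x) (@?g x)) => apply: (@FP_tfind f g)
  end.

(** * Binary arithmetic *)

Opaque uadd tnth tab tcat tflat tfind trev.

Fixpoint nval t := if t is Nd b t' then isnd b + (nval t').*2 else 0.

Lemma nvalE t : nval t = isnd (hd t) + (nval (tl t)).*2. Proof. by case: t. Qed.

Definition na_carry a b c := tif a (tif b tru (tif c tru Lf)) (tif b (tif c tru Lf) Lf).
Definition na_sum a b c := tif a (tif b (tif c tru Lf) (tif c Lf tru))
                                 (tif b (tif c Lf tru) (tif c tru Lf)).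
(** The state of a serial adder: the unread bits of both summands, the carry, and the bits of the
    sum with the latest one first. *)
Definition na_step st :=
  Nd (tl (hd st)) (Nd (tl (hd (tl st)))
    (Nd (na_carry (hd (hd st)) (hd (hd (tl st))) (hd (tl (tl st))))
        (Nd (na_sum (hd (hd st)) (hd (hd (tl st))) (hd (tl (tl st)))) (tl (tl (tl st)))))).
(** The number of rounds is one more than the sum of both lengths. This exceeds both lengths, so the
    last carry has been written out, and it makes the length of the sum independent of the bits. *)
Definition nadd a b :=
  trev (tl (tl (tl (tfor (uadd (Nd Lf a) b) (fun _ st => na_step st) (Nd a (Nd b (Nd Lf Lf))))))).

Lemma sz_carry a b c : sz (na_carry a b c) <= 3.
Proof. by rewrite /na_carry /tif; do ![case: ifP => _]. Qed.
Lemma sz_sum a b c : sz (na_sum a b c) <= 3.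
Proof. by rewrite /na_sum /tif; do ![case: ifP => _]. Qed.

Lemma FP_nadd F G : FP F -> FP G -> FP (fun x => nadd (F x) (G x)).
Proof.
move=> HF HG; apply: FP_trev; do 3!apply: FP_tl.
apply: (FP_tfor_step (f := na_step)); [by fp| |by fp|].
  by rewrite /na_step /na_carry /na_sum; fp.
exists 20 => st; rewrite /na_step !sz_Nd.
have := sz_carry (hd (hd st)) (hd (hd (tl st))) (hd (tl (tl st))).
have := sz_sum (hd (hd st)) (hd (hd (tl st))) (hd (tl (tl st))).
have := sz_hd_tl st; have := sz_hd_tl (tl st); have := sz_hd_tl (tl (tl st)).
have := sz_tl (hd st); have := sz_tl (hd (tl st)); lia.
Qed.

Fixpoint rnval o := if o is Nd b o' then isnd b * 2 ^ len o' + rnval o' else 0.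

Lemma nval_catrev o acc : nval (catrev o acc) = rnval o + 2 ^ len o * nval acc.
Proof. elim: o acc => [|b _ o IH] acc /=; first by rewrite mul1n. rewrite IH /= expnS; nia. Qed.

Lemma len_catrev o acc : len (catrev o acc) = len o + len acc.
Proof. by elim: o acc => //= b _ o IH acc; rewrite IH /= addnS. Qed.

Lemma sz_catrev o acc : sz (catrev o acc) = sz o + sz acc - 1.
Proof.
by elim: o acc => [|b _ o IH] acc /=; rewrite ?IH ?sz_Nd ?sz_Lf; lia.
Qed.

Lemma na_sumE a b c :
  isnd (na_sum a b c) + 2 * isnd (na_carry a b c) = isnd a + isnd b + isnd c.
Proof.
by rewrite /na_sum /na_carry /tif; case: (isnd a); case: (isnd b); case Ec: (isnd c).
Qed.

Lemma iter_tl m t : len (iter m tl t) = len t - m.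
Proof.
elim: m => [|m IH]; first by rewrite subn0.
by rewrite iterS subnS -IH; case: (iter _ _ _).
Qed.

Lemma nadd_iter a b m : exists c o,
  iter m na_step (Nd a (Nd b (Nd Lf Lf))) =
    Nd (iter m tl a) (Nd (iter m tl b) (Nd c o)) /\
  [/\ len o = m, sz o <= 4 * m + 1,
     rnval o + 2 ^ m * (nval (iter m tl a) + nval (iter m tl b) + isnd c) = nval a + nval b
     & maxn (len a) (len b) < m -> ~~ isnd c].
Proof.
elim: m => [|m [c [o [E [H1 H2 H3 H4]]]]].
  by exists Lf, Lf; split=> //; split=> //=; lia.
rewrite iterS E {1}/na_step /=; do 2 eexists; split; first reflexivity.
split.
- by rewrite /= H1.
- by rewrite sz_Nd; have := sz_sum (hd (iter m tl a)) (hd (iter m tl b)) c; lia.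
- rewrite /= H1 -H3 [nval (iter m tl a)]nvalE [nval (iter m tl b)]nvalE expnS.
  have := na_sumE (hd (iter m tl a)) (hd (iter m tl b)) c; nia.
- move=> lt; have Ea : iter m tl a = Lf.
    by have := iter_tl m a; case: (iter m tl a) => //= ? ?; lia.
  have Eb : iter m tl b = Lf.
    by have := iter_tl m b; case: (iter m tl b) => //= ? ?; lia.
  by rewrite Ea Eb /= /na_carry /tif /=.
Qed.

Lemma nadd_spec a b :
  [/\ nval (nadd a b) = nval a + nval b, len (nadd a b) = (len a + len b).+1
    & sz (nadd a b) <= 4 * (len a + len b) + 5].
Proof.
rewrite /nadd tfor_iter len_uadd trevE [len (Nd Lf a)]/= addSn.
have [c [o [-> [H1 H2 H3 H4]]]] := nadd_iter a b (len a + len b).+1.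
rewrite -[tl _]/o nval_catrev len_catrev sz_catrev /= H1.
have Ea : iter (len a + len b).+1 tl a = Lf.
  by have := iter_tl (len a + len b).+1 a; case: (iter _ tl a) => // ? ?; rewrite [len (Nd _ _)]/=; lia.
have Eb : iter (len a + len b).+1 tl b = Lf.
  by have := iter_tl (len a + len b).+1 b; case: (iter _ tl b) => // ? ?; rewrite [len (Nd _ _)]/=; lia.
split; last by rewrite sz_Lf; lia.
  rewrite -H3 Ea Eb /=; have := H4 ltac:(lia); case: (isnd c) => //; lia.
lia.
Qed.
Lemma nval_add a b : nval (nadd a b) = nval a + nval b. Proof. by have [] := nadd_spec a b. Qed.
Lemma len_nadd a b : len (nadd a b) = (len a + len b).+1. Proof. by have [] := nadd_spec a b. Qed.
(** The bits of the summands may be arbitrary trees, of which only [isnd] counts, but the bits of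
    the sum are normalized. Hence [len] controls the size of sums and can serve as the measure in
    later loops. *)
Lemma sz_nadd a b : sz (nadd a b) <= 4 * len (nadd a b) + 1.
Proof. by have [_ -> H] := nadd_spec a b; lia. Qed.

Opaque nadd.

(** Bits are compared from the least significant end; a pair of different bits overrides the verdict
    reached so far. *)
Definition nle_step st := Nd (tl (hd st)) (Nd (tl (hd (tl st)))
  (tif (hd (hd st)) (tif (hd (hd (tl st))) (tl (tl st)) Lf)
                    (tif (hd (hd (tl st))) tru (tl (tl st))))).
Definition nle a b := tl (tl (tfor (uadd a b) (fun _ st => nle_step st) (Nd a (Nd b tru)))).

Lemma FP_nle F G : FP F -> FP G -> FP (fun x => nle (F x) (G x)).
Proof.
move=> HF HG; do 2!apply: FP_tl.
apply: (FP_tfor_step (f := nle_step)); [by fp| |by fp|].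
  by rewrite /nle_step; fp.
exists 20 => st; rewrite /nle_step !sz_Nd.
have H : sz (tif (hd (hd st)) (tif (hd (hd (tl st))) (tl (tl st)) Lf)
   (tif (hd (hd (tl st))) tru (tl (tl st)))) <= sz (tl (tl st)) + 3.
  by rewrite /tif; do ![case: ifP => _]; rewrite ?sz_Nd ?sz_Lf; lia.
have := sz_hd_tl st; have := sz_hd_tl (tl st).
have := sz_tl (hd st); have := sz_tl (hd (tl st)); lia.
Qed.

Lemma nleP a b : isnd (nle a b) = (nval a <= nval b).
Proof.
rewrite /nle tfor_iter len_uadd.
have H m c x y : len x <= m -> len y <= m ->
    isnd (tl (tl (iter m nle_step (Nd x (Nd y c))))) =
    (nval x < nval y) || (nval x == nval y) && isnd c.
  elim: m c x y => [|m IH] c x y; first by case: x y => [|? ?] [|? ?].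
  move=> lx ly; have lx' : len (tl x) <= m by case: (x) lx.
  have ly' : len (tl y) <= m by case: (y) ly.
  rewrite iterSr {2}/nle_step IH //.
  rewrite [nval x]nvalE [nval y]nvalE /tif.
  by case: (isnd (hd x)); case: (isnd (hd y)); rewrite /= ?andbF ?andbT ?orbF; case: (isnd c); lia.
by rewrite H /= ?andbT; lia.
Qed.

Opaque nle.

Ltac fp_custom ::= match goal with
  | |- FP (fun x => uadd (@?f x) (@?g x)) => apply: (@FP_uadd f g)
  | |- FP (fun x => tnth (@?f x) (@?g x)) => apply: (@FP_tnth f g)
  | |- FP (fun x => tcat (@?f x) (@?g x)) => apply: (@FP_tcat f g)
  | |- FP (fun x => trev (@?f x)) => apply: (@FP_trev f)
  | |- FP (fun x => tab (@?f x) (@?g x)) => apply: (@FP_tab f g)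
  | |- FP (fun x => tflat (@?f x) (@?g x)) => apply: (@FP_tflat f g)
  | |- FP (fun x => tfind (@?f x) (@?g x)) => apply: (@FP_tfind f g)
  | |- FP (fun x => nadd (@?f x) (@?g x)) => apply: (@FP_nadd f g)
  | |- FP (fun x => nle (@?f x) (@?g x)) => apply: (@FP_nle f g)
  end.

Lemma nval_nth t : nval t = \sum_(i < len t) isnd (nth Lf (sp t) i) * 2 ^ i.
Proof.
elim: t => [|a _ b IH] /=; first by rewrite big_ord0.
rewrite big_ord_recl /= muln1 IH -mul2n big_distrr /=; congr (_ + _).
by apply: eq_bigr => i _; rewrite /bump /= expnS mulnCA.
Qed.

(** Numbers are little-endian, so prepending leaves is a left shift and [uadd] doubles as the shift
    operation. *)
Lemma nval_shift i a : nval (uadd i a) = 2 ^ len i * nval a.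
Proof.
by rewrite uaddE; elim: (len i) => [|k IH] /=; rewrite ?mul1n // IH expnS; lia.
Qed.

Lemma big_iota_foldr (f : nat -> nat) n : foldr (fun i acc => f i + acc) 0 (iota 0 n) = \sum_(i < n) f i.
Proof.
by rewrite -(big_mkord xpredT f) /index_iota subn0 unlock; elim: (iota _ _).
Qed.

Definition nmul a b := tfor b (fun i acc => nadd (tif (tnth b i) (uadd i a) Lf) acc) Lf.

Lemma nval_mul a b : nval (nmul a b) = nval a * nval b.
Proof.
have H := big_iota_foldr (fun i => nval a * (isnd (nth Lf (sp b) i) * 2 ^ i)) (len b).
rewrite [nval b]nval_nth big_distrr /= -{}H /nmul /tfor.
elim: (iota _ _) => //= i l IH; rewrite nval_add IH; congr (_ + _).
by rewrite /tif tnthE len_un; case: ifP => _; rewrite ?muln0 // nval_shift len_un mul1n mulnC.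
Qed.

Lemma FP_nmul F G : FP F -> FP G -> FP (fun x => nmul (F x) (G x)).
Proof.
move=> HF HG.
have HF' : FP (fun p => F (hd p)) by apply: FP_comp HF _; fp.
have HG' : FP (fun p => G (hd p)) by apply: FP_comp HG _; fp.
apply: (FP_tfor_mu (mu := len) (F := fun x i acc => nadd (tif (tnth (G x) i) (uadd i (F x)) Lf) acc)) => //.
- by fp.
- by fp.
- exact: pb_const.
- exists (fun x => len (G x) + len (F x) + 1).
    have pF := pb_len (FP_sz HF); have pG := pb_len (FP_sz HG); by pb.
  move=> x i acc lt; rewrite len_nadd /tif; case: ifP => _ /=; rewrite ?len_uadd ?len_un; lia.
- exists 3 => x i acc _; apply: leq_trans (sz_nadd _ _) _.
  set m := len _; rewrite !expnS expn0; nia.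
Qed.

Opaque nmul.

(** Integers are formal differences of naturals, so that no operation needs a subtraction or a case
    distinction on signs. Such pairs are not unique and grow under arithmetic; [znorm] below
    restores a bounded size. *)
Definition zval (t : tree) : int := (Posz (nval (hd t)) - Posz (nval (tl t)))%R.
Definition zadd x y := Nd (nadd (hd x) (hd y)) (nadd (tl x) (tl y)).
Definition zmul x y :=
  Nd (nadd (nmul (hd x) (hd y)) (nmul (tl x) (tl y)))
     (nadd (nmul (hd x) (tl y)) (nmul (tl x) (hd y))).
Definition zopp x := Nd (tl x) (hd x).
Definition zle x y := nle (nadd (hd x) (tl y)) (nadd (hd y) (tl x)).
Definition zone := Nd tru Lf.
Definition zconst1 := Nd zone Lf.

Lemma FP_zadd F G : FP F -> FP G -> FP (fun x => zadd (F x) (G x)).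
Proof.
move=> HF HG; rewrite /zadd; apply: FP_Nd; apply: FP_nadd; fp.
Qed.
Lemma FP_zopp F : FP F -> FP (fun x => zopp (F x)).
Proof. by move=> HF; rewrite /zopp; fp. Qed.
Lemma FP_zmul F G : FP F -> FP G -> FP (fun x => zmul (F x) (G x)).
Proof.
by move=> HF HG; rewrite /zmul; apply: FP_Nd; apply: FP_nadd; apply: FP_nmul; fp.
Qed.
Lemma FP_zle F G : FP F -> FP G -> FP (fun x => zle (F x) (G x)).
Proof. by move=> HF HG; rewrite /zle; fp. Qed.

Lemma zval_add x y : zval (zadd x y) = (zval x + zval y)%R.
Proof. rewrite /zval /= !nval_add; lia. Qed.
Lemma zval_opp x : zval (zopp x) = (- zval x)%R.
Proof. rewrite /zval /=; lia. Qed.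
Lemma zval_mul x y : zval (zmul x y) = (zval x * zval y)%R.
Proof. by rewrite /zval /= !nval_add !nval_mul !PoszD !PoszM; ring. Qed.
Lemma zleP x y : isnd (zle x y) = (zval x <= zval y)%R.
Proof. rewrite nleP !nval_add /zval; lia. Qed.
Lemma zval1 : zval zconst1 = 1%R. Proof. by []. Qed.

Definition zsum n F := tfor n (fun i acc => zadd (F i) acc) Lf.

Lemma zval_sum n F : zval (zsum n F) = (\sum_(i < len n) zval (F (un i)))%R.
Proof.
rewrite -(big_mkord xpredT (fun i => zval (F (un i)))) /index_iota subn0 /zsum /tfor.
elim: (iota _ _) => [|i l IH]; first by rewrite big_nil.
by rewrite big_cons [foldr _ _ _]/= zval_add IH.
Qed.

Lemma FP_zsum n F : FP n -> FP2 F -> FP (fun x => zsum (n x) (F x)).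
Proof.
move=> Hn HF; have H3 := FP3_of2 HF; have [k Hk] := FP_bound2 HF.
apply: (FP_tfor_mu (mu := fun t => len (hd t) + len (tl t)) (F := fun x i acc => zadd (F x i) acc)) => //.
- by apply: FP_zadd; fp.
- exact: FP_const.
- exact: pb_const.
- exists (fun x => 2 * (sz x + 2 * len (n x) + 4) ^ k + 2).
    by have pn := pb_len (FP_sz Hn); pb.
  move=> x i acc lt; rewrite /zadd /= !len_nadd.
  have h := Hk x (un i); rewrite sz_un in h.
  have h2 : (sz x + i.*2.+1 + 3) ^ k <= (sz x + 2 * len (n x) + 4) ^ k.
    by apply: leq_expl; lia.
  have := sz_hd_tl (F x (un i)); have := len_sz (hd (F x (un i))).
  have := len_sz (tl (F x (un i))); lia.
- exists 3 => x i acc _; rewrite /zadd /= sz_Nd.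
  have := sz_nadd (hd (F x (un i))) (hd acc); have := sz_nadd (tl (F x (un i))) (tl acc).
  set a := len _; set b := len _ => h1 h2; rewrite !expnS expn0.
  have := sz_gt0 x; nia.
Qed.

(* Exact division by greedy search for the quotient, represented as
   [q - 2 ^ W] with [q < 2 ^ (W + 1)], so that its size depends on [W] only. *)
Definition zdiv W X D :=
  Nd (tfor (Nd Lf W) (fun i q =>
        tif (zle (zmul (Nd (nadd (uadd i zone) q) (uadd W zone)) D) X)
            (nadd (uadd i zone) q) (nadd Lf q)) Lf)
     (uadd W zone).

Lemma len_zdiv_aux W X D l N : all (fun i => i < N) l ->
  len (foldr (fun i q => tif (zle (zmul (Nd (nadd (uadd (un i) zone) q) (uadd W zone)) D) X)
            (nadd (uadd (un i) zone) q) (nadd Lf q)) Lf l) <= size l * (N + 2).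
Proof.
elim: l => //= i l IH /andP[lt /IH H]; rewrite mulSn; move: (foldr _ _ _) H => q H; rewrite /tif; case: ifP => _; rewrite len_nadd /= ?len_uadd ?len_un /=; lia.
Qed.

(** The size condition of the loop rule concerns every accumulator [q]. The sum [nadd Lf q] in the
    other branch leaves the value unchanged but normalizes the bits, which makes [len] control the
    size there too. *)
Lemma FP_zdiv W X D : FP W -> FP X -> FP D -> FP (fun x => zdiv (W x) (X x) (D x)).
Proof.
move=> HW HX HD; rewrite /zdiv; apply: FP_Nd; last by fp.
apply: (FP_tfor_mu (mu := len) (F := fun x i q => tif (zle (zmul (Nd (nadd (uadd i zone) q) (uadd (W x) zone)) (D x)) (X x))
            (nadd (uadd i zone) q) (nadd Lf q))).
- by fp.
- rewrite /FP3; apply: FP_tif; [|by fp|by fp].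
  apply: FP_zle; last by fp.
  by apply: FP_zmul; fp.
- exact: FP_const.
- exact: pb_const.
- exists (fun x => len (W x) + 3).
    by have pn := pb_len (FP_sz HW); pb.
  by move=> x i acc /= lt; rewrite /tif; case: ifP => _; rewrite len_nadd /= ?len_uadd ?len_un /=; lia.
- exists 3 => x i acc _; rewrite /tif.
  case: ifP => _; (apply: leq_trans (sz_nadd _ _) _; set m := len _; rewrite !expnS expn0; nia).
Qed.

Lemma sz_uadd n m : sz (uadd n m) = 2 * len n + sz m.
Proof. by rewrite uaddE; elim: (len n) => //= k; rewrite sz_Nd sz_Lf; lia. Qed.

Lemma zdiv_sz W X D : sz (zdiv W X D) <= 8 * (len W + 4) ^ 2.
Proof.
rewrite sz_Nd sz_uadd; set q := tfor _ _ _.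
have Hl : len q <= (len W).+1 * (len W + 3).
  have := @len_zdiv_aux W X D (iota 0 (len W).+1) (len W).+1.
  rewrite size_iota => H; apply: leq_trans (H _) _; last by lia.
  by apply/allP => i; rewrite mem_iota.
have : sz q <= 4 * len q + 1.
  by rewrite /q /tfor /= /tif; case: ifP => _; exact: sz_nadd.
rewrite /(sz zone) /= expnS expn1; nia.
Qed.

Lemma nval_pow i : nval (uadd i zone) = 2 ^ len i.
Proof. by rewrite nval_shift /= muln1. Qed.

Lemma zdivE W X D (Q : int) : (0 < zval D)%R -> (zval X = Q * zval D)%R ->
  (- (Posz (2 ^ len W)) <= Q)%R -> (Q < Posz (2 ^ len W))%R ->
  zval (zdiv W X D) = Q.
Proof.
move=> D0 EX Q1 Q2; rewrite /zval /= nval_pow.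
pose T := (Q + Posz (2 ^ len W))%R.
suff E : Posz (nval (tfor (Nd Lf W) (fun i q =>
        tif (zle (zmul (Nd (nadd (uadd i zone) q) (uadd W zone)) D) X)
            (nadd (uadd i zone) q) (nadd Lf q)) Lf)) = T by rewrite E /T; ring.
rewrite /tfor; set f := fun i q => _.
(* The invariant of the greedy search: once the bits from [len W] down to [c] are settled, the
   partial result [q] satisfies [q <= T < q + 2 ^ c]. At [c = 0] this is equality. *)
have H c m : c + m = (len W).+1 ->
   (Posz (nval (foldr f Lf (iota c m))) <= T)%R /\
   (T < Posz (nval (foldr f Lf (iota c m)) + 2 ^ c))%R.
  elim: m c => [|m IH] c E.
    split; first by rewrite /T /=; lia.
    by rewrite /= -[c]addn0 E expnS /T; lia.
  have := IH c.+1 ltac:(by rewrite -E addnS); rewrite [foldr _ _ (iota c m.+1)]/=.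
  move: (foldr _ _ _) => q [h1 h2].
  have Et : isnd (zle (zmul (Nd (nadd (uadd (un c) zone) q) (uadd W zone)) D) X) =
      (Posz (nval q + 2 ^ c) <= T)%R.
    rewrite zleP zval_mul EX ler_pM2r // {1}/zval [hd _]/= [tl _]/= nval_add !nval_pow len_un /T; lia.
  rewrite expnS in h2; rewrite /f /tif Et.
  case: ifP => Hc; rewrite nval_add ?nval_pow ?len_un /=; lia.
have [h1 h2] := H 0 _ erefl; rewrite [len (Nd _ _)]/=; rewrite expn0 in h2; lia.
Qed.

Ltac fp_custom ::= match goal with
  | |- FP (fun x => uadd (@?f x) (@?g x)) => apply: (@FP_uadd f g)
  | |- FP (fun x => tnth (@?f x) (@?g x)) => apply: (@FP_tnth f g)
  | |- FP (fun x => tcat (@?f x) (@?g x)) => apply: (@FP_tcat f g)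
  | |- FP (fun x => tab (@?f x) (@?g x)) => apply: (@FP_tab f g)
  | |- FP (fun x => tflat (@?f x) (@?g x)) => apply: (@FP_tflat f g)
  | |- FP (fun x => tfind (@?f x) (@?g x)) => apply: (@FP_tfind f g)
  | |- FP (fun x => zadd (@?f x) (@?g x)) => apply: (@FP_zadd f g)
  | |- FP (fun x => zmul (@?f x) (@?g x)) => apply: (@FP_zmul f g)
  | |- FP (fun x => zopp (@?f x)) => apply: (@FP_zopp f)
  | |- FP (fun x => zle (@?f x) (@?g x)) => apply: (@FP_zle f g)
  | |- FP (fun x => zsum (@?f x) (@?g x)) => apply: (@FP_zsum f g)
  | |- FP (fun x => zdiv (@?f x) (@?g x) (@?h x)) => apply: (@FP_zdiv f g h)
  end.

(** * The integral tableau, the perceptron and vertex solutions *)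

Section ScaledTableau.
Local Open Scope ring_scope.

Lemma det_le (R : realDomainType) r (B : R) (M : 'M[R]_r) :
  (forall i j, `|M i j| <= B) -> `|\det M| <= r`!%:R * B ^+ r.
Proof.
move=> H; rewrite /determinant; apply: le_trans (ler_norm_sum _ _ _) _.
have -> : r`!%:R * B ^+ r = \sum_(s : 'S_r) B ^+ r.
  by rewrite sumr_const card_Sn mulr_natl.
apply: ler_sum => s _; rewrite normrM normrX normrN1 expr1n mul1r normr_prod.
have -> : B ^+ r = \prod_(i < r) B by rewrite prodr_const card_ord.
by apply: ler_prod => i _; rewrite normr_ge0 H.
Qed.

Section Tableau.
Variables (F : realFieldType) (m r : nat) (A : 'M[int]_(m, r)).
Implicit Types (N : 'M[int]_(m, r)) (D : int) (y : 'I_m -> nat) (e : 'I_m -> nat).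

Definition scaled (e : 'I_m -> nat) : 'M[int]_(m, r) := \matrix_(i, j) (2 ^+ e i * A i j).

(** A row of [C] keeps the scaling it had when it entered, hence [f <= e i], while the same row of
    the scaled matrix may have been doubled since. This is the factor [c] in the unit rows. *)
Definition tableau (N : 'M[int]_(m, r)) (D : int) (e : 'I_m -> nat) :=
  exists C : 'M[int]_r,
    [/\ N = scaled e *m \adj C, D = \det C, D != 0,
        forall j, exists i (c : int), 1 <= c /\ forall j', N i j' = (j' == j)%:R * (c * D)
      & forall j, exists i f, (f <= e i)%N /\ forall l, C j l = 2 ^+ f * A i l].

Lemma tableau_init : (forall j, exists i, forall j', A i j' = (j' == j)%:R) ->
  tableau A 1 (fun => 0%N).
Proof.
move=> H; exists 1%:M; split.
- by rewrite adj1 mulmx1; apply/matrixP => i j; rewrite mxE expr0 mul1r.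
- by rewrite det1.
- exact: oner_neq0.
- by move=> j; have [i Hi] := H j; exists i, 1; split=> // j'; rewrite Hi !mulr1.
- move=> j; have [i Hi] := H j; exists i, 0%N; split=> // l.
  by rewrite Hi mxE expr0 mul1r eq_sym.
Qed.

(** The fraction-free pivot rule of Edmonds and Bareiss, multiplied out by [D]. For [j = j0] the
    first two terms cancel, so the pivot column is kept. *)
Definition pivoted N D k j0 N' := forall i j,
  D * N' i j = N i j * N k j0 - N i j0 * N k j + (j == j0)%:R * (D * N i j0).

(** Row [j0] of [C] is exchanged for row [k] of the scaled matrix. Cofactor expansion identifies
    [N k j0] with the new determinant. The new tableau is defined through the new adjugate, so its
    integrality is free and only the pivot rule has to be verified. *)
Lemma tableau_pivot N D e k j0 : tableau N D e -> N k j0 != 0 ->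
  exists2 N', pivoted N D k j0 N' & tableau N' (N k j0) e.
Proof.
move=> [C [EN ED D0 HU HC]] D10; set S := scaled e in EN *.
pose C1 : 'M[int]_r := \matrix_(i, j) (if i == j0 then S k j else C i j).
have Ecof l : cofactor C1 j0 l = cofactor C j0 l.
  rewrite /cofactor; congr (_ * \det _); apply/matrixP => i j.
  by rewrite !mxE eq_sym (negbTE (neq_lift _ _)).
have ED1 : N k j0 = \det C1.
  rewrite (expand_det_row C1 j0) EN mxE; apply: eq_bigr => l _.
  by rewrite [C1 _ _]mxE eqxx Ecof [(\adj C) _ _]mxE.
set D1 := N k j0 in D10 ED1 *.
pose n := col j0 N; pose dl : 'cV[int]_r := delta_mx j0 0; pose dr : 'rV[int]_r := delta_mx 0 j0.
pose a := row k S; pose c := row j0 C.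
have NC : N *m C = D *: S by rewrite EN -mulmxA mul_adj_mx mul_mx_scalar ED.
(* The exchange is a rank-one update. It makes the product of [Q] with [C1] computable, after which
   [C1] is cancelled by its adjugate. *)
have EC1 : C1 = C + dl *m (a - c).
  apply/matrixP => i j; rewrite !mxE big_ord1 !mxE.
  by rewrite eqxx andbT; case: eqP => [->|_]; rewrite ?mul1r ?mul0r ?addr0 // addrC subrK.
pose Q := D1 *: N - n *m row k N + D *: (n *m dr).
have EQ i j : Q i j = N i j * D1 - N i j0 * N k j + (j == j0)%:R * (D * N i j0).
  rewrite !mxE !big_ord1 !mxE mulrC eqxx /=.
  by case: (j == j0); rewrite ?mulr1 ?mulr0 ?mul1r ?mul0r.
have Ndl : N *m dl = n by rewrite /n colE.
have rNC : row k N *m C = D *: a by rewrite -row_mul NC linearZ.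
have rNd : row k N *m dl = D1%:M.
  by rewrite -row_mul Ndl; apply/matrixP => i j; rewrite !mxE !ord1 eqxx.
have drC : dr *m C = c by rewrite -rowE.
have drd : dr *m dl = 1%:M.
  by rewrite mul_delta_mx; apply/matrixP => i j; rewrite !mxE !ord1.
have QC1 : Q *m C1 = (D * D1) *: S.
  rewrite EC1 mulmxDr !mulmxDl !mulNmx -!scalemxAl NC -!mulmxA rNC.
  rewrite (mulmxA N) Ndl (mulmxA (row k N)) rNd (mulmxA dr) drd drC !mul_scalar_mx scale1r.
  rewrite -!scalemxAr !mulmxBr; move: (n *m a) (n *m c) => P1 P2.
  by apply/matrixP => i j; rewrite !mxE; ring.
pose N1 := S *m \adj C1.
have N1C1 : N1 *m C1 = D1 *: S by rewrite -mulmxA mul_adj_mx mul_mx_scalar ED1.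
have HN' : pivoted N D k j0 N1.
  have : (D *: N1 - Q) *m C1 *m \adj C1 = 0.
    by rewrite mulmxBl -scalemxAl N1C1 QC1 scalerA subrr mul0mx.
  rewrite -mulmxA mul_mx_adj mul_mx_scalar -ED1 => /matrixP H0 i j.
  apply: (mulfI D10); move: (H0 i j); rewrite -EQ !mxE => /eqP.
  by rewrite mulrBr subr_eq0 => /eqP.
exists N1 => //; exists C1; split=> //.
- move=> j; have [->|ne] := eqVneq j j0.
    exists k, 1; split=> // j'; apply: (mulfI D0); rewrite HN' -/D1; ring.
  have [i [b [b1 Hb]]] := HU j; exists i, b; split=> // j'.
  apply: (mulfI D0); rewrite HN' !Hb (eq_sym j0) (negbTE ne) !mulr0n; ring.
- move=> j; have [->|ne] := eqVneq j j0.
    by exists k, (e k); split=> // l; rewrite !mxE eqxx.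
  by have [i [f [hf Hf]]] := HC j; exists i, f; split=> // l; rewrite !mxE (negbTE ne).
Qed.

Lemma tableau_double N D e k (N' : 'M[int]_(m, r)) : tableau N D e ->
  (forall i j, N' i j = if i == k then N i j + N i j else N i j) ->
  tableau N' D (fun i => e i + (i == k))%N.
Proof.
move=> [C [EN ED D0 HU HC]] HN'; exists C; split=> //.
- apply/matrixP => i j; rewrite HN' EN !mxE; case: ifP => Hi.
    by rewrite -big_split /=; apply: eq_bigr => l _; rewrite !mxE Hi addn1 exprS; ring.
  by apply: eq_bigr => l _; rewrite !mxE Hi addn0.
- move=> j; have [i [c [c1 Hc]]] := HU j.
  exists i, (if i == k then c + c else c); split; first by case: ifP => _ //; lia.
  by move=> j'; rewrite HN' Hc; case: ifP => _; ring.
- move=> j; have [i [f [hf Hf]]] := HC j; exists i, f; split=> //; lia.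
Qed.

(** [N i j] is the determinant of [C] with row [j] replaced by the scaled row [i], so the entries
    obey the same Leibniz bound as [D]. *)
Lemma tableau_bound N D e (E : nat) (a : int) : tableau N D e -> 1 <= a ->
  (forall i j, `|A i j| <= a) -> (forall i, e i <= E)%N ->
  (forall i j, `|N i j| <= r`!%:R * (2 ^+ E * a) ^+ r) /\
  `|D| <= r`!%:R * (2 ^+ E * a) ^+ r.
Proof.
move=> [C [EN ED D0 HU HC]] a1 Ha He.
have HS i f l : (f <= E)%N -> `|2 ^+ f * A i l| <= 2 ^+ E * a.
  move=> le; rewrite normrM; apply: ler_pM => //.
  rewrite ger0_norm ?exprn_ge0 //; apply: ler_weXn2l => //.
have HCl j l : `|C j l| <= 2 ^+ E * a.
  by have [i [f [hf ->]]] := HC j; apply: HS; apply: leq_trans hf (He i).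
split; last by rewrite ED; apply: det_le.
move=> i j.
pose C1 : 'M[int]_r := \matrix_(i', l) (if i' == j then scaled e i l else C i' l).
have -> : N i j = \det C1.
  rewrite (expand_det_row C1 j) EN mxE; apply: eq_bigr => l _.
  rewrite [C1 _ _]mxE eqxx [(\adj C) _ _]mxE; congr (_ * _).
  rewrite /cofactor; congr (_ * \det _); apply/matrixP => i' j'.
  by rewrite !mxE eq_sym (negbTE (neq_lift _ _)).
apply: det_le => i' l; rewrite mxE; case: ifP => _ //.
by rewrite mxE; apply: HS.
Qed.

Definition slack (x : 'I_r -> F) i : F := \sum_j (A i j)%:~R * x j.

Definition comb (y : 'I_m -> nat) (N : 'M[int]_(m, r)) j : int := \sum_l (y l)%:R * N l j.

(** The new coordinates are those of [C] applied to [x]. Each of them is the scaled slack of some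
    row divided by a factor [c >= 1], and so lies between 0 and the largest scaled slack. *)
Lemma tableau_sol N D e x : tableau N D e -> exists u : 'I_r -> F,
  (forall i, \sum_j (N i j)%:~R * u j = D%:~R * (2 ^+ e i * slack x i)) /\
  (forall M, (forall i, 0 < slack x i) -> (forall i, 2 ^+ e i * slack x i <= M) ->
     forall j, `|u j| <= M).
Proof.
move=> [C [EN ED D0 HU HC]].
pose f := fun z : int => z%:~R : F.
pose X : 'cV[F]_r := \col_j x j; pose U := map_mx intr C *m X : 'cV[F]_r.
have HNU i : \sum_j (N i j)%:~R * U j 0 = D%:~R * (2 ^+ e i * slack x i).
  have -> : \sum_j (N i j)%:~R * U j 0 = (map_mx intr N *m U) i 0.
    by rewrite [RHS]mxE; apply: eq_bigr => j _; rewrite [map_mx _ _ _ _]mxE.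
  rewrite /U EN mulmxA -map_mxM -mulmxA mul_adj_mx mul_mx_scalar -ED mxE.
  rewrite /slack mulr_sumr mulr_sumr; apply: eq_bigr => j _.
  by rewrite !mxE !rmorphM rmorphXn /=; ring.
exists (fun j => U j 0); split=> // M H0 HM j.
have [i [c [c1 Hc]]] := HU j.
have := HNU i; rewrite (bigD1 j) //= big1 ?addr0 => [|j' ne]; last first.
  by rewrite Hc (negbTE ne) mul0r mul0r.
rewrite Hc eqxx mul1r rmorphM /= mulrAC mulrC => /(mulfI _) E0.
have E : c%:~R * U j 0 = 2 ^+ e i * slack x i by apply: E0; rewrite intr_eq0.
have c1' : (1 : F) <= c%:~R by rewrite -[1]/(1%:~R) ler_int.
have s0 : 0 < 2 ^+ e i * slack x i by rewrite mulr_gt0 ?exprn_gt0.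
have U0 : 0 < U j 0 by rewrite -(pmulr_rgt0 _ (lt_le_trans ltr01 c1')) E.
rewrite gtr0_norm //; apply: le_trans (HM i); rewrite -E.
by rewrite ler_peMl // ltW.
Qed.

Lemma comb_sum y N (u : 'I_r -> F) :
  \sum_j (comb y N j)%:~R * u j = \sum_l (y l)%:R * \sum_j (N l j)%:~R * u j.
Proof.
rewrite (eq_bigr (fun j => \sum_l (y l)%:R * (N l j)%:~R * u j)).
  rewrite exchange_big; apply: eq_bigr => l _; rewrite mulr_sumr.
  by apply: eq_bigr => j _; rewrite mulrA.
move=> j _; rewrite /comb rmorph_sum mulr_suml; apply: eq_bigr => l _.
by rewrite rmorphM /= rmorph_nat.
Qed.

(** If no count exceeds [tau], the squared norm is at most 4 m * m * 16 m^4 = (8 m^3)^2 times D^2,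
    so the coordinates of the perceptron vector are at most 8 m^3 |D|. Pairing with coordinates of
    size at most M bounds [tau] times the slack by 8 m^4 M, which is half of [tau] times M. *)
Definition tau := (16 * m ^ 4)%N.

Definition sqnorm y N : int := \sum_j (comb y N j) ^+ 2.

(* A constraint that the perceptron hits [tau] times is thin: its scaled slack
   is at most half of the maximum, so that it may be doubled. *)
Lemma thin_row N D e x M y k : tableau N D e -> (r <= m)%N ->
  (forall i, 0 < slack x i) -> (forall i, 2 ^+ e i * slack x i <= M) ->
  (forall l, y l <= tau)%N -> y k = tau ->
  sqnorm y N <= 4 * D ^+ 2 * (r * \sum_l y l)%:R ->
  2 * (2 ^+ e k * slack x k) <= M.
Proof.
move=> HT rm H0 HM Hy yk Hsq.
have [u [Hu HuM]] := tableau_sol x HT; have {}HuM := HuM M H0 HM.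
have D0 : D != 0 by case: HT => C [].
have m0 : (0 < m)%N := leq_ltn_trans (leq0n _) (ltn_ord k).
have M0 : 0 <= M by apply: le_trans (HM k); rewrite mulr_ge0 ?exprn_ge0 // ltW.
have Hys : (\sum_l y l <= m * tau)%N.
  by rewrite -[m in (m * _)%N]card_ord -sum_nat_const; apply: leq_sum.
have Hr : (4 * r * (\sum_l y l) <= (8 * m ^ 3) ^ 2)%N.
  apply: (@leq_trans (4 * m * (m * tau))); first by rewrite leq_mul // leq_mul2l.
  rewrite /tau; lia.
have HZ j : `|comb y N j| <= (8 * m ^ 3)%:R * `|D|.
  rewrite -(@ler_pXn2r _ 2) ?nnegrE ?mulr_ge0 // exprMn !real_normK ?num_real //.
  apply: (@le_trans _ _ (sqnorm y N)).
    by rewrite /sqnorm (bigD1 j) //= lerDl sumr_ge0 // => i _; exact: sqr_ge0.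
  apply: le_trans Hsq _; rewrite mulrAC -natrX; apply: ler_wpM2r; first exact: sqr_ge0.
  by move: Hr; rewrite -(ler_nat int) -mulnA natrM.
have E : D%:~R * \sum_l (y l)%:R * (2 ^+ e l * slack x l) = \sum_j (comb y N j)%:~R * u j.
  rewrite comb_sum mulr_sumr; apply: eq_bigr => l _; rewrite Hu; ring.
have D0' : 0 < `|D%:~R : F| by rewrite normr_gt0 intr_eq0.
have s0 l : 0 < 2 ^+ e l * slack x l by rewrite mulr_gt0 ?exprn_gt0.
have H1 : tau%:R * (2 ^+ e k * slack x k) <= \sum_l (y l)%:R * (2 ^+ e l * slack x l).
  rewrite (bigD1 k) //= yk lerDl sumr_ge0 // => i _; apply: mulr_ge0 => //; exact: ltW.
have H2 : `|D%:~R| * \sum_l (y l)%:R * (2 ^+ e l * slack x l) <=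
          r%:R * ((8 * m ^ 3)%:R * `|D%:~R| * M).
  have S0 : 0 <= \sum_l (y l)%:R * (2 ^+ e l * slack x l).
    by apply: le_trans H1; apply: mulr_ge0 => //; exact: ltW.
  rewrite -{1}(ger0_norm S0) -normrM E; apply: le_trans (ler_norm_sum _ _ _) _.
  have -> : r%:R * ((8 * m ^ 3)%:R * `|D%:~R| * M) =
      \sum_(j < r) ((8 * m ^ 3)%:R * `|D%:~R| * M) by rewrite sumr_const card_ord mulr_natl.
  apply: ler_sum => j _; rewrite normrM; apply: ler_pM => //.
  by have := HZ j; rewrite -(ler_int F) rmorphM /= !intr_norm rmorph_nat.
have H3 : tau%:R * (2 ^+ e k * slack x k) <= r%:R * (8 * m ^ 3)%:R * M.
  rewrite -(ler_pM2l D0'); apply: le_trans (ler_wpM2l (ltW D0') H1) _.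
  by apply: le_trans H2 _; rewrite le_eqVlt; apply/orP; left; apply/eqP; ring.
have H4 : r%:R * (8 * m ^ 3)%:R * M <= (8 * m ^ 4)%:R * M.
  apply: ler_wpM2r => //; rewrite -natrM ler_nat; apply: (@leq_trans (m * (8 * m ^ 3))).
    by rewrite leq_mul2r rm orbT.
  lia.
have m4 : 0 < (8 * m ^ 4)%:R :> F by rewrite ltr0n; lia.
rewrite -(ler_pM2l m4); apply: le_trans H4; apply: le_trans H3.
by rewrite [X in X <= _]mulrA -natrM /tau (_ : 8 * m ^ 4 * 2 = 16 * m ^ 4)%N //; lia.
Qed.

(** [N] is the scaled matrix times the adjugate of [C]; hence the adjugate carries [z] back to a
    solution, whatever the sign of [D]. *)
Lemma tableau_feasible N D e (z : 'I_r -> int) : tableau N D e ->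
  (forall i, 0 < \sum_j N i j * z j) -> exists x, forall i, 0 < slack x i.
Proof.
move=> [C [EN _ _ _ _]] H.
pose Z : 'cV[int]_r := \col_j z j.
exists (fun j => ((\adj C *m Z) j 0)%:~R) => i.
rewrite -(pmulr_rgt0 _ (exprn_gt0 (e i) (ltr0Sn F 1))) /slack.
have -> : 2 ^+ e i * (\sum_j (A i j)%:~R * ((\adj C *m Z) j 0)%:~R) =
  ((scaled e *m (\adj C *m Z)) i 0)%:~R :> F.
  rewrite [in RHS]mxE rmorph_sum mulr_sumr; apply: eq_bigr => j _.
  by rewrite [scaled _ _ _]mxE !rmorphM rmorphXn /= mulrA.
rewrite mulmxA -EN mxE ltr0z; move: (H i); congr (0 < _).
by apply: eq_bigr => j _; rewrite mxE.
Qed.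

Definition run_inv t N D (y : 'I_m -> nat) := exists e p,
  [/\ tableau N D e, 2 ^+ p <= `|D|,
      (t <= (p + \sum_i e i) * (m * tau) + \sum_l y l)%N /\ (\sum_i e i <= t)%N,
      (forall l, y l < tau)%N /\ sqnorm y N <= 4 * D ^+ 2 * (r * \sum_l y l)%:R
    & forall x M, (forall i, 0 < slack x i) -> (forall i, slack x i <= M) ->
        forall i, 2 ^+ e i * slack x i <= M].

Lemma sqnorm0 y N : (forall l, y l = 0%N) -> sqnorm y N = 0.
Proof.
move=> H; rewrite /sqnorm big1 // => j _; rewrite /comb big1 ?expr0n // => l _.
by rewrite H mul0r.
Qed.

Hypothesis m_gt0 : (0 < m)%N.

Lemma tau_gt0 : (0 < tau)%N. Proof. by rewrite /tau muln_gt0 expn_gt0 m_gt0. Qed.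

Lemma sum_lt_tau y : (forall l, y l < tau)%N -> (\sum_(l < m) y l < m * tau)%N.
Proof.
move=> Hy; have : (\sum_(l < m) (y l).+1 <= m * tau)%N.
  by rewrite -[m in (m * _)%N]card_ord -sum_nat_const; apply: leq_sum.
rewrite (eq_bigr (fun l => y l + 1)%N) => [|l _]; last by rewrite addn1.
by rewrite big_split /= sum_nat_const card_ord; lia.
Qed.

Lemma run_init y : (forall j, exists i, forall j', A i j' = (j' == j)%:R) ->
  (forall l, y l = 0%N) -> run_inv 0 A 1 y.
Proof.
move=> H Hy; exists (fun => 0%N), 0%N; split=> //.
- exact: tableau_init.
- by rewrite big1.
- by split=> [l|]; [rewrite Hy tau_gt0|rewrite sqnorm0 // big1 // muln0 mulr0].
- by move=> x M _ H1 i; rewrite expr0 mul1r.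
Qed.

Lemma run_pivot t N D y k j0 y' : run_inv t N D y ->
  4 * D ^+ 2 <= N k j0 ^+ 2 -> (forall l, y' l = 0%N) ->
  exists2 N', pivoted N D k j0 N' & run_inv t.+1 N' (N k j0) y'.
Proof.
move=> [e [p [HT Hp [Ht He] [Hy Hs] HM]]] Hpv Hy'.
have D0 : D != 0 by case: HT => C [].
have HD : 2 * `|D| <= `|N k j0|.
  by rewrite -(@ler_pXn2r _ 2) ?nnegrE ?mulr_ge0 // exprMn !real_normK ?num_real.
have D10 : N k j0 != 0.
  by rewrite -normr_gt0; apply: lt_le_trans HD; rewrite mulr_gt0 // normr_gt0.
have [N' HN' HT'] := tableau_pivot HT D10; exists N' => //.
exists e, p.+1; split=> //.
- by rewrite exprS; apply: le_trans HD; rewrite ler_pM2l.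
- split; last exact: leqW.
  rewrite addSn mulSn; apply: leq_ltn_trans Ht _; rewrite addnC.
  by apply: leq_trans (leq_addr _ _); rewrite ltn_add2r sum_lt_tau.
- by split=> [l|]; [rewrite Hy' tau_gt0|rewrite sqnorm0 // big1 // muln0 mulr0].
Qed.

Lemma comb_inc y y' N i j : (forall l, y' l = y l + (l == i))%N ->
  comb y' N j = comb y N j + N i j.
Proof.
move=> H; rewrite /comb (eq_bigr (fun l => (y l)%:R * N l j + (l == i)%:R * N l j)).
  rewrite big_split /=; congr (_ + _); rewrite (bigD1 i) //= eqxx mul1r big1 ?addr0 //.
  by move=> l /negbTE ->; rewrite mul0r.
by move=> l _; rewrite H natrD mulrDl.
Qed.

Lemma sum_inc (y y' : 'I_m -> nat) i : (forall l, y' l = y l + (l == i))%N ->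
  (\sum_l y' l = (\sum_l y l).+1)%N.
Proof.
move=> H; rewrite (eq_bigr _ (fun l _ => H l)) big_split /= -addn1; congr (_ + _)%N.
by rewrite (bigD1 i) //= eqxx big1 // => l /negbTE ->.
Qed.

(** The perceptron estimate: the cross term is at most 0 by the choice of row [i], and the added row
    has squared norm at most 4 D^2 r since no entry is large enough for a pivot. *)
Lemma sqnorm_inc y y' N D i : (forall l, y' l = y l + (l == i))%N ->
  (forall k j, N k j ^+ 2 < 4 * D ^+ 2) -> \sum_j N i j * comb y N j <= 0 ->
  sqnorm y N <= 4 * D ^+ 2 * (r * \sum_l y l)%:R ->
  sqnorm y' N <= 4 * D ^+ 2 * (r * \sum_l y' l)%:R.
Proof.
move=> Hy' HN Hi Hs; rewrite (sum_inc Hy') mulnS addnC natrD mulrDr.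
have -> : sqnorm y' N = sqnorm y N + 2 * (\sum_j N i j * comb y N j) + \sum_j N i j ^+ 2.
  rewrite /sqnorm mulr_sumr -!big_split /=; apply: eq_bigr => j _.
  by rewrite (comb_inc _ _ Hy'); ring.
have H : \sum_(j < r) N i j ^+ 2 <= 4 * D ^+ 2 * r%:R.
  have -> : 4 * D ^+ 2 * r%:R = \sum_(j < r) (4 * D ^+ 2).
    by rewrite sumr_const card_ord mulr_natr.
  by apply: ler_sum => j _; exact: ltW.
apply: lerD => //; rewrite -[X in _ <= X]addr0; apply: lerD => //.
by rewrite pmulr_rle0.
Qed.

Lemma run_inc t N D y y' i : run_inv t N D y ->
  (forall k j, N k j ^+ 2 < 4 * D ^+ 2) -> \sum_j N i j * comb y N j <= 0 ->
  (forall l, y' l = y l + (l == i))%N -> (y' i < tau)%N ->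
  run_inv t.+1 N D y'.
Proof.
move=> [e [p [HT Hp [Ht He] [Hy Hs] HM]]] HN Hi Hy' Hlt; exists e, p; split=> //.
- by rewrite (sum_inc Hy'); split; lia.
- split=> [l|]; last exact: (sqnorm_inc Hy' HN Hi Hs).
  by have [->//|ne] := eqVneq l i; rewrite Hy' (negbTE ne) addn0.
Qed.

Lemma run_double t N D y y' i (N' : 'M[int]_(m, r)) y0 : (r <= m)%N -> run_inv t N D y ->
  (forall k j, N k j ^+ 2 < 4 * D ^+ 2) -> \sum_j N i j * comb y N j <= 0 ->
  (forall l, y' l = y l + (l == i))%N -> (tau <= y' i)%N ->
  (forall k j, N' k j = if k == i then N k j + N k j else N k j) ->
  (forall l, y0 l = 0%N) ->
  run_inv t.+1 N' D y0.
Proof.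
move=> rm [e [p [HT Hp [Ht He] [Hy Hs] HM]]] HN Hi Hy' Hge HN' Hy0.
have Hse : (\sum_l (e l + (l == i)) = (\sum_l e l).+1)%N by apply: sum_inc.
exists (fun l => e l + (l == i))%N, p; split=> //.
- exact: tableau_double HT HN'.
- rewrite Hse addnS mulSn; split; last by lia.
  apply: leq_ltn_trans Ht _; rewrite addnC.
  by apply: leq_trans (leq_addr _ _); rewrite ltn_add2r sum_lt_tau.
- by split=> [l|]; [rewrite Hy0 tau_gt0|rewrite sqnorm0 // big1 // muln0 mulr0].
move=> x M H0 H1 l; have Hl := HM x M H0 H1.
have [->|ne] := eqVneq l i; last by rewrite addn0.
rewrite addn1 exprS -mulrA.
have Hi' : y' i = tau.
  by apply/eqP; rewrite eqn_leq Hge andbT Hy' eqxx addn1; exact: Hy.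
apply: (thin_row HT rm H0 Hl _ Hi') => [j|]; last exact: (sqnorm_inc Hy' HN Hi Hs).
by rewrite Hy'; have := Hy j; case: eqP => _ /=; lia.
Qed.

(** Both r! and m^r are at most m^m, hence at most 2^(m^2); the factor 2^(E r) remains. *)
Lemma pow2_bound E : (r <= m)%N ->
  r`!%:R * (2 ^+ E * m%:R) ^+ r <= 2 ^+ (2 * m ^ 2 + E * m) :> int.
Proof.
move=> rm; rewrite -!natrX -natrM -natrX -natrM ler_nat.
have m2 : (m <= 2 ^ m)%N by apply: ltnW; apply: ltn_expl.
have fr n : (n`! <= n ^ n)%N.
  elim: n => // n IH; rewrite factS expnS leq_mul //; apply: leq_trans IH _.
  by case: n => // n; rewrite leq_exp2r.
have mr : (r ^ r <= 2 ^ (m ^ 2))%N.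
  apply: (@leq_trans (m ^ m)).
    case: (posnP r) => [->|r0]; first by rewrite expn0 expn_gt0 m_gt0.
    by apply: (@leq_trans (m ^ r)); [rewrite leq_exp2r|rewrite leq_pexp2l].
  by rewrite expnS expn1 expnM leq_exp2r.
apply: (@leq_trans (2 ^ (m ^ 2) * (2 ^ E * 2 ^ m) ^ m)).
  apply: leq_mul; first exact: leq_trans (fr r) mr.
  apply: (@leq_trans ((2 ^ E * 2 ^ m) ^ r)).
    by case: (r) => // r'; rewrite leq_exp2r // leq_mul2l m2 orbT.
  by rewrite leq_pexp2l // muln_gt0 !expn_gt0.
by rewrite -expnD -expnM -expnD leq_exp2l //; lia.
Qed.

Hypothesis rm : (r <= m)%N.
Hypothesis A_le : forall i j, `|A i j| <= m%:R.

(** Only the bound of the scalings by [t] enters, so this also covers infeasible systems; it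
    dictates the width of the divisions. *)
Lemma run_entries t N D y : run_inv t N D y ->
  (forall i j, `|N i j| <= 2 ^+ (2 * m ^ 2 + t * m)) /\ `|D| <= 2 ^+ (2 * m ^ 2 + t * m).
Proof.
move=> [e [p [HT _ [_ He] _ _]]].
have H : (forall i, e i <= t)%N.
  by move=> i; apply: leq_trans He; rewrite (bigD1 i) //= leq_addr.
have m1 : 1 <= m%:R :> int by rewrite ler1n.
have [H1 H2] := tableau_bound HT m1 A_le H; have H3 := pow2_bound t rm.
by split=> [i j|]; [apply: le_trans (H1 i j) H3|apply: le_trans H2 H3].
Qed.

(** Slacks between 1 and 2^(3 m^2) force [e i <= 3 m^2]; the resulting bound on the determinant
    gives [p <= 2 m^2 + 3 m^3]. Together there are at most 8 m^3 pivots and doublings, so t < 9 m^3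
    * m * 16 m^4 = 144 m^8, which is at most m^16 because m >= 2. *)
Lemma run_bound t N D y x : (2 <= m)%N -> run_inv t N D y ->
  (forall i, 1 <= slack x i) -> (forall i, slack x i <= 2 ^+ (3 * m ^ 2)) ->
  (t < m ^ 16)%N.
Proof.
move=> m2 [e [p [HT Hp [Ht He] [Hy _] HM]]] H1 H2.
have H0 i : 0 < slack x i by apply: lt_le_trans (H1 i).
have HE i : (e i <= 3 * m ^ 2)%N.
  have := HM x _ H0 H2 i; have : 2 ^+ e i <= 2 ^+ e i * slack x i.
    by rewrite ler_peMr // exprn_ge0.
  move=> /le_trans H /H {H}; by rewrite -!natrX ler_nat leq_exp2l.
have m1 : 1 <= m%:R :> int by rewrite ler1n.
have [_ HD] := tableau_bound HT m1 A_le HE.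
have := le_trans Hp (le_trans HD (pow2_bound (3 * m ^ 2) rm)).
rewrite -!natrX ler_nat leq_exp2l // => Hp2.
have HS : (\sum_i e i <= m * (3 * m ^ 2))%N.
  by rewrite -[m in (m * _)%N]card_ord -sum_nat_const; apply: leq_sum.
have HY := sum_lt_tau Hy.
have Hpe : (p + \sum_i e i <= 8 * m ^ 3)%N.
  apply: leq_trans (leq_add Hp2 HS) _; rewrite !expnS expn0; nia.
apply: leq_ltn_trans Ht _.
apply: (@leq_trans ((8 * m ^ 3).+1 * (m * tau))).
  rewrite mulSn addnC -addSn; apply: leq_add => //.
  by rewrite leq_mul2r Hpe orbT.
apply: (@leq_trans ((9 * m ^ 3) * (m * tau))).
  rewrite leq_mul2r; apply/orP; right; have : (0 < m ^ 3)%N by rewrite expn_gt0 m_gt0. lia.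
rewrite /tau.
have -> : (9 * m ^ 3 * (m * (16 * m ^ 4)) = 144 * m ^ 8)%N by lia.
have -> : (m ^ 16 = m ^ 8 * m ^ 8)%N by rewrite -expnD.
rewrite leq_mul2r; apply/orP; right.
by apply: (@leq_trans (2 ^ 8)); rewrite ?leq_exp2r.
Qed.
End Tableau.

Section Vertex.
Variables (F : realFieldType) (m r : nat) (A : 'M[int]_(m, r)).
Hypothesis units : forall j, exists i, forall j', A i j' = (j' == j)%:R.
Hypothesis m_gt0 : (0 < m)%N.
Hypothesis rm : (r <= m)%N.
Hypothesis A_le : forall i j, `|A i j| <= m%:R.

Definition tight (x : 'I_r -> F) := [set i | slack A x i == 1].

Lemma slackD (x y : 'I_r -> F) i c : slack A (fun j => x j + c * y j) i = slack A x i + c * slack A y i.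
Proof.
rewrite /slack mulr_sumr -big_split /=; apply: eq_bigr => j _; ring.
Qed.

(** The direction [d] keeps tight rows tight. Once its sign is chosen with [d j < 0], the unit row
    for [j] has decreasing slack, so the ratio test ranges over a nonempty set and stops at a new
    tight row. *)
Lemma tighten (x d : 'I_r -> F) : (forall i, 1 <= slack A x i) ->
  (forall i, i \in tight x -> slack A d i = 0) -> (exists j, d j != 0) ->
  exists x' : 'I_r -> F, (forall i, 1 <= slack A x' i) /\ (#|tight x| < #|tight x'|)%N.
Proof.
move=> Hx Hd [j dj].
wlog dj0 : d Hd dj / d j < 0.
  move=> H; have [lt|] := ltrP (d j) 0; first exact: (H d).
  rewrite le_eqVlt eq_sym (negbTE dj) /= => gt; apply: (H (fun j => - d j)).
  - move=> i /Hd E; transitivity (- slack A d i); last by rewrite E oppr0.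
    by rewrite /slack -sumrN; apply: eq_bigr => l _; rewrite mulrN.
  - by rewrite oppr_eq0.
  - by rewrite oppr_lt0.
have [i0 Hi0] := units j.
have si0 : slack A d i0 < 0.
  rewrite /slack (bigD1 j) //= big1 ?addr0 => [|l ne]; last by rewrite Hi0 (negbTE ne) mul0r.
  by rewrite Hi0 eqxx mul1r.
pose q i := (slack A x i - 1) / - slack A d i.
pose P := fun i => slack A d i < 0.
have Pi0 : P i0 by [].
case: (@arg_minP _ _ _ i0 P q Pi0) => i1 Pi1 Hmin.
have q0 : 0 <= q i1 by rewrite divr_ge0 ?subr_ge0 // oppr_ge0 ltW.
exists (fun l => x l + q i1 * d l); split=> [i|].
  rewrite slackD; have [Pi|ge] := boolP (P i).
    have := Hmin i Pi; rewrite {2}/q ler_pdivlMr ?oppr_gt0 // => H; lra.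
  have : 0 <= q i1 * slack A d i by rewrite mulr_ge0 // leNgt.
  have := Hx i; lra.
apply: proper_card; apply/properP; split.
  apply/fintype.subsetP => i Hi; have di := Hd i Hi; move: Hi; rewrite !inE slackD di mulr0 addr0 //.
exists i1; rewrite !inE ?slackD.
  have ne : slack A d i1 != 0 by rewrite lt_eqF.
  by apply/eqP; rewrite /q; field.
apply/negP => H; have := Hd i1; rewrite inE H => /(_ isT) E.
by move: Pi1; rewrite /P E ltxx.
Qed.

(** After scaling all slacks to at least 1, tightening is repeated until the tight rows have full
    column rank. An invertible subsystem with right-hand side 1 then determines the point, Cramer's
    rule bounds it by 2^(2 m^2), and a slack is at most m * m times that. *)
Lemma vertex (x : 'I_r -> F) : (forall i, 0 < slack A x i) ->
  exists x' : 'I_r -> F, forall i, 1 <= slack A x' i /\ slack A x' i <= 2 ^+ (3 * m ^ 2).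
Proof.
move=> Hx.
have [x1 H1] : exists x1 : 'I_r -> F, forall i, 1 <= slack A x1 i.
  pose i0 : 'I_m := Ordinal m_gt0.
  case: (@arg_minP _ _ _ i0 xpredT (slack A x) isT) => i1 _ Hmin.
  exists (fun j => 0 + (slack A x i1)^-1 * x j) => i; rewrite slackD.
  have -> : slack A (fun=> 0 : F) i = 0 by rewrite /slack big1 // => j _; rewrite mulr0.
  by rewrite add0r mulrC ler_pdivlMr // mul1r Hmin.
(* Rows that are not tight are set to zero instead of being removed, so that the matrix keeps its
   dimensions while the tight set grows. *)
pose T (x : 'I_r -> F) : 'M[F]_(m, r) := \matrix_(i, j) (if i \in tight x then (A i j)%:~R else 0).
have {x Hx x1 H1} [x [Hx Hfull]] : exists x : 'I_r -> F, (forall i, 1 <= slack A x i) /\ row_full (T x).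
  have [n] := ubnP (m - #|tight x1|); elim: n x1 H1 => // n IH x1 H1 lt.
  have [full|nfull] := boolP (row_full (T x1)); first by exists x1.
  have : cokermx (T x1) != 0.
    rewrite -mxrank_eq0 mxrank_coker subn_eq0 -ltnNge ltn_neqAle rank_leq_col andbT.
    exact: nfull.
  case/matrix0Pn => l [l' Hl].
  have Hd i : i \in tight x1 -> slack A (fun j => cokermx (T x1) j l') i = 0.
    move=> Hi; move/matrixP/(_ i l'): (mulmx_coker (T x1)); rewrite !mxE => E.
    by rewrite -[RHS]E; apply: eq_bigr => j _; rewrite [T x1 i j]mxE Hi.
  have [x' [Hx' Hlt]] := tighten H1 Hd (ex_intro _ l Hl).
  apply: (IH x') => //.
  have := max_card (tight x'); rewrite card_ord; move: lt Hlt; rewrite ltnS; lia.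
have [f Hf] : exists f : 'I_r -> 'I_m, rowsub f (T x) \in unitmx.
  by exists (fullrankfun Hfull); exact: fullrowsub_unit.
pose B : 'M[int]_r := \matrix_(i, j) A (f i) j.
have Htight i : f i \in tight x.
  apply: contraT => Hi; have : row i (rowsub f (T x)) = 0.
    by apply/rowP => j; rewrite !mxE (negbTE Hi).
  move=> H0; have : delta_mx 0 i *m rowsub f (T x) *m invmx (rowsub f (T x)) = 0 :> 'rV_r.
    by rewrite -rowE H0 mul0mx.
  by rewrite mulmxK // => /matrixP/(_ 0 i); rewrite !mxE !eqxx => /eqP; rewrite oner_eq0.
have HB : map_mx intr B = rowsub f (T x).
  by apply/matrixP => i j; rewrite !mxE Htight.
have B0 : \det B != 0.
  by move: Hf; rewrite unitmxE unitfE -HB det_map_mx intr_eq0.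
pose X : 'cV[F]_r := \col_j x j.
have HX : map_mx intr B *m X = const_mx 1.
  apply/matrixP => i j; rewrite !mxE; transitivity (slack A x (f i)); last first.
    by have := Htight i; rewrite inE => /eqP.
  by apply: eq_bigr => l _; rewrite !mxE.
have Hdet j : `|(\det B)%:~R * x j| <= (2 ^+ (2 * m ^ 2 + 0 * m))%:~R.
  have -> : (\det B)%:~R * x j = (\sum_l cofactor B l j)%:~R.
    have : map_mx intr (\adj B) *m (map_mx intr B *m X) = map_mx intr (\adj B) *m const_mx 1.
      by rewrite HX.
    rewrite mulmxA -map_mxM mul_adj_mx map_scalar_mx mul_scalar_mx => /matrixP/(_ j 0).
    rewrite !mxE => ->; rewrite rmorph_sum; apply: eq_bigr => l _.
    by rewrite !mxE mulr1.
  rewrite -intr_norm ler_int.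
  (* The numerator in Cramer's rule: column [j] is replaced by the right-hand side 1. *)
  pose C : 'M[int]_r := \matrix_(i, l) (if l == j then 1 else B i l).
  have -> : \sum_l cofactor B l j = \det C.
    rewrite (expand_det_col C j); apply: eq_bigr => l _; rewrite mxE eqxx mul1r.
    rewrite /cofactor; congr (_ * \det _); apply/matrixP => i' j'.
    by rewrite !mxE eq_sym (negbTE (neq_lift _ _)).
  apply: le_trans (pow2_bound m_gt0 0 rm); apply: det_le => i l; rewrite expr0 mul1r mxE.
  by case: ifP => _; [rewrite normr1 ler1n|rewrite mxE].
exists x => i; split=> //.
have Hxj j : `|x j| <= 2 ^+ (2 * m ^ 2).
  apply: (@le_trans _ _ `|(\det B)%:~R * x j|).
    rewrite normrM ler_peMl // -intr_norm -[1]/(1%:~R) ler_int.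
    by rewrite -gtz0_ge1 normr_gt0.
  by apply: le_trans (Hdet j) _; rewrite mul0n addn0 rmorphXn.
apply: le_trans (ler_norm _) _; apply: le_trans (ler_norm_sum _ _ _) _.
apply: (@le_trans _ _ (\sum_(j < r) m%:R * 2 ^+ (2 * m ^ 2))).
  apply: ler_sum => j _; rewrite normrM; apply: ler_pM => //.
  by have := A_le i j; rewrite -(ler_int F) intr_norm rmorph_nat.
rewrite sumr_const card_ord -[X in X <= _]mulr_natl mulrA -natrM -!natrX -natrM ler_nat.
have : (m < 2 ^ m)%N by apply: ltn_expl.
have -> : (3 * m ^ 2 = m ^ 2 + 2 * m ^ 2)%N by lia.
rewrite expnD leq_mul2r => m2; apply/orP; right.
apply: (@leq_trans (m ^ 2)); first by rewrite expnS expn1 leq_mul2r rm orbT.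
by apply: ltnW; apply: ltn_expl.
Qed.
End Vertex.

End ScaledTableau.

(** * The solver as a function on trees *)

Definition mget N i j := tnth (tnth N i) j.
(** Division by 1 keeps a value that fits into the width and rewrites it in a size that depends on
    [W] only. *)
Definition znorm W x := zdiv W x zconst1.
Definition zfour := Nd (Nd Lf (Nd Lf (Nd tru Lf))) Lf.

(** The entry has at least twice the absolute value of [D]; squares avoid absolute values. *)
Definition pivtest N D k j :=
  zle (zmul zfour (zmul D D)) (zmul (mget N k j) (mget N k j)).
Definition find_col r N D k := tfind r (fun j => pivtest N D k j).
Definition find_row m r N D := tfind m (fun k => find_col r N D k).

(** Numerator and denominator are both multiplied by [D], since the exact division is specified for
    positive divisors and [D] may be negative. *)
Definition pivot_entry W N D k j0 i j :=
  zdiv W (zmul (tif (beq j j0) (zmul D (mget N i j0))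
     (zadd (zmul (mget N i j) (mget N k j0)) (zopp (zmul (mget N i j0) (mget N k j))))) D)
   (zmul D D).
Definition tzeros m := tab m (fun _ => Lf).
Definition mktab m r F := tab m (fun i => tab r (fun j => F i j)).
Definition do_pivot m r W N D k j0 :=
  Nd Lf (Nd (mktab m r (fun i j => pivot_entry W N D k j0 i j))
            (Nd (znorm W (mget N k j0)) (tzeros m))).

Definition tcomb m N y j := zsum m (fun l => zsum (tnth y l) (fun _ => mget N l j)).
Definition row_test m r N y i :=
  zle (zsum r (fun j => zmul (mget N i j) (tcomb m N y j))) Lf.
Definition find_bad m r N y := tfind m (fun i => row_test m r N y i).
Definition uge a b := tif (tfor a (fun _ t => tl t) b) Lf tru.
Definition bump_count m y i := tab m (fun l => tif (beq l i) (Nd Lf (tnth y l)) (tnth y l)).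
Definition do_double m r W N D i :=
  Nd Lf (Nd (mktab m r (fun k j => znorm W (tif (beq k i) (zadd (mget N k j) (mget N k j)) (mget N k j))))
            (Nd (znorm W D) (tzeros m))).
Definition do_inc m r W t N D y i :=
  tif (uge (tnth (bump_count m y i) i) t) (do_double m r W N D i)
      (Nd Lf (Nd N (Nd D (bump_count m y i)))).

Definition step m r W t N D y :=
  tif (find_row m r N D)
      (do_pivot m r W N D (hd (find_row m r N D)) (hd (find_col r N D (hd (find_row m r N D)))))
      (tif (find_bad m r N y) (do_inc m r W t N D y (hd (find_bad m r N y)))
           (Nd tru (Nd N (Nd D y)))).
Definition tick m r W t s :=
  tif (hd s) s (step m r W t (hd (tl s)) (hd (tl (tl s))) (tl (tl (tl s)))).

Section FPtick.
Variables m r W N D y k j0 i : tree -> tree.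
Hypotheses (Hm : FP m) (Hr : FP r) (HW : FP W) (HN : FP N) (HD : FP D)
  (Hy : FP y) (Hk : FP k) (Hj0 : FP j0) (Hi : FP i).

Lemma FP_find_col : FP (fun x => find_col (r x) (N x) (D x) (k x)).
Proof. by rewrite /find_col /pivtest /mget; fp. Qed.
Lemma FP_find_row : FP (fun x => find_row (m x) (r x) (N x) (D x)).
Proof. by rewrite /find_row /find_col /pivtest /mget; fp. Qed.
Lemma FP_do_pivot : FP (fun x => do_pivot (m x) (r x) (W x) (N x) (D x) (k x) (j0 x)).
Proof. by rewrite /do_pivot /tzeros /mktab /pivot_entry /znorm /mget; fp. Qed.
Lemma FP_find_bad : FP (fun x => find_bad (m x) (r x) (N x) (y x)).
Proof. by rewrite /find_bad /row_test /tcomb /mget; fp. Qed.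
Lemma FP_uge : FP (fun x => uge (m x) (r x)).
Proof.
rewrite /uge; apply: FP_tif; [|by fp|by fp].
apply: (FP_tfor_step (f := tl)) => //; first exact: FP_tl FP_id.
by exists 0 => st; rewrite addn0 sz_tl.
Qed.
Lemma FP_bump : FP (fun x => bump_count (m x) (y x) (i x)).
Proof. by rewrite /bump_count; fp. Qed.
Lemma FP_do_double : FP (fun x => do_double (m x) (r x) (W x) (N x) (D x) (i x)).
Proof. by rewrite /do_double /tzeros /mktab /znorm /mget; fp. Qed.
End FPtick.

Lemma FP_step m r W t N D y : FP m -> FP r -> FP W -> FP t -> FP N -> FP D -> FP y ->
  FP (fun x => step (m x) (r x) (W x) (t x) (N x) (D x) (y x)).
Proof.
move=> Hm Hr HW Ht HN HD Hy.
have H1 := FP_find_row Hm Hr HN HD; have H2 := FP_find_bad Hm Hr HN Hy.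
rewrite /step; apply: FP_tif => //.
  by apply: FP_do_pivot => //; apply: FP_hd => //; apply: FP_find_col => //; apply: FP_hd.
have H3 := FP_hd H2; have H4 := FP_bump Hm Hy H3.
apply: FP_tif => //; last by fp.
rewrite /do_inc; apply: FP_tif; [apply: FP_uge => //; by fp|exact: FP_do_double|by fp].
Qed.

Lemma FP_tick m r W t s : FP m -> FP r -> FP W -> FP t -> FP s ->
  FP (fun x => tick (m x) (r x) (W x) (t x) (s x)).
Proof.
move=> Hm Hr HW Ht Hs; rewrite /tick; apply: FP_tif => //; first by fp.
by apply: FP_step => //; fp.
Qed.

Lemma sz_tab_le n F B : (forall i, sz (F i) <= B) -> sz (tab n F) <= len n * B.+1 + 1.
Proof.
move=> H; rewrite sz_sp sp_tab /mkseq -map_comp addn1 ltnS.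
have Hl l : sumn (map ((fun u => (sz u).+1) \o (fun i => F (un i))) l) <= size l * B.+1.
  by elim: l => //= i l IH; have := H (un i); lia.
by have := Hl (iota 0 (len n)); rewrite size_iota.
Qed.

Lemma sum_nth_sz y n : \sum_(i < n) sz (nth Lf (sp y) i) <= sz y + n.
Proof.
elim: y n => [|a _ b IH] [|n]; rewrite ?big_ord0 //.
  rewrite (eq_bigr (fun => 1)); first by rewrite sum_nat_const card_ord; lia.
  by move=> i _; rewrite nth_nil.
rewrite big_ord_recl [sp _]/= sz_Nd; have := IH n.
rewrite (eq_bigr (fun i : 'I_n => sz (nth Lf (a :: sp b) (lift ord0 i)))) //= => H; lia.
Qed.

Lemma sz_bump m y i : sz (bump_count m y i) <= sz y + 4 * len m + 1.
Proof.
rewrite sz_sp sp_tab /mkseq -map_comp.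
have H (f : nat -> nat) : sumn (map f (iota 0 (len m))) = \sum_(j < len m) f j.
  by rewrite -(big_mkord xpredT f) /index_iota subn0 sumnE big_map.
rewrite H; have := sum_nth_sz y (len m).
have : \sum_(j < len m) ((fun u => (sz u).+1) \o
    (fun j => tif (beq (un j) i) (Nd Lf (tnth y (un j))) (tnth y (un j)))) j <=
  \sum_(j < len m) sz (nth Lf (sp y) j) + \sum_(j < len m) 3.
  rewrite -big_split; apply: leq_sum => j _ /=.
  by rewrite /tif; case: ifP => _; rewrite ?sz_Nd ?sz_Lf tnthE len_un; lia.
by rewrite sum_nat_const card_ord; lia.
Qed.

Definition tick_growth n := n * (n * (8 * (n + 4) ^ 2 + 1) + 2) + 8 * (n + 4) ^ 2 + 10 * n + 20.

Lemma sz_state f a b c : sz (Nd f (Nd a (Nd b c))) = sz f + sz a + sz b + sz c + 3.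
Proof. rewrite !sz_Nd; lia. Qed.

(** No assumption on [s] is made: new matrix entries and new values of [D] come out of [zdiv], whose
    size depends on [W] only, and a counter grows by one node. So a round adds a polynomial amount
    even to a meaningless state. *)
Lemma sz_tick m r W t s :
  sz (tick m r W t s) <= sz s + tick_growth (len m + len r + len W).
Proof.
rewrite {1}/tick {1}/tif; case: ifP => _; first by rewrite leq_addr.
set N := hd (tl s); set D := hd (tl (tl s)); set y := tl (tl (tl s)).
have Hs : sz N + sz D + sz y <= sz s + 3.
  by have := sz_hd_tl s; have := sz_hd_tl (tl s); have := sz_hd_tl (tl (tl s)); rewrite -/N -/D -/y; lia.
set n := len m + len r + len W; set G := 8 * (n + 4) ^ 2.
have HG x d : sz (zdiv W x d) <= G.
  apply: leq_trans (zdiv_sz _ _ _) _; rewrite leq_mul2l /= leq_exp2r // /n; lia.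
have HT F : (forall i j, sz (F i j) <= G) -> sz (mktab m r F) <= n * (n * G.+1 + 2) + 1.
  move=> HF; apply: leq_trans (sz_tab_le (B := n * G.+1 + 1) _ _) _ => [i|].
    apply: leq_trans (sz_tab_le _ (HF i)) _; rewrite leq_add2r leq_mul2r /n; lia.
  rewrite leq_add2r -addnS leq_mul2r /n; lia.
have HZ : sz (tzeros m) <= 2 * n + 1.
  apply: leq_trans (sz_tab_le (B := 1) _ _) _ => //; rewrite /n; lia.
have HB i := sz_bump m y i.
have Gd x : sz (znorm W x) <= G by exact: HG.
rewrite /tick_growth -/G addn1 /step /do_pivot /do_double /tif; case: ifP => _.
  rewrite sz_state sz_Lf; have := HT (fun i j => pivot_entry W N D (hd (find_row m r N D))
    (hd (find_col r N D (hd (find_row m r N D)))) i j) (fun i j => HG _ _).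
  by have := Gd (mget N (hd (find_row m r N D)) (hd (find_col r N D (hd (find_row m r N D))))); lia.
case: ifP => _; last by rewrite sz_state /(sz tru) /=; lia.
rewrite /do_inc /do_double /tif; case: ifP => _.
  rewrite sz_state sz_Lf; have := HT (fun k j => znorm W (tif (beq k (hd (find_bad m r N y)))
    (zadd (mget N k j) (mget N k j)) (mget N k j))) (fun i j => Gd _).
  by have := Gd D; rewrite /tif; lia.
rewrite sz_state sz_Lf; have := HB (hd (find_bad m r N y)).
have : len m <= n by rewrite /n; lia.
lia.
Qed.

Lemma un_inj : injective un.
Proof. exact: (can_inj len_un). Qed.

Lemma beq_un i j : isnd (beq (un i) (un j)) = (i == j).
Proof. by rewrite /beq (inj_eq un_inj); case: eqP. Qed.

Lemma zval_four : zval zfour = 4%R. Proof. by []. Qed.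

Lemma ugeP a b : isnd (uge a b) = (len b <= len a)%N.
Proof.
rewrite /uge /tif tfor_iter; have := iter_tl (len a) b.
by case: (iter _ _ _) => [|? ?] /= E; lia.
Qed.

Section Correct.
Variables (F : realFieldType) (m' r' : nat) (A : 'M[int]_(m', r')).
Variables (m r W t : tree).
Hypotheses (Hm : len m = m') (Hr : len r = r') (Ht : len t = tau m').
Local Open Scope ring_scope.

Definition zmat N : 'M[int]_(m', r') := \matrix_(i, j) zval (mget N (un i) (un j)).
Definition counts y (l : 'I_m') : nat := len (tnth y (un l)).

Lemma pivtestP N D (k : 'I_m') (j : 'I_r') :
  isnd (pivtest N D (un k) (un j)) = (4 * zval D ^+ 2 <= zmat N k j ^+ 2).
Proof. by rewrite zleP !zval_mul zval_four mxE !expr2. Qed.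

Lemma zmat_tab f : zmat (mktab m r f) = \matrix_(i, j) zval (f (un i) (un j)).
Proof.
apply/matrixP => i j; rewrite !mxE /mget /mktab tnth_tab ?Hm // tnth_tab ?Hr //.
Qed.

Lemma counts_zeros l : counts (tzeros m) l = 0%N.
Proof. by rewrite /counts /tzeros tnth_tab ?Hm. Qed.

Lemma zval_comb N y (j : 'I_r') : zval (tcomb m N y (un j)) = comb (counts y) (zmat N) j.
Proof.
rewrite /tcomb zval_sum Hm; apply: eq_bigr => l _.
rewrite zval_sum (eq_bigr (fun => zmat N l j)) => [|i _]; last by rewrite mxE.
by rewrite sumr_const card_ord mulr_natl.
Qed.

Lemma row_testP N y (i : 'I_m') : isnd (row_test m r N y (un i)) =
  (\sum_j zmat N i j * comb (counts y) (zmat N) j <= 0).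
Proof.
rewrite zleP zval_sum Hr; congr (_ <= _); apply: eq_bigr => j _.
by rewrite zval_mul zval_comb mxE.
Qed.

Lemma counts_bump y (i l : 'I_m') :
  counts (bump_count m y (un i)) l = (counts y l + (l == i))%N.
Proof.
rewrite /counts /bump_count tnth_tab ?Hm // /tif beq_un.
by rewrite -(inj_eq val_inj); case: eqP => _ /=; lia.
Qed.

Lemma znormE x : `|zval x| < 2 ^+ len W -> zval (znorm W x) = zval x.
Proof.
rewrite ltr_norml -!natrX => /andP[h1 h2]; apply: zdivE; rewrite ?zval1 ?mulr1 //; lia.
Qed.

Lemma pivot_entryE N D k j0 N' (i : 'I_m') (j : 'I_r') :
  zval D != 0 -> pivoted (zmat N) (zval D) k j0 N' -> `|N' i j| < 2 ^+ len W ->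
  zval (pivot_entry W N D (un k) (un j0) (un i) (un j)) = N' i j.
Proof.
move=> D0 HN'; rewrite ltr_norml -!natrX => /andP[h1 h2]; apply: zdivE; try lia.
  by rewrite zval_mul -expr2 exprn_even_gt0.
rewrite !zval_mul mulrA; congr (_ * _); rewrite mulrC HN' /tif beq_un (inj_eq val_inj).
case: eqP => [->|_].
  by rewrite zval_mul !mxE mulr1n; ring.
by rewrite zval_add zval_opp !zval_mul !mxE mulr0n; ring.
Qed.

Hypotheses (m2 : (2 <= m')%N) (rm : (r' <= m')%N) (A_le : forall i j, `|A i j| <= m'%:R).
Hypothesis HW : len W = (m' ^ 18)%N.
Let inv k N D y := run_inv F A k (zmat N) (zval D) (counts y).

Lemma m_pos : (0 < m')%N. Proof. exact: ltnW. Qed.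

(** The origin of the width m^18: up to round m^16 the entries need m^17 + 2 m^2 bits, which is less
    than 2 m^17. *)
Lemma bits_ok k : (k <= m' ^ 16)%N -> (2 * m' ^ 2 + k * m' < len W)%N.
Proof.
move=> hk; rewrite HW.
have h1 : (k * m' <= m' ^ 17)%N by rewrite (expnS _ 16) mulnC leq_mul2l hk orbT.
have h2 : (2 * m' ^ 2 < m' ^ 17)%N.
  apply: (@leq_trans (2 * m' ^ 2).+1) => //.
  have -> : (m' ^ 17 = m' ^ 15 * m' ^ 2)%N by rewrite -expnD.
  rewrite ltn_mul2r expn_gt0 m_pos /=.
  by apply: (@leq_trans (2 ^ 15)); rewrite ?leq_exp2r.
have h3 : (2 * m' ^ 17 <= m' ^ 18)%N by rewrite (expnS _ 17) leq_mul2r m2 orbT.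
lia.
Qed.

Lemma bound_ok k N D y : (k <= m' ^ 16)%N -> run_inv F A k N D y ->
  (forall i j, `|N i j| < 2 ^+ len W) /\ `|D| < 2 ^+ len W.
Proof.
move=> hk /(run_entries m_pos rm A_le)[H1 H2].
have H : 2 ^+ (2 * m' ^ 2 + k * m') < 2 ^+ len W :> int.
  by rewrite -!natrX ltr_nat ltn_exp2l // bits_ok.
by split=> [i j|]; [apply: le_lt_trans (H1 i j) H|apply: le_lt_trans H2 H].
Qed.

(** The computed quotients are exact only if the next tableau fits into the width. The abstract rule
    provides that tableau and its invariant beforehand, [bound_ok] bounds its entries, and the
    computed matrix is identified with it afterwards. *)
Lemma step_ok k N D y : (k < m' ^ 16)%N -> inv k N D y ->
  let s := step m r W t N D y in
  (isnd (hd s) /\ exists x : 'I_r' -> F, forall i, 0 < slack A x i) \/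
  (hd s = Lf /\ inv k.+1 (hd (tl s)) (hd (tl (tl s))) (tl (tl (tl s)))).
Proof.
move=> hk Hinv; have D0 : zval D != 0 by case: (Hinv) => e [p [[C [_ _ ? _ _]] _ _ _ _]].
have [HN HDb] := bound_ok (ltnW hk) Hinv.
rewrite /step /find_row /find_bad /tif; case: (tfindP m _) => [k1 lt1 Hk1|Hno] /=; last first.
  have {}Hno (k0 : 'I_m') (j : 'I_r') : zmat N k0 j ^+ 2 < 4 * zval D ^+ 2.
    have := Hno k0; rewrite Hm => /(_ (ltn_ord k0)); rewrite ltNge -pivtestP.
    rewrite /find_col; case: tfindP => // Hno' _; apply: Hno'; by rewrite Hr.
  case: (tfindP m _) => [i lti Hi|Hall] /=; last first.
    left; split=> //; case: (Hinv) => e [p [HT _ _ _ _]].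
    apply: (tableau_feasible F (z := comb (counts y) (zmat N)) HT) => i.
    have := Hall i; rewrite Hm => /(_ (ltn_ord i)); by rewrite row_testP -ltNge.
  rewrite Hm in lti; pose i' := Ordinal lti; rewrite (row_testP N y i') in Hi.
  have Hb l := counts_bump y i' l.
  right; rewrite /do_inc /tif ugeP Ht; case: ifP => Hge /=; split=> //; rewrite /inv.
    have Hge' : (tau m' <= counts (bump_count m y (un i')) i')%N by [].
    pose N' := \matrix_(k, j) (if k == i' then zmat N k j + zmat N k j else zmat N k j) : 'M[int]_(m', r').
    have HN' k0 j : N' k0 j = if k0 == i' then zmat N k0 j + zmat N k0 j else zmat N k0 j.
      by rewrite mxE.
    have Hrun := run_double m_pos rm Hinv Hno Hi Hb Hge' HN' (@counts_zeros).
    have [HNb _] := bound_ok hk Hrun.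
    rewrite (znormE HDb); rewrite (_ : zmat _ = N'); first exact: Hrun.
    apply/matrixP => a b; rewrite zmat_tab mxE.
    have E : zval (tif (beq (un a) (un i)) (zadd (mget N (un a) (un b)) (mget N (un a) (un b)))
      (mget N (un a) (un b))) = N' a b.
      rewrite HN' /tif beq_un -(inj_eq val_inj) /=; case: ifP => _; rewrite ?zval_add mxE //.
    by rewrite znormE E.
  have Hlt : (counts (bump_count m y (un i')) i' < tau m')%N by rewrite ltnNge Hge.
  exact: (run_inc m_pos Hinv Hno Hi Hb Hlt).
right; split=> //; move: Hk1; rewrite /find_col; case: tfindP => // j lt2 Hj _ /=.
rewrite Hm in lt1; rewrite Hr in lt2; pose k' := Ordinal lt1; pose j' := Ordinal lt2.
have Hpv := pivtestP N D k' j'; rewrite Hj in Hpv; symmetry in Hpv.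
have [N' HN' Hrun] := run_pivot m_pos Hinv Hpv (@counts_zeros).
have [HNb HDb'] := bound_ok hk Hrun.
have ED : zval (znorm W (mget N (un k1) (un j))) = zmat N k' j'.
  by rewrite znormE; rewrite [zmat N k' j']mxE in HDb' *.
rewrite /inv ED; rewrite (_ : zmat _ = N'); first exact: Hrun.
apply/matrixP => a b; rewrite zmat_tab mxE.
exact: (pivot_entryE (k := k') (j0 := j') D0 HN' (HNb a b)).
Qed.

Lemma loop_ok N D y n : (n <= m' ^ 16)%N -> inv 0 N D y ->
  let s := iter n (tick m r W t) (Nd Lf (Nd N (Nd D y))) in
  (isnd (hd s) /\ exists x : 'I_r' -> F, forall i, 0 < slack A x i) \/
  (hd s = Lf /\ inv n (hd (tl s)) (hd (tl (tl s))) (tl (tl (tl s)))).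
Proof.
move=> + H0; elim: n => [|n IH] hn; first by right.
rewrite iterS; move: (iter n _ _) (IH (ltnW hn)) => s [[H1 H2]|[H1 H2]]; rewrite /tick /tif.
  by rewrite H1; left.
by rewrite H1; exact: (step_ok hn H2).
Qed.

(** A raised flag comes with a solution by [loop_ok]. Conversely, a run still going after m^16
    rounds contradicts [run_bound] at a vertex. *)
Lemma loop_correct N D y :
  (forall j, exists i, forall j', A i j' = (j' == j)%:R) ->
  zmat N = A -> zval D = 1 -> (forall l, counts y l = 0%N) ->
  isnd (hd (iter (m' ^ 16) (tick m r W t) (Nd Lf (Nd N (Nd D y))))) <->
  exists x : 'I_r' -> F, forall i, 0 < slack A x i.
Proof.
move=> HU EN ED Ey.
have H0 : inv 0 N D y.
  by rewrite /inv EN ED; exact: (run_init F m_pos HU Ey).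
split.
  by case: (loop_ok (leqnn _) H0) => [[]|[->]].
move=> [x Hx]; case: (loop_ok (leqnn _) H0) => [[]//|[_ Hrun]].
have [x' Hx'] := vertex HU m_pos rm A_le Hx.
have := run_bound m_pos rm A_le m2 Hrun (fun i => (Hx' i).1) (fun i => (Hx' i).2).
by rewrite ltnn.
Qed.

End Correct.

(** * From lists of literals to a matrix *)

Definition litneg q := Nd (tif (hd q) Lf tru) (tl q).
Definition lits rows := tflat rows (fun i => tnth rows i).
Definition negs l := tab l (fun i => litneg (tnth l i)).
(** A free unknown becomes a signed sum of positive unknowns, one for each occurrence of a literal
    and one for its negation. Their positivity is expressed by unit rows, which provide the initial
    tableau. *)
Definition cols rows := tcat (lits rows) (negs (lits rows)).
Definition zminus1 := Nd Lf zone.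
Definition dense_entry row c := zsum row (fun t =>
  zadd (tif (beq (tnth row t) c) zconst1 Lf) (tif (beq (tnth row t) (litneg c)) zminus1 Lf)).
Definition nrows rows := uadd (cols rows) rows.
Definition udrop a b := tfor a (fun _ t => tl t) b.
Definition dense rows X := mktab (uadd X rows) X (fun i j =>
  tif (uge i X) (dense_entry (tnth rows (udrop X i)) (tnth X j)) (tif (beq i j) zconst1 Lf)).
Definition umul a b := tfor a (fun _ acc => uadd b acc) Lf.
Definition usq a := umul a a.

(** With [K] of length m^16, the width [umul K (usq m)] is m^18, and the next argument is [tau] of
    m. *)
Definition lp_loop m r K s :=
  hd (tfor K (fun _ s => tick m r (umul K (usq m)) (umul (un 16) (usq (usq m))) s) s).
Definition lp rows := lp_loop (nrows rows) (cols rows) (usq (usq (usq (usq (nrows rows)))))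
  (Nd Lf (Nd (dense rows (cols rows)) (Nd zconst1 (tzeros (nrows rows))))).

Lemma FP_umul F G : FP F -> FP G -> FP (fun x => umul (F x) (G x)).
Proof.
move=> HF HG; apply: (@FP_tfor_add F (fun x _ acc => uadd (G x) acc)) => //; [by fp|by fp|].
have [k Hk] := FP_sz HG; exists k.+1 => x i acc; rewrite sz_uadd addnC leq_add2l.
have h := len_sz (G x); have := Hk x.
have : (sz x + 2) ^ k <= (sz x + sz i + 3) ^ k by apply: leq_expl; lia.
rewrite expnS; nia.
Qed.

Lemma FP_udrop F G : FP F -> FP G -> FP (fun x => udrop (F x) (G x)).
Proof.
move=> HF HG; apply: (FP_tfor_step (f := tl)) => //; first exact: FP_tl FP_id.
by exists 0 => st; rewrite addn0 sz_tl.
Qed.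

Lemma FP_negs F : FP F -> FP (fun x => negs (F x)).
Proof. by move=> HF; rewrite /negs /litneg; fp. Qed.

Lemma FP_cols F : FP F -> FP (fun x => cols (F x)).
Proof. by move=> HF; apply: FP_tcat; rewrite /negs /litneg /lits; fp. Qed.

Lemma FP_dense F G : FP F -> FP G -> FP (fun x => dense (F x) (G x)).
Proof.
move=> HF HG; rewrite /dense /mktab; fp.
  by apply: FP_uge; fp.
have H : FP (fun p => udrop (G (hd (hd p))) (tl (hd p))) by apply: FP_udrop; fp.
by rewrite /dense_entry /litneg; fp; apply: FP_comp H _; fp.
Qed.

Lemma FP_lp_loop m r K s : FP m -> FP r -> FP K -> FP s ->
  FP (fun x => lp_loop (m x) (r x) (K x) (s x)).
Proof.
move=> Hm Hr HK Hs; apply: FP_hd.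
have HW : FP (fun x => umul (K x) (usq (m x))).
  by apply: FP_umul => //; apply: FP_umul.
have Ht : FP (fun x => umul (un 16) (usq (usq (m x)))).
  by apply: FP_umul; [fp|do 2!apply: FP_umul => //; apply: FP_umul].
apply: (@FP_tfor_add K (fun x _ s => tick (m x) (r x) (umul (K x) (usq (m x))) (umul (un 16) (usq (usq (m x)))) s)) => //.
  rewrite /FP3; apply: FP_tick; last by fp.
  - by fp.
  - by fp.
  - by apply: (FP_comp HW); fp.
  - by apply: (FP_comp Ht); fp.
have pm := pb_len (FP_sz Hm); have pr := pb_len (FP_sz Hr); have pW := pb_len (FP_sz HW).
have [k Hk] : poly_bounded sz (fun x => tick_growth (len (m x) + len (r x) + len (umul (K x) (usq (m x))))).
  by rewrite /tick_growth; pb.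
exists k => x i acc; apply: leq_trans (sz_tick _ _ _ _ _) _; rewrite leq_add2l.
by apply: leq_trans (Hk x) _; apply: leq_expl; lia.
Qed.

Lemma FP_lp F : FP F -> FP (fun x => lp (F x)).
Proof.
move=> HF; have HX := FP_cols HF; have Hm := FP_uadd HX HF.
apply: FP_lp_loop => //; first by do 4!(apply: FP_umul => //).
by have HD := FP_dense HF HX; rewrite /tzeros; fp.
Qed.

Lemma len_umul a b : len (umul a b) = len a * len b.
Proof. by rewrite /umul tfor_iter; elim: (len a) => //= n IH; rewrite len_uadd IH mulSn. Qed.

Lemma len_udrop a b : len (udrop a b) = len b - len a.
Proof. by rewrite /udrop tfor_iter iter_tl. Qed.

Section Feasible.
Variable F : realFieldType.
Local Open Scope ring_scope.

Definition sg (q : tree) : F := if isnd (hd q) then 1 else -1.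
Definition row_val (x : tree -> F) row : F := \sum_(q <- sp row) sg q * x (tl q).
Definition feasible rows := exists x : tree -> F, forall row, row \in sp rows -> 0 < row_val x row.
Definition is_lit q := (q == Nd tru (tl q)) || (q == Nd Lf (tl q)).
Definition wf_rows rows := forall row q, row \in sp rows -> q \in sp row -> is_lit q.

Lemma sp_lits rows : sp (lits rows) = flatten (map sp (sp rows)).
Proof.
rewrite sp_tflat -[in RHS](mkseq_nth Lf (sp rows)) size_sp /mkseq -map_comp.
by congr flatten; apply: eq_map => i /=; rewrite tnthE len_un.
Qed.

Lemma sp_negs l : sp (negs l) = map litneg (sp l).
Proof.
rewrite sp_tab -[in RHS](mkseq_nth Lf (sp l)) size_sp /mkseq -map_comp.
by apply: eq_map => i /=; rewrite tnthE len_un.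
Qed.

Lemma sp_cols rows : sp (cols rows) = sp (lits rows) ++ map litneg (sp (lits rows)).
Proof. by rewrite sp_tcat sp_negs. Qed.

Lemma len_cols rows : len (cols rows) = (2 * len (lits rows))%N.
Proof. by rewrite -!size_sp sp_cols size_cat size_map; lia. Qed.

Lemma lit_eq q c : is_lit q -> is_lit c ->
  (q == c)%:R - (q == litneg c)%:R = (tl q == tl c)%:R * (sg q * sg c) :> F.
Proof.
have HN s a t b : (Nd s a == Nd t b) = (s == t) && (a == b).
  by apply/eqP/andP => [[-> ->]|[/eqP-> /eqP->]].
rewrite /is_lit /litneg /sg => /orP[] /eqP -> /orP[] /eqP -> /=; rewrite /tif /= !HN /=;
  case: (_ == _) => /=; ring.
Qed.

Lemma litneg_lit c : is_lit (litneg c).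
Proof. by rewrite /is_lit /litneg /tif; case: ifP; rewrite eqxx ?orbT. Qed.

Variable rows : tree.
Hypothesis wf : wf_rows rows.
Let X := cols rows.
Let r := len X.
Let m := len (nrows rows).

Definition col (j : 'I_r) := nth Lf (sp X) j.

Lemma col_lit j : is_lit (col j).
Proof.
have : col j \in sp X by apply: mem_nth; rewrite size_sp.
rewrite sp_cols mem_cat => /orP[|/mapP[c _ ->]]; last exact: litneg_lit.
by rewrite sp_lits => /flatten_mapP[row Hrow]; apply: wf.
Qed.

Lemma zval_dense_entry row c :
  zval (dense_entry row c) = \sum_(q <- sp row) ((q == c)%:R - (q == litneg c)%:R).
Proof.
rewrite /dense_entry zval_sum (big_nth Lf) size_sp big_mkord; apply: eq_bigr => i _.
rewrite zval_add tnthE len_un /beq /tif.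
by case: eqP => _; case: eqP => _.
Qed.

Definition Amat : 'M[int]_(m, r) := zmat m r (dense rows X).

Lemma m_eq : m = (r + len rows)%N. Proof. exact: len_uadd. Qed.

Lemma AmatE (i : 'I_m) (j : 'I_r) : Amat i j =
  if (i < r)%N then (i == j :> nat)%:R
  else \sum_(q <- sp (nth Lf (sp rows) (i - r))) ((q == col j)%:R - (q == litneg (col j))%:R).
Proof.
rewrite /Amat /dense zmat_tab // mxE /tif ugeP len_un -/r ltnNge.
case: leqP => le /=; last by rewrite beq_un; case: eqP.
by rewrite zval_dense_entry !tnthE len_udrop !len_un.
Qed.

Lemma Amat_units j : exists i, forall j', Amat i j' = (j' == j)%:R.
Proof.
have lt : (j < m)%N by rewrite m_eq ltn_addr.
by exists (Ordinal lt) => j'; rewrite AmatE /= ltn_ord eq_sym.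
Qed.

(** An entry is at most twice the number of literals in its row, and every literal occurrence
    contributes two columns, so the number of columns is a bound. *)
Lemma Amat_le i j : `|Amat i j| <= m%:R.
Proof.
rewrite AmatE; have [lt|ge] := ltnP i r.
  rewrite normr_nat ler_nat; apply: (@leq_trans 1); first by case: (_ == _).
  exact: leq_ltn_trans (leq0n _) (ltn_ord i).
set row := nth _ _ _; apply: le_trans (ler_norm_sum _ _ _) _.
apply: (@le_trans _ _ (\sum_(q <- sp row) 2)).
  by apply: ler_sum => q _; case: (_ == _); case: (_ == _).
have -> : \sum_(q <- sp row) 2 = (2 * size (sp row))%:R :> int.
  by rewrite big_const_seq count_predT iter_addr_0 natrM mulr_natr.
rewrite ler_nat.
have Hrow : row \in sp rows.
  apply: mem_nth; rewrite size_sp; have : (i < r + len rows)%N by rewrite -m_eq.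
  lia.
apply: (@leq_trans r); last by rewrite m_eq leq_addr.
rewrite /r len_cols leq_mul2l /= -size_sp sp_lits.
case/splitPr: Hrow => l1 l2; rewrite map_cat flatten_cat /= !size_cat; lia.
Qed.

Lemma slack_unit (u : 'I_r -> F) (i : 'I_m) (lt : (i < r)%N) : slack Amat u i = u (Ordinal lt).
Proof.
rewrite /slack (bigD1 (Ordinal lt)) //= AmatE lt eqxx mul1r big1 ?addr0 // => j ne.
by rewrite AmatE lt; move: ne; rewrite -(inj_eq val_inj) eq_sym /= => /negbTE ->; rewrite mul0r.
Qed.

Lemma slack_row (u : 'I_r -> F) (i : 'I_m) : (r <= i)%N ->
  slack Amat u i = \sum_(q <- sp (nth Lf (sp rows) (i - r)))
    \sum_j ((q == col j)%:R - (q == litneg (col j))%:R) * u j.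
Proof.
move=> ge; rewrite /slack exchange_big; apply: eq_bigr => j _.
rewrite AmatE ltnNge ge /= rmorph_sum mulr_suml; apply: eq_bigr => q _.
by rewrite rmorphB /= !rmorph_nat.
Qed.

Lemma feasibleP : (exists u : 'I_r -> F, forall i, 0 < slack Amat u i) <-> feasible rows.
Proof.
split=> [[u Hu]|[x Hx]].
  exists (fun nm => \sum_j (tl (col j) == nm)%:R * sg (col j) * u j) => row Hrow.
  have lt : (r + index row (sp rows) < m)%N by rewrite m_eq ltn_add2l -size_sp index_mem.
  have := Hu (Ordinal lt); rewrite slack_row ?leq_addr //= addKn nth_index //.
  congr (_ < _); rewrite /row_val big_seq [RHS]big_seq; apply: eq_bigr => q Hq.
  rewrite mulr_sumr; apply: eq_bigr => j _.
  by rewrite (lit_eq (wf Hrow Hq) (col_lit j)) eq_sym; ring.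
(* For a literal [c], the difference of [g c] and [g (litneg c)] is its signed value, and the
   summand 1 makes [g] positive. Equal literals may fill several columns, among which [g c] is
   shared equally; hence the division by [cnt c]. *)
pose g c : F := 1 + Num.max (sg c * x (tl c)) 0.
pose cnt c : F := (count_mem c (sp X))%:R.
have g0 c : 0 < g c by apply: ltr_pwDl => //; rewrite le_max lexx orbT.
have Hsum q : q \in sp X -> \sum_(j < r) (q == col j)%:R * (g (col j) / cnt (col j)) = g q.
  move=> Hq; rewrite (eq_bigr (fun j => (q == col j)%:R * (g q / cnt q))); last first.
    by move=> j _; case: eqP => [<-|]; rewrite ?mul0r.
  rewrite -mulr_suml; have -> : \sum_(j < r) (q == col j)%:R = cnt q.
    rewrite /cnt -sum1_count natr_sum (big_nth Lf) size_sp big_mkord [RHS]big_mkcond.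
    by apply: eq_bigr => j _; rewrite eq_sym /=; case: (_ == _).
  by rewrite mulrC divfK // /cnt pnatr_eq0 -lt0n -has_count has_pred1.
exists (fun j => g (col j) / cnt (col j)) => i.
have [lt|ge] := ltnP i r.
  rewrite slack_unit divr_gt0 // /cnt ltr0n -has_count has_pred1.
  by apply: mem_nth; rewrite size_sp.
rewrite slack_row //; set row := nth _ _ _.
have Hrow : row \in sp rows.
  apply: mem_nth; rewrite size_sp; have : (i < r + len rows)%N by rewrite -m_eq.
  lia.
have := Hx row Hrow; congr (_ < _); rewrite /row_val big_seq [RHS]big_seq.
apply: eq_bigr => q Hq.
have Hl := wf Hrow Hq.
have HqX : q \in sp (lits rows) by rewrite sp_lits; apply/flatten_mapP; exists row.
have litnegK c : is_lit c -> litneg (litneg c) = c.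
  by rewrite /is_lit /litneg => /orP[] /eqP -> /=.
rewrite (eq_bigr (fun j => (q == col j)%:R * (g (col j) / cnt (col j)) -
     (litneg q == col j)%:R * (g (col j) / cnt (col j)))); last first.
  move=> j _; rewrite mulrBl; congr (_ - (nat_of_bool _)%:R * _).
  by apply/idP/idP => /eqP; [move=> ->|move=> <-]; rewrite litnegK ?col_lit.
rewrite sumrB !Hsum; first last.
- by rewrite sp_cols mem_cat HqX.
- by rewrite sp_cols mem_cat map_f ?orbT.
rewrite /g /litneg /sg /tif /=; case: ifP => _ /=; set z := x _.
  rewrite !mul1r mulN1r /Num.max; case: ltP => h1; case: ltP => h2; lra.
rewrite !mul1r mulN1r /Num.max; case: ltP => h1; case: ltP => h2; lra.
Qed.

Lemma lpP : (0 < len (lits rows))%N -> isnd (lp rows) <-> feasible rows.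
Proof.
move=> l0; rewrite -feasibleP /lp /lp_loop tfor_iter.
have m2 : (2 <= m)%N by rewrite m_eq /r len_cols; lia.
have -> : len (usq (usq (usq (usq (nrows rows))))) = (m ^ 16)%N.
  by rewrite /usq !len_umul -/m; ring.
apply: (@loop_correct F m r Amat) => //.
- by rewrite !len_umul len_un /tau -/m; ring.
- by rewrite m_eq leq_addr.
- exact: Amat_le.
- by rewrite /usq !len_umul -/m; ring.
- exact: Amat_units.
- by move=> l; apply: counts_zeros.
Qed.
End Feasible.

(** * Formulas as trees *)

Definition bit_tree (a : sym) := if a is S1 then tru else Lf.
(** A variable is named by its bits as they stand in the input, so the parser never decodes a
    number. *)
Definition var_tree (p : nat) := lst (map bit_tree (pos_bits (Pos.of_succ_nat p))).

Definition tag0 := Lf.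
Definition tag1 := Nd Lf Lf.
Definition tag2 := Nd Lf (Nd Lf Lf).

Fixpoint ftree (f : form) : tree :=
  match f with
  | FVar p => Nd tag0 (var_tree p)
  | FImp a b => Nd tag1 (Nd (ftree a) (ftree b))
  | FBox a => Nd tag2 (ftree a)
  end.

Lemma var_tree_inj : injective var_tree.
Proof.
move=> p q /(can_inj lstK) E; apply: SuccNat2Pos.inj.
elim: (Pos.of_succ_nat p) (Pos.of_succ_nat q) E => [a IH|a IH|] [b|b|] //= [] /IH -> //.
Qed.

Lemma ftree_inj : injective ftree.
Proof.
elim=> [p|a IHa b IHb|a IHa] [q|c d|c] //=.
- by case=> /var_tree_inj ->.
- by case=> /IHa -> /IHb ->.
- by case=> /IHa ->.
Qed.
HB.instance Definition _ := Equality.copy form (inj_type ftree_inj).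

(** Repetitions are kept: this is the list that the parser accumulates, and its length is still
    small enough to serve as depth and branching degree. *)
Fixpoint bodies (f : form) : seq form :=
  match f with
  | FVar _ => [::]
  | FImp a b => bodies a ++ bodies b
  | FBox a => a :: bodies a
  end.

Fixpoint fvars (f : form) : seq nat :=
  match f with
  | FVar p => [:: p]
  | FImp a b => fvars a ++ fvars b
  | FBox a => fvars a
  end.

Fixpoint mdepth (f : form) : nat :=
  match f with
  | FVar _ => 0
  | FImp a b => maxn (mdepth a) (mdepth b)
  | FBox a => (mdepth a).+1
  end.

Lemma mdepth_bodies f : mdepth f <= size (bodies f).
Proof. by elim: f => //= a IHa b IHb; rewrite size_cat; lia. Qed.

Lemma size_bodies_sub f c : c \in bodies f -> size (bodies c) <= size (bodies f).
Proof.
elim: f => //= [a IHa b IHb|a IHa].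
  by rewrite mem_cat size_cat => /orP[/IHa|/IHb]; lia.
by rewrite in_cons => /orP[/eqP->|/IHa]; lia.
Qed.

(** * Interval evaluation on a tree of worlds *)

(** [LLo c] and [LHi c] are bounds for [FBox c], not for [c]. *)
Inductive lname := LVar of nat | LLo of form | LHi of form.

Section IntervalEvaluation.
Local Open Scope ring_scope.
Section System.
Variables (tbl : seq form) (h : nat).

Fixpoint nodes (n : nat) : seq (seq form) :=
  if n is n'.+1 then [::] :: flatten [seq [seq c :: w | c <- tbl] | w <- nodes n'] else [::].

Lemma nodesE n w : (w \in nodes n) = (size w < n)%N && all (mem tbl) w.
Proof.
elim: n w => [|n IH] [|c w] //=; rewrite in_cons /=.
apply/flatten_mapP/idP => [[w' Hw' /mapP[d Hd [-> ->]]]|].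
  by move: Hw'; rewrite IH /= ltnS => /andP[-> ->]; rewrite /= Hd.
rewrite ltnS => /and3P[h1 h2 h3]; exists w; first by rewrite IH h1.
by apply/mapP; exists c.
Qed.

(* [ev true] is a lower bound and [ev false] an upper bound for the value at
   node [w], computed from atoms and from bounds for the boxed subformulas. *)
Fixpoint ev (b : bool) (X : seq form -> lname -> R) (w : seq form) (f : form) : R :=
  match f with
  | FVar p => X w (LVar p)
  | FImp a c => ev b X w c - ev (~~ b) X w a
  | FBox c => X w (if b then LLo c else LHi c)
  end.

(** A node is the list of choices that lead to it, the latest first. The child [c :: w] stands for a
    near-minimizer of [c]: it bounds [FBox c] from above, while every child of [w] bounds every box
    from below. *)
Definition sysfeas (phi : form) (X : seq form -> lname -> R) :=
  ev false X [::] phi < 0 /\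
  forall w c, w \in nodes h -> c \in tbl ->
    (forall d, d \in tbl -> X w (LLo d) < ev true X (c :: w) d) /\
    ev false X (c :: w) c < X w (LHi c).
End System.

Section Soundness.
Variables (phi : form) (X : seq form -> lname -> R).
Let tbl := bodies phi.
Let h := size tbl.
Hypothesis HX : sysfeas tbl h phi X.

(** Set to 0 outside the finite tree and the variables of [phi], because a model needs a bounded
    valuation. *)
Definition tval (p : nat) (w : seq form) : R :=
  if (w \in nodes tbl h.+1) && (p \in fvars phi) then X w (LVar p) else 0.
Definition tbound : R :=
  \sum_(w <- nodes tbl h.+1) \sum_(p <- fvars phi) `|X w (LVar p)|.

Lemma tbound_ge0 : 0 <= tbound.
Proof. by apply: sumr_ge0 => w _; apply: sumr_ge0. Qed.

Lemma tval_bound p w : - tbound <= tval p w <= tbound.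
Proof.
rewrite -ler_norml /tval; case: ifP => [/andP[Hw Hp]|_]; last by rewrite normr0 tbound_ge0.
rewrite /tbound (big_rem w) //= (big_rem p) //= -addrA lerDl addr_ge0 ?sumr_ge0 //.
by move=> w' _; apply: sumr_ge0.
Qed.

Definition tmodel : KAmodel := {|
  world := seq form; world_nonempty := inhabits [::];
  acc := fun w w' => w \in nodes tbl h /\ exists2 c, c \in tbl & w' = c :: w;
  val := tval; bound := tbound; bound_ge0 := tbound_ge0; val_bound := tval_bound |}.

(** The depth condition ensures that a node where a box is evaluated has children. The infimum is
    above the lower bound because all children are, and below the upper bound because of the child
    [a :: w]. *)
Lemma tmodel_eval f w : {subset bodies f <= tbl} -> {subset fvars f <= fvars phi} ->
  w \in nodes tbl h.+1 -> (size w + mdepth f <= h)%N ->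
  ev true X w f <= eval tmodel f w <= ev false X w f.
Proof.
elim: f w => [p|a IHa b IHb|a IHa] w /= Hb Hv Hw Hd.
- by rewrite /tval Hw Hv ?mem_head // lexx.
- have /andP[a1 a2] : ev true X w a <= eval tmodel a w <= ev false X w a.
    apply: IHa => //; last by apply: leq_trans Hd; rewrite leq_add2l leq_maxl.
      by move=> z Hz; apply: Hb; rewrite mem_cat Hz.
    by move=> z Hz; apply: Hv; rewrite mem_cat Hz.
  have /andP[b1 b2] : ev true X w b <= eval tmodel b w <= ev false X w b.
    apply: IHb => //; last by apply: leq_trans Hd; rewrite leq_add2l leq_maxr.
      by move=> z Hz; apply: Hb; rewrite mem_cat Hz orbT.
    by move=> z Hz; apply: Hv; rewrite mem_cat Hz orbT.
  by rewrite !lerB.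
have Ha : a \in tbl by apply: Hb; rewrite mem_head.
have Hwh : w \in nodes tbl h.
  move: (Hw : w \in nodes tbl h.+1); rewrite !nodesE => /andP[_ ->]; rewrite andbT.
  by apply: leq_trans Hd; rewrite addnS ltnS leq_addr.
have Hc c : c \in tbl -> ev true X (c :: w) a <= eval tmodel a (c :: w) <= ev false X (c :: w) a.
  move=> Hc; apply: IHa => //; last by rewrite addSnnS.
    by move=> z Hz; apply: Hb; rewrite in_cons Hz orbT.
  by move: Hwh; rewrite !nodesE /= Hc.
set S := (Y in inf Y).
have SE c : c \in tbl -> S (eval tmodel a (c :: w)).
  by move=> Hc'; exists (c :: w) => //=; split=> //; exists c.
have Slb : lbound S (X w (LLo a)).
  move=> _ [_ [_ [c Hc' ->]] <-].
  have [H _] := HX.2 w c Hwh Hc'.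
  by apply/ltW/(lt_le_trans (H a Ha)); have /andP[] := Hc c Hc'.
apply/andP; split.
  by apply: lb_le_inf => //; exists (eval tmodel a (a :: w)); apply: SE.
apply: (@le_trans _ _ (eval tmodel a (a :: w))).
  by apply: ge_inf; [exists (X w (LLo a))|apply: SE].
have [_ /ltW H] := HX.2 w a Hwh Ha.
by apply: le_trans H; have /andP[] := Hc a Ha.
Qed.

Lemma sysfeas_invalid : ~ KA_valid phi.
Proof.
move=> /(_ tmodel [::]); apply/negP; rewrite -ltNge; apply: le_lt_trans HX.1.
have /andP[_ //] : ev true X [::] phi <= eval tmodel phi [::] <= ev false X [::] phi.
by apply: tmodel_eval => //; exact: mdepth_bodies.
Qed.
End Soundness.

Section Completeness.
Variables (phi : form) (M : KAmodel) (x0 : world M).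
Hypothesis phi_neg : eval M phi x0 < 0.
Let tbl := bodies phi.
Let h := size tbl.

(* Worlds without successors behave like a world [None] at which every formula
   has value 0 and which is its own successor. *)
Definition evo (f : form) (o : option (world M)) : R :=
  if o is Some y then eval M f y else 0.

Definition nb (f : form) : R := (size (bodies f))%:R.
Definition nphi : R := nb phi.
(** With n boxes, Kphi = 2 n + 2 gives delta l / 2 = (n + 1) delta (l + 1). Half of the slack at a
    level thus exceeds the accumulated error n delta (l + 1) of a child, and the other half pays for
    taking a near-minimizer. At the root, n dphi is less than Kphi dphi, the negated value of
    [phi]. *)
Definition Kphi : R := 2 * nphi + 2.
Definition dphi : R := - eval M phi x0 / Kphi.
Definition delta (l : nat) : R := dphi / Kphi ^+ l.

Lemma n_ge0 : 0 <= nphi. Proof. exact: ler0n. Qed.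
Lemma K_gt0 : 0 < Kphi. Proof. have := n_ge0; rewrite /Kphi; lra. Qed.
Lemma d0_gt0 : 0 < dphi. Proof. by rewrite divr_gt0 ?oppr_gt0 ?K_gt0. Qed.
Lemma delta_gt0 l : 0 < delta l.
Proof. by rewrite divr_gt0 ?d0_gt0 ?exprn_gt0 ?K_gt0. Qed.
Lemma deltaS l : delta l = Kphi * delta l.+1.
Proof.
rewrite /delta exprS invfM; have := lt0r_neq0 K_gt0; have := lt0r_neq0 (exprn_gt0 l K_gt0).
by move=> h1 h2; field; rewrite h1 h2.
Qed.

(** Needed because [inf] has the properties of an infimum only for sets that are bounded below. *)
Lemma eval_bounded f : exists B : R, forall y, `|eval M f y| <= B.
Proof.
elim: f => [p|a [A HA] b [B HB]|a [A HA]] /=.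
- by exists (bound M) => y; rewrite ler_norml; exact: val_bound.
- by exists (B + A) => y; apply: le_trans (ler_normB _ _) _; apply: lerD.
exists A => y; set S := (Y in inf Y).
have HS z : S z -> - A <= z <= A by move=> [y' _ <-]; rewrite -ler_norml.
have [[z Sz]|S0] := pselect (nonempty S); last first.
  rewrite inf_out ?normr0; first exact: le_trans (HA y).
  by case.
rewrite ler_norml; apply/andP; split.
  by apply: lb_le_inf; [exists z|move=> t /HS /andP[]].
apply: le_trans (_ : z <= A); last by have /andP[] := HS z Sz.
by apply: ge_inf => //; exists (- A) => t /HS /andP[].
Qed.

Lemma box_le a y y' : acc M y y' -> eval M (FBox a) y <= eval M a y'.
Proof.
move=> Hy; have [A HA] := eval_bounded a; apply: ge_inf; last by exists y'.
by exists (- A) => _ [z _ <-]; have := HA z; rewrite ler_norml => /andP[].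
Qed.

Lemma child_exists a y (e : R) : 0 < e -> (exists y', acc M y y') ->
  exists y', acc M y y' /\ eval M a y' < eval M (FBox a) y + e.
Proof.
move=> e0 [y' Hy]; have [A HA] := eval_bounded a.
set S := ((fun y => eval M a y) @` [set y' | acc M y y'])%classic.
have hS : has_inf S.
  split; first by exists (eval M a y'), y'.
  by exists (- A) => _ [z _ <-]; have := HA z; rewrite ler_norml => /andP[].
by have [_ [z Hz <-] Hlt] := inf_adherent e0 hS; exists z.
Qed.

Definition child a (o : option (world M)) (e : R) : option (world M) :=
  if o is Some y then
    if pselect (exists y', acc M y y' /\ eval M a y' < eval M (FBox a) y + e) is left H
    then Some (projT1 (cid H)) else None
  else None.

Fixpoint place (w : seq form) : option (world M) :=
  if w is c :: w' then child c (place w') (delta (size w') / 2) else Some x0.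

(** If no near-minimizer exists, there is no successor at all; every box then has value 0 at [y],
    and the child [None] matches it. *)
Lemma child_spec a o e : 0 < e ->
  (forall f, evo (FBox f) o <= evo f (child a o e)) /\
  evo a (child a o e) < evo (FBox a) o + e.
Proof.
move=> e0; case: o => [y|] /=; last by rewrite add0r.
case: pselect => [H|nH].
  case: (cid H) => z [Hz Hlt] /=; split=> // f; exact: box_le.
have E f : eval M (FBox f) y = 0.
  rewrite /= (_ : [set y' | acc M y y']%classic = set0) ?image_set0 ?inf0 //.
  rewrite -subset0 => z Hz; apply: nH; apply: child_exists => //; by exists z.
by split=> [f|] /=; [rewrite -/(eval M (FBox f) y) E|rewrite -/(eval M (FBox a) y) E add0r].
Qed.

Definition assign (w : seq form) (a : lname) : R :=
  match a with
  | LVar p => evo (FVar p) (place w)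
  | LLo f => evo (FBox f) (place w) - delta (size w)
  | LHi f => evo (FBox f) (place w) + delta (size w)
  end.

Lemma evo_imp a b o : evo (FImp a b) o = evo b o - evo a o.
Proof. by case: o => //=; rewrite subrr. Qed.

(** Each outermost box contributes one [delta], and errors add up through implications. [nb] also
    counts nested boxes, which only weakens the estimate. *)
Lemma assign_ev f w :
  evo f (place w) - nb f * delta (size w) <= ev true assign w f /\
  ev false assign w f <= evo f (place w) + nb f * delta (size w).
Proof.
have d_ge0 := ltW (delta_gt0 (size w)).
elim: f => [p|a [a1 a2] b [b1 b2]|a _] /=.
- by rewrite /nb /= mul0r subr0 addr0.
- rewrite evo_imp /nb /= size_cat natrD mulrDl; rewrite /nb in a1 a2 b1 b2; split; lra.
- rewrite /nb /=; have : 0 <= (size (bodies a))%:R * delta (size w) by apply: mulr_ge0.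
  by rewrite -[(size (bodies a)).+1]addn1 natrD mulrDl mul1r; split; lra.
Qed.

Lemma assign_feasible : sysfeas tbl h phi assign.
Proof.
split.
  have [_ H] := assign_ev phi [::]; apply: le_lt_trans H _.
  rewrite /= /delta expr0 divr1 /dphi -/nphi.
  have E : nphi * (- eval M phi x0 / Kphi) < - eval M phi x0.
    rewrite mulrA ltr_pdivrMr ?K_gt0 // mulrC ltr_pM2l ?oppr_gt0 // /Kphi.
    by have := n_ge0; lra.
  lra.
move=> w c Hw Hc.
have e0 : 0 < delta (size w) / 2 by rewrite divr_gt0 ?delta_gt0.
have [H1 H2] := child_spec c (place w) e0.
have Hn d : d \in tbl -> nb d * delta (size w).+1 < delta (size w) / 2.
  move=> Hd; have hn : nb d <= nphi by rewrite ler_nat; apply: size_bodies_sub.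
  have dp := delta_gt0 (size w).+1; rewrite (deltaS (size w)).
  have : nb d * delta (size w).+1 <= nphi * delta (size w).+1 by rewrite ler_pM2r.
  have -> : Kphi * delta (size w).+1 / 2 = nphi * delta (size w).+1 + delta (size w).+1.
    by rewrite /Kphi; field.
  lra.
split=> [d Hd|] /=.
  have [H _] := assign_ev d (c :: w); apply: lt_le_trans H.
  by have := H1 d; have := Hn d Hd; rewrite /=; lra.
have [_ H] := assign_ev c (c :: w); apply: le_lt_trans H _.
by have := Hn c Hc; rewrite /=; lra.
Qed.
End Completeness.

Theorem invalidP phi : (exists X, sysfeas (bodies phi) (size (bodies phi)) phi X) <-> ~ KA_valid phi.
Proof.
split=> [[X]|]; first exact: sysfeas_invalid.
move=> /existsNP[M /existsNP[x /negP]]; rewrite -ltNge => H.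
by exists (assign phi x); apply: assign_feasible.
Qed.

End IntervalEvaluation.

(** * Linear forms of formulas *)

Fixpoint litseq (b : bool) (f : form) : seq (bool * lname) :=
  match f with
  | FVar p => [:: (true, LVar p)]
  | FImp a c => litseq b c ++ [seq (~~ q.1, q.2) | q <- litseq (~~ b) a]
  | FBox c => [:: (true, if b then LLo c else LHi c)]
  end.

Definition ltree (a : lname) : tree :=
  match a with
  | LVar p => Nd tag0 (var_tree p)
  | LLo f => Nd tag1 (ftree f)
  | LHi f => Nd tag2 (ftree f)
  end.
Definition sign_tree (s : bool) := if s then tru else Lf.
Definition lit_tree (q : bool * lname) := Nd (sign_tree q.1) (ltree q.2).
Definition form_lits b f := lst (map lit_tree (litseq b f)).
(** Both linear forms are stored next to the formula: the lower form of an implication needs the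
    upper form of its antecedent, so the parser builds the two together. *)
Definition elem f := Nd (ftree f) (Nd (form_lits true f) (form_lits false f)).
Definition wtree (w : seq form) := lst (map ftree w).

Lemma ltree_inj : injective ltree.
Proof. by case=> [p|f|f] [q|g|g] //= [] => [/var_tree_inj|/ftree_inj|/ftree_inj] ->. Qed.
HB.instance Definition _ := Equality.copy lname (inj_type ltree_inj).
Lemma wtree_inj : injective wtree.
Proof. by move=> v w /(can_inj lstK) /(inj_map ftree_inj). Qed.

Lemma negs_map l : negs (lst (map lit_tree l)) = lst (map lit_tree [seq (~~ q.1, q.2) | q <- l]).
Proof.
apply: (can_inj spK); rewrite sp_negs !lstK -!map_comp; apply: eq_map => -[s a] /=.
by rewrite /litneg /lit_tree /=; case: s.
Qed.

Lemma tcat_lst a b : tcat (lst a) (lst b) = lst (a ++ b).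
Proof. by apply: (can_inj spK); rewrite sp_tcat !lstK. Qed.

Definition place_lits w l := tab l (fun i => Nd (hd (tnth l i)) (Nd w (tl (tnth l i)))).
Definition glit w (q : bool * lname) := Nd (sign_tree q.1) (Nd (wtree w) (ltree q.2)).

Lemma sp_place_lits w l : sp (place_lits (wtree w) (lst (map lit_tree l))) = map (glit w) l.
Proof.
rewrite sp_tab -[in RHS](mkseq_nth (true, LVar 0) l) /mkseq -map_comp -size_sp lstK size_map.
apply/eq_in_map => i; rewrite mem_iota /= => lt.
by rewrite tnthE lstK len_un (nth_map (true, LVar 0)).
Qed.

Lemma glit_lit w q : is_lit (glit w q).
Proof. by rewrite /is_lit /glit /sign_tree; case: (q.1); rewrite eqxx ?orbT. Qed.

(** * The system of inequalities *)

(** Prefixing [w] with [hd ej] addresses the child for [ej]; the tags select the unknowns [LLo] here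
    and [LHi] in [row_high]. *)
Definition row_low w ej ei :=
  tcat (place_lits (Nd (hd ej) w) (hd (tl ei))) (Nd (Nd Lf (Nd w (Nd tag1 (hd ei)))) Lf).
Definition row_high w ej :=
  tcat (Nd (Nd tru (Nd w (Nd tag2 (hd ej)))) Lf) (place_lits (Nd (hd ej) w) (negs (tl (tl ej)))).
Definition gen_rows nodes table root :=
  Nd (place_lits Lf (negs (tl (tl root))))
    (tflat nodes (fun a => tflat table (fun j =>
       Nd (row_high (tnth nodes a) (tnth table j))
          (tab table (fun i => row_low (tnth nodes a) (tnth table j) (tnth table i)))))).

Lemma FP_place_lits F G : FP F -> FP G -> FP (fun x => place_lits (F x) (G x)).
Proof. by move=> HF HG; rewrite /place_lits; fp. Qed.

Lemma FP_gen_rows F G H : FP F -> FP G -> FP H -> FP (fun x => gen_rows (F x) (G x) (H x)).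
Proof.
move=> HF HG HH; rewrite /gen_rows /row_high /row_low.
apply: FP_Nd; first by apply: FP_place_lits; [fp|apply: FP_negs; fp].
apply: FP_tflat => //; rewrite /FP2; apply: FP_tflat; first by fp.
rewrite /FP2; apply: FP_Nd.
  apply: FP_tcat; first by fp.
  by apply: FP_place_lits; [fp|apply: FP_negs; fp].
apply: FP_tab; first by fp.
rewrite /FP2; apply: FP_tcat; last by fp.
by apply: FP_place_lits; fp.
Qed.

(** Each round adds a level of the tree by prefixing all known nodes. The growth is multiplicative,
    so this loop lies outside the rule for [FP]. *)
Definition tnodes table := tfor table (fun _ acc =>
  Nd Lf (tflat acc (fun i => tab table (fun j => Nd (hd (tnth table j)) (tnth acc i))))) Lf.

Lemma sp_tnodes tbl : sp (tnodes (lst (map elem tbl))) = map wtree (nodes tbl (size tbl)).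
Proof.
rewrite /tnodes tfor_iter -[len _]size_sp lstK size_map; set f := fun acc => _.
elim: (size tbl) => //= n IH; congr (_ :: _).
rewrite sp_tflat map_flatten -map_comp; congr flatten.
set acc := iter _ _ _ in IH *; move: (nodes tbl n) IH => V IH.
rewrite -[in RHS](mkseq_nth [::] V) /mkseq -!map_comp -size_sp IH size_map.
apply/eq_in_map => i; rewrite mem_iota /= => lt.
rewrite sp_tab -[in RHS](mkseq_nth (FVar 0) tbl) /mkseq -!map_comp -size_sp lstK size_map.
apply/eq_in_map => j; rewrite mem_iota /= => ltj.
by rewrite !tnthE IH lstK !len_un (nth_map [::]) // (nth_map (FVar 0)).
Qed.

Section Equiv.
Local Open Scope ring_scope.
Implicit Types (X : seq form -> lname -> R) (x : tree -> R).

Definition agree X x := forall w a, x (Nd (wtree w) (ltree a)) = X w a.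

Lemma sgE (s : bool) t : sg R (Nd (sign_tree s) t) = if s then 1 else -1.
Proof. by case: s. Qed.

Lemma row_val_lits X x w l : agree X x ->
  \sum_(q <- map (glit w) l) sg R q * x (tl q) =
  \sum_(q <- l) (if q.1 then 1 else -1) * X w q.2.
Proof.
move=> H; rewrite big_map; apply: eq_bigr => q _; by rewrite sgE /= H.
Qed.

Lemma evE b X w f : ev b X w f = \sum_(q <- litseq b f) (if q.1 then 1 else -1) * X w q.2.
Proof.
elim: f b => [p|a IHa c IHc|c IHc] b /=; rewrite ?big_seq1 ?mul1r //.
rewrite big_cat IHa IHc big_map -sumrN; congr (_ + _); apply: eq_bigr => -[[] q] _ /=; ring.
Qed.

Lemma negE X w l :
  \sum_(q <- [seq (~~ q.1, q.2) | q <- l]) (if q.1 then 1 else -1) * X w q.2 =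
  - \sum_(q <- l) (if q.1 then 1 else -1) * X w q.2.
Proof. rewrite big_map -sumrN; apply: eq_bigr => -[[] q] _ /=; ring. Qed.

Variable phi : form.
Let tbl := bodies phi.
Let table := lst (map elem tbl).
Let rows := gen_rows (tnodes table) table (elem phi).

Lemma rows_spec row : row \in sp rows <->
  (row = place_lits Lf (negs (form_lits false phi)) \/
   exists w c, [/\ w \in nodes tbl (size tbl), c \in tbl &
     row = row_high (wtree w) (elem c) \/
     exists2 d, d \in tbl & row = row_low (wtree w) (elem c) (elem d)]).
Proof.
have Hw i : (i < size (nodes tbl (size tbl)))%N ->
    tnth (tnodes table) (un i) = wtree (nth [::] (nodes tbl (size tbl)) i).
  by move=> lt; rewrite tnthE sp_tnodes len_un (nth_map [::]).
have Ht j : (j < size tbl)%N -> tnth table (un j) = elem (nth (FVar 0) tbl j).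
  by move=> lt; rewrite tnthE lstK len_un (nth_map (FVar 0)).
have lt1 : len (tnodes table) = size (nodes tbl (size tbl)).
  by rewrite -size_sp sp_tnodes size_map.
have lt2 : len table = size tbl by rewrite -size_sp lstK size_map.
rewrite [sp rows]/= in_cons; split=> [/orP[/eqP->|]|[->|]].
- by left.
- rewrite sp_tflat lt1 => /flatten_mapP[i]; rewrite mem_iota /= => lti.
  rewrite sp_tflat lt2 => /flatten_mapP[j]; rewrite mem_iota /= => ltj.
  rewrite Hw // Ht // => Hrow; right.
  exists (nth [::] (nodes tbl (size tbl)) i), (nth (FVar 0) tbl j).
  split; [exact: mem_nth|exact: mem_nth|].
  move: Hrow; rewrite in_cons => /orP[/eqP->|]; first by left.
  rewrite sp_tab lt2 => /mapP[l]; rewrite mem_iota /= => ltl ->.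
  by right; exists (nth (FVar 0) tbl l); [exact: mem_nth|rewrite Ht].
- by rewrite eqxx.
case=> w [c [Hwn Hc Hrow]]; apply/orP; right.
rewrite sp_tflat lt1; apply/flatten_mapP; exists (index w (nodes tbl (size tbl))).
  by rewrite mem_iota /= index_mem.
rewrite sp_tflat lt2; apply/flatten_mapP; exists (index c tbl).
  by rewrite mem_iota /= index_mem.
rewrite Hw ?index_mem // Ht ?index_mem // !nth_index //= in_cons.
case: Hrow => [->|[d Hd ->]]; first by rewrite eqxx.
apply/orP; right; rewrite sp_tab lt2; apply/mapP; exists (index d tbl).
  by rewrite mem_iota /= index_mem.
by rewrite Ht ?index_mem // nth_index.
Qed.

Lemma row_high_sp w c : sp (row_high (wtree w) (elem c)) =
  map (glit w) [:: (true, LHi c)] ++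
  map (glit (c :: w)) [seq (~~ q.1, q.2) | q <- litseq false c].
Proof. by rewrite sp_tcat /= negs_map -[Nd _ (wtree w)]/(wtree (c :: w)) sp_place_lits. Qed.

Lemma row_low_sp w c d : sp (row_low (wtree w) (elem c) (elem d)) =
  map (glit (c :: w)) (litseq true d) ++ map (glit w) [:: (false, LLo d)].
Proof. by rewrite sp_tcat /= -[Nd _ (wtree w)]/(wtree (c :: w)) sp_place_lits. Qed.

Lemma root_sp : sp (place_lits Lf (negs (form_lits false phi))) =
  map (glit [::]) [seq (~~ q.1, q.2) | q <- litseq false phi].
Proof. by rewrite negs_map -[Lf]/(wtree [::]) sp_place_lits. Qed.

Lemma feasible_agree X x : agree X x ->
  (forall row, row \in sp rows -> 0 < row_val x row) <-> sysfeas tbl (size tbl) phi X.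
Proof.
move=> Hx.
have Vroot : row_val x (place_lits Lf (negs (form_lits false phi))) = - ev false X [::] phi.
  by rewrite /row_val root_sp (row_val_lits _ _ Hx) negE evE.
have Vhigh w c : row_val x (row_high (wtree w) (elem c)) =
    X w (LHi c) - ev false X (c :: w) c.
  rewrite /row_val row_high_sp big_cat !(row_val_lits _ _ Hx) negE -evE big_seq1 /=; ring.
have Vlow w c d : row_val x (row_low (wtree w) (elem c) (elem d)) =
    ev true X (c :: w) d - X w (LLo d).
  rewrite /row_val row_low_sp big_cat !(row_val_lits _ _ Hx) -evE big_seq1 /=; ring.
split=> [H|[H0 H1]].
  split.
    by rewrite -oppr_gt0 -Vroot; apply: H; apply/rows_spec; left.
  move=> w c Hw Hc; split=> [d Hd|]; rewrite -subr_gt0.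
    rewrite -Vlow; apply: H; apply/rows_spec; right.
    by exists w, c; split=> //; right; exists d.
  rewrite -Vhigh; apply: H; apply/rows_spec; right.
  by exists w, c; split=> //; left.
move=> row /rows_spec[->|[w [c [Hw Hc]]]]; first by rewrite Vroot oppr_gt0.
have [H2 H3] := H1 w c Hw Hc.
case=> [->|[d Hd ->]]; first by rewrite Vhigh subr_gt0.
by rewrite Vlow subr_gt0; exact: H2.
Qed.

Lemma rows_feasible : feasible R rows <-> ~ KA_valid phi.
Proof.
rewrite -invalidP; split=> [[x Hx]|[X HX]].
  exists (fun w a => x (Nd (wtree w) (ltree a))).
  by apply/(@feasible_agree _ x).
pose P t (p : seq form * lname) := t = Nd (wtree p.1) (ltree p.2).
(* Names that do not encode a pair of a node and an unknown do not occur in the rows, so 0 is as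
   good as any value for them. *)
pose x t := if pselect (exists p, P t p) is left H
            then X (projT1 (cid H)).1 (projT1 (cid H)).2 else 0.
exists x; apply/(@feasible_agree X) => // w a; rewrite /x.
case: pselect => [H|[]]; last by exists (w, a).
by case: (cid H) => -[w' a'] /= [/wtree_inj-> /ltree_inj->].
Qed.

Lemma rows_wf : wf_rows rows.
Proof.
move=> row q /rows_spec[->|[w [c [_ _ [->|[d _ ->]]]]]].
- by rewrite root_sp => /mapP[q' _ ->]; exact: glit_lit.
- by rewrite row_high_sp mem_cat => /orP[/mapP[? _ ->]|/mapP[? _ ->]]; exact: glit_lit.
- by rewrite row_low_sp mem_cat => /orP[/mapP[? _ ->]|/mapP[? _ ->]]; exact: glit_lit.
Qed.

Lemma litseq_gt0 b f : (0 < size (litseq b f))%N.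
Proof. by elim: f b => //= a _ c IH b; rewrite size_cat ltn_addr. Qed.

Lemma rows_lits : (0 < len (lits rows))%N.
Proof.
rewrite -size_sp sp_lits [sp rows]/= [map _ _]/= root_sp /= size_cat !size_map.
by rewrite ltn_addr // litseq_gt0.
Qed.

Lemma lp_rows : isnd (lp rows) <-> ~ KA_valid phi.
Proof. by rewrite -rows_feasible; apply: lpP; [exact: rows_wf|exact: rows_lits]. Qed.
End Equiv.

(** * Parsing *)

Definition sym_tree (a : sym) : tree :=
  match a with Sv => un 0 | Si => un 1 | Sb => un 2 | S0 => un 3 | S1 => un 4 end.

(* The input is read from right to left. The state consists of the bits read
   since the last other symbol, a stack of parsed formulas and the table of the
   bodies of all boxed subformulas. *)
Definition pstep (c st : tree) : tree :=
  let bits := hd st in let stack := hd (tl st) in let table := tl (tl st) in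
  let a := hd stack in let b := hd (tl stack) in
  tif (beq c (un 3)) (Nd (Nd Lf bits) (Nd stack table))
  (tif (beq c (un 4)) (Nd (Nd tru bits) (Nd stack table))
  (tif (beq c (un 0))
     (Nd Lf (Nd (Nd (Nd (Nd tag0 bits)
        (Nd (Nd (Nd tru (Nd tag0 bits)) Lf) (Nd (Nd tru (Nd tag0 bits)) Lf))) stack) table))
  (tif (beq c (un 1))
     (Nd Lf (Nd (Nd (Nd (Nd tag1 (Nd (hd a) (hd b)))
        (Nd (tcat (hd (tl b)) (negs (tl (tl a)))) (tcat (tl (tl b)) (negs (hd (tl a))))))
        (tl (tl stack))) table))
     (Nd Lf (Nd (Nd (Nd (Nd tag2 (hd a))
        (Nd (Nd (Nd tru (Nd tag1 (hd a))) Lf) (Nd (Nd tru (Nd tag2 (hd a))) Lf)))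
        (tl stack)) (Nd a table)))))).

Definition parse inp := tfor inp (fun i st => pstep (tnth inp i) st) (Nd Lf (Nd Lf Lf)).

Lemma FP_pstep F G : FP F -> FP G -> FP (fun x => pstep (F x) (G x)).
Proof.
move=> HF HG; rewrite /pstep; cbv zeta; fp.
  by apply: FP_negs; fp.
by apply: FP_negs; fp.
Qed.

Lemma foldr_bits p stack table :
  foldr (fun c => pstep (sym_tree c)) (Nd Lf (Nd stack table)) (pos_bits p) =
  Nd (lst (map bit_tree (pos_bits p))) (Nd stack table).
Proof. by elim: p => [p IH|p IH|] //=; rewrite IH. Qed.

Lemma parse_foldr w : parse (lst (map sym_tree w)) =
  foldr (fun c => pstep (sym_tree c)) (Nd Lf (Nd Lf Lf)) w.
Proof.
rewrite /parse /tfor -size_sp lstK size_map.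
rewrite -[w in RHS](mkseq_nth Sv) /mkseq.
have : all (fun i => i < size w) (iota 0 (size w)) by apply/allP => i; rewrite mem_iota.
elim: (iota _ _) => //= i l IH /andP[lt /IH ->].
by rewrite tnthE lstK len_un (nth_map Sv).
Qed.

(** Prefix notation read backwards is evaluated like postfix notation. The statement covers any text
    to the right and any stack, since the second argument of an implication has been read before the
    first. *)
Lemma foldr_enc f rest st0 stack table :
  foldr (fun c => pstep (sym_tree c)) st0 rest = Nd Lf (Nd stack table) ->
  foldr (fun c => pstep (sym_tree c)) st0 (enc f ++ rest) =
  Nd Lf (Nd (Nd (elem f) stack) (lst (map elem (bodies f) ++ sp table))).
Proof.
elim: f rest stack table => [p|a IHa b IHb|a IHa] rest stack table H.
- by rewrite foldr_cat H /= foldr_bits spK.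
- rewrite /= -catA; rewrite (IHa _ _ _ (IHb _ _ _ H)) /pstep /tif /=.
  by rewrite lstK map_cat catA !negs_map !tcat_lst /elem /form_lits /= !map_cat.
- by rewrite /= (IHa _ _ _ H) /pstep /tif /=.
Qed.

Lemma parse_enc f : parse (lst (map sym_tree (enc f))) =
  Nd Lf (Nd (Nd (elem f) Lf) (lst (map elem (bodies f)))).
Proof.
by rewrite parse_foldr -[enc f]cats0 (@foldr_enc _ [::] _ Lf Lf) // cats0.
Qed.

Lemma size_bodies_enc f : size (bodies f) <= size (enc f).
Proof. by elim: f => //= a IHa b IHb; rewrite !size_cat; lia. Qed.

Lemma sz_negs l : sz (negs l) <= 5 * sz l.
Proof.
rewrite sz_sp sp_negs (sz_sp l) -map_comp.
elim: (sp l) => //= q s IH; rewrite sz_Nd /tif.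
have := sz_tl q; have : sz (if isnd (hd q) then Lf else tru) <= 3 by case: ifP.
lia.
Qed.

(** A constant factor per symbol, hence a single exponential bound for parsing, is enough: the
    system of inequalities is exponential anyway. *)
Lemma sz_pstep c st : sz (pstep c st) <= 64 * sz st.
Proof.
rewrite /pstep; set bits := hd st; set stack := hd (tl st); set table := tl (tl st).
set a := hd stack; set b := hd (tl stack).
have h1 := sz_hd_tl st; have h2 := sz_hd_tl (tl st).
have h3 := sz_hd_tl stack; have h4 := sz_hd_tl (tl stack).
have h5 := sz_hd_tl a; have h6 := sz_hd_tl (tl a).
have h7 := sz_hd_tl b; have h8 := sz_hd_tl (tl b).
have := sz_negs (hd (tl a)); have := sz_negs (tl (tl a)).
have := sz_tcat (hd (tl b)) (negs (tl (tl a))).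
have := sz_tcat (tl (tl b)) (negs (hd (tl a))).
have := sz_gt0 st; have t0 : sz tag0 = 1 by []. have t1 : sz tag1 = 3 by [].
have t2 : sz tag2 = 5 by []. have tt : sz tru = 3 by [].
rewrite -/bits -/stack -/table -/a -/b in h1 h2 h3 h4 h5 h6 h7 h8 *.
rewrite /tif; do 4 (case: ifP => _; first by rewrite !sz_Nd ?t0 ?t1 ?t2 ?tt ?sz_Lf; lia).
by rewrite !sz_Nd ?t0 ?t1 ?t2 ?tt ?sz_Lf; lia.
Qed.

Lemma sz_parse_state (F : nat -> tree) l st0 : sz (foldr (fun i acc => pstep (F i) acc) st0 l) <= 64 ^ size l * sz st0.
Proof.
elim: l => [|i l IH] /=; first by rewrite mul1n.
by apply: leq_trans (sz_pstep _ _) _; rewrite expnS -mulnA leq_mul2l.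
Qed.

Lemma Comp_parse : exists T k, Comp parse T /\
  forall x, T x <= (sz x + 5 * 64 ^ len x + 2) ^ k.
Proof.
have HF : FP3 (fun x i st => pstep (tnth x i) st) by apply: FP_pstep; fp.
have [T [k [HT Hk]]] := Comp_tfor FP_id HF (FP_const (Nd Lf (Nd Lf Lf))).
exists T, k; split=> // x; apply: Hk => l _ lsz.
apply: leq_trans (sz_parse_state (fun i => tnth x (un i)) _ _) _.
by rewrite mulnC leq_mul // leq_pexp2l.
Qed.

Lemma sz_tflat_le n F : sz (tflat n F) <= (\sum_(i < len n) sz (F (un i))).+1.
Proof.
rewrite sz_sp sp_tflat ltnS -(big_mkord xpredT (fun i => sz (F (un i)))) /index_iota subn0 /mkseq.
elim: (iota _ _) => [|i l IH]; first by rewrite big_nil.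
by rewrite big_cons /= map_cat sumn_cat (sz_sp (F (un i))); lia.
Qed.

Lemma sz_tab_sum n F : sz (tab n F) = (\sum_(i < len n) (sz (F (un i))).+1).+1.
Proof.
rewrite sz_sp sp_tab -(big_mkord xpredT (fun i => (sz (F (un i))).+1)) /index_iota subn0 /mkseq.
by congr _.+1; elim: (iota _ _) => [|i l IH] /=; rewrite ?big_nil ?big_cons ?IH.
Qed.

Lemma sz_tnodes_step table acc :
  sz (Nd Lf (tflat acc (fun i => tab table (fun j => Nd (hd (tnth table j)) (tnth acc i))))) <=
  (sz table + 10) ^ 2 * sz acc.
Proof.
have HG i : sz (tab table (fun j => Nd (hd (tnth table j)) (tnth acc (un i)))) <=
    (4 * sz table).+1 + sz table * sz (nth Lf (sp acc) i).
  rewrite sz_tab_sum addSn ltnS.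
  apply: (@leq_trans (\sum_(j < len table) (sz (nth Lf (sp table) j) + (2 + sz (nth Lf (sp acc) i))))).
    apply: leq_sum => j _; rewrite sz_Nd !tnthE !len_un.
    by have := sz_hd (nth Lf (sp table) j); lia.
  rewrite big_split /= sum_nat_const card_ord; have := sum_nth_sz table (len table).
  have lt := len_sz table.
  have : len table * sz (nth Lf (sp acc) i) <= sz table * sz (nth Lf (sp acc) i).
    by rewrite leq_mul2r (ltnW lt) orbT.
  have h3 : sz table + len table + len table * 2 <= 4 * sz table by lia.
  move=> h1 h2; rewrite mulnDr; apply: leq_trans (leq_add h2 (leqnn _)) _.
  by rewrite addnA; exact: leq_add h3 h1.
rewrite sz_Nd sz_Lf.
have H1 := sz_tflat_le acc (fun i => tab table (fun j => Nd (hd (tnth table j)) (tnth acc i))).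
have H2 : \sum_(i < len acc) sz (tab table (fun j => Nd (hd (tnth table j)) (tnth acc (un i)))) <=
    \sum_(i < len acc) ((4 * sz table).+1 + sz table * sz (nth Lf (sp acc) i)).
  by apply: leq_sum => i _; exact: HG.
have H3 := leq_trans H1 (H2 : _ < _.+1).
move: H3; rewrite big_split /= sum_nat_const card_ord -big_distrr /=.
have := sum_nth_sz acc (len acc); have := len_sz acc; have := sz_gt0 table.
set s1 := \sum_(_ < _) _; rewrite expnS expn1; nia.
Qed.

Definition add_nodes s := Nd (tnodes (tl (tl s))) s.

(** Each of the [len (tl (tl s))] levels multiplies the size by at most [(sz s + 10) ^ 2]. *)
Definition nodes_bound s := ((sz s + 10) ^ 2) ^ len (tl (tl s)).

Lemma sz_tnodes s l : size l <= len (tl (tl s)) ->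
  sz (foldr (fun _ acc => Nd Lf (tflat acc (fun i => tab (tl (tl s))
    (fun j => Nd (hd (tnth (tl (tl s)) j)) (tnth acc i))))) Lf (l : seq nat)) <= nodes_bound s.
Proof.
move=> lsz; set table := tl (tl s).
have Ht : sz table <= sz s by apply: leq_trans (sz_tl _) (sz_tl _).
apply: (@leq_trans (((sz s + 10) ^ 2) ^ size l)); last first.
  by rewrite leq_pexp2l // expn_gt0 addn_gt0 orbT.
elim: l {lsz} => [|i l IH]; first by rewrite expn0.
rewrite [foldr _ _ _]/=; apply: leq_trans (sz_tnodes_step _ _) _.
rewrite -[size (i :: l)]/((size l).+1) [X in _ <= X]expnS.
by apply: leq_mul => //; rewrite leq_exp2r // leq_add2r.
Qed.

Lemma Comp_add_nodes : exists T k, Comp add_nodes T /\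
  forall s, T s <= (sz s + nodes_bound s + 2) ^ k + 1 + 40 * (2 * sz s + nodes_bound s).
Proof.
have HF : FP3 (fun s i acc => Nd Lf (tflat acc (fun i => tab (tl (tl s))
    (fun j => Nd (hd (tnth (tl (tl s)) j)) (tnth acc i))))) by fp.
have Hn : FP (fun s => tl (tl s)) by fp.
have [T [k [HT Hk]]] := Comp_tfor Hn HF FP_Lf.
have H := Comp_Nd HT Comp_id.
eexists; exists k; split; first exact: H.
move=> s /=; apply: leq_add; first by rewrite leq_add2r; apply: Hk => l _; exact: sz_tnodes.
have := @sz_tnodes s (iota 0 (len (tl (tl s)))); rewrite size_iota => /(_ (leqnn _)).
rewrite /tfor /=; lia.
Qed.

Definition decide z := tif (lp (gen_rows (hd z) (tl (tl (tl z))) (hd (hd (tl (tl z)))))) Lf tru.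

Lemma FP_decide : FP decide.
Proof.
apply: FP_tif; [apply: FP_lp; apply: FP_gen_rows; fp|fp|fp].
Qed.

Definition solve x := decide (add_nodes (parse x)).

Lemma solve_correct f : isnd (solve (lst (map sym_tree (enc f)))) <-> KA_valid f.
Proof.
rewrite /solve parse_enc /decide /add_nodes /tif /=.
have H := lp_rows f; case: ifP => Hlp /=.
  by split=> // Hv; case: (H.1 Hlp).
by split=> // _; apply: contrapT => /H.2; rewrite Hlp.
Qed.

(** * The decision procedure *)

(** [K4] has the last input symbol on top, so the list is built from its end: each symbol is put
    before the list so far and joined to it by a new root. *)
Definition load : stmt :=
  Seq (Push K0 S0) (Loop K4 (fun a => Seq (pushes K0 (rev (ser (sym_tree a)))) (Push K0 S1))).

Lemma pushes_sem l a : sem (pushes K0 l) a (sset K0 (rev l ++ st0 a) a) (size l).+1.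
Proof.
elim: l a => [|x l IH] [a b c d e] /=; first exact: sem_skip.
apply: sem_eq; first (apply: sem_seq; [exact: sem_push|exact: IH]).
  by rewrite /= rev_cons cat_rcons.
by [].
Qed.

Lemma load_loop w (t : seq sym) b : exists2 n, n <= 20 * size w + 1 &
  sem (Loop K4 (fun a => Seq (pushes K0 (rev (ser (sym_tree a)))) (Push K0 S1)))
    (Stacks (ser (lst b)) [::] [::] [::] (rev w))
    (main (ser (lst (map sym_tree w ++ b)))) n.
Proof.
elim/last_ind: w b => [|w a IH] b; first by exists 1 => //; exact: sem_loop0.
have [n hn Hn] := IH (sym_tree a :: b).
exists (((size (rev (ser (sym_tree a)))).+1 + 1) + n).+1.
  by rewrite size_rcons size_rev; move: hn; case: (a) => /=; lia.
rewrite rev_rcons map_rcons cat_rcons; apply: sem_loop; [by []| |exact: Hn].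
apply: sem_eq; first (apply: sem_seq; [exact: pushes_sem|exact: sem_push]).
  by rewrite /= revK.
by [].
Qed.

Lemma load_sem w : exists2 n, n <= 20 * size w + 2 &
  sem load (Stacks [::] [::] [::] [::] (rev w)) (main (ser (lst (map sym_tree w)))) n.
Proof.
have [n hn Hn] := load_loop w [::] [::]; rewrite cats0 in Hn.
by exists (1 + n); [lia|apply: sem_seq; [exact: sem_push|exact: Hn]].
Qed.

Lemma sz_input w : sz (lst (map sym_tree w)) <= 10 * size w + 1.
Proof.
elim: w => //= a w IH; rewrite sz_Nd.
have : sz (sym_tree a) <= 9 by case: a.
lia.
Qed.

Lemma len_input w : len (lst (map sym_tree w)) = size w.
Proof. by rewrite -size_sp lstK size_map. Qed.

(** For input length N, the parser state has size 2^(O(N)) and the list of nodes, being an N-fold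
    product of such sizes, 2^(O(N^2)). [V] exceeds all these sizes with room for constants, and each
    stage is polynomial in them. *)
Lemma solve_time : exists p k, forall f (w := enc f) (x := lst (map sym_tree w)), exists2 n,
  n <= (2 ^ (14 * (size w).+2 ^ 2)) ^ k &
  sem p (Stacks [::] [::] [::] [::] (rev w)) (main (ser (solve x))) n.
Proof.
have [T1 [k1 [HT1 H1]]] := Comp_parse.
have [T2 [k2 [HT2 H2]]] := Comp_add_nodes.
have [[T3 HT3 [k3 H3]] _] := FP_decide.
have [p Hp] := Comp_comp HT3 (Comp_comp HT2 HT1).
exists (Seq load p), (k1 + k2 + k3 + 12) => f w x.
have [n0 h0 Hn0] := load_sem w; have [n hn Hn] := Hp x [::].
exists (n0 + n); last by apply: sem_seq Hn0 _; move: Hn; rewrite !cats0.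
apply: leq_trans (leq_add h0 hn) _.
set N := size w; set s := parse x; set V := 2 ^ (14 * N.+2 ^ 2).
have EN : N.+2 ^ 2 = N * N + 4 * N + 4 by rewrite expnS expn1; lia.
have pow a b : a <= b -> 2 ^ a <= 2 ^ b by move=> le; rewrite leq_exp2l.
have N2 : N < 2 ^ N by apply: ltn_expl.
have sx : sz x <= 10 * N + 1 by exact: sz_input.
have lx : len x = N by exact: len_input.
have E64 : 5 * 64 ^ N <= 2 ^ (6 * N + 3).
  by rewrite expnD expnM mulnC leq_mul2l orbT.
have ss : sz s <= 5 * 64 ^ N.
  rewrite /s /parse; apply: leq_trans (sz_parse_state (fun i => tnth x (un i)) _ _) _.
  by rewrite size_iota lx mulnC.
have lt : len (tl (tl s)) <= N.
  by rewrite /s parse_enc /= -size_sp lstK size_map; exact: size_bodies_enc.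
have s10 : sz s + 10 <= 2 ^ (6 * N + 5).
  have : 2 ^ 3 <= 2 ^ (6 * N + 3) by apply: pow; lia.
  have : 2 ^ (6 * N + 5) = 4 * 2 ^ (6 * N + 3) by rewrite -[4]/(2 ^ 2) -expnD; congr (2 ^ _); lia.
  lia.
have nbV : nodes_bound s <= 2 ^ (12 * N.+2 ^ 2).
  rewrite /nodes_bound; apply: (@leq_trans ((2 ^ (12 * N + 10)) ^ N)).
    apply: (@leq_trans (((sz s + 10) ^ 2) ^ N)).
      by rewrite leq_pexp2l // expn_gt0 addn_gt0 orbT.
    apply: leq_expl; rewrite (_ : 12 * N + 10 = (6 * N + 5) * 2); last by lia.
    by rewrite expnM leq_exp2r.
  by rewrite -expnM; apply: pow; rewrite EN; lia.
have sV : sz s + 10 <= 2 ^ (12 * N.+2 ^ 2).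
  by apply: leq_trans s10 _; apply: pow; rewrite EN; lia.
have xV : 20 * N + 10 <= 2 ^ (12 * N.+2 ^ 2).
  apply: (@leq_trans (2 ^ (N + 5))); last by apply: pow; rewrite EN; lia.
  by rewrite expnD -[2 ^ 5]/32; lia.
have VE : V = 2 ^ (12 * N.+2 ^ 2) * 2 ^ (2 * N.+2 ^ 2).
  by rewrite /V -expnD; congr (2 ^ _); lia.
have V2 : 8 <= 2 ^ (2 * N.+2 ^ 2) by rewrite -[8]/(2 ^ 3); apply: pow; rewrite EN; lia.
have V0 : 8 * 2 ^ (12 * N.+2 ^ 2) <= V by rewrite VE mulnC leq_mul2l V2 orbT.
set P := 2 ^ (12 * N.+2 ^ 2) in V0 nbV sV xV.
have t1 : T1 x <= V ^ k1.
  apply: leq_trans (H1 x) _; apply: leq_expl; rewrite lx.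
  have : 5 * 64 ^ N + 10 <= P.
    apply: leq_trans (_ : 2 ^ (6 * N + 5) <= P); last by apply: pow; rewrite EN; lia.
    have : 2 ^ 3 <= 2 ^ (6 * N + 3) by apply: pow; lia.
    have : 2 ^ (6 * N + 5) = 4 * 2 ^ (6 * N + 3) by rewrite -[4]/(2 ^ 2) -expnD; congr (2 ^ _); lia.
    lia.
  lia.
have t2 : T2 s <= V ^ k2 + 1 + 40 * V.
  apply: leq_trans (H2 s) _; apply: leq_add.
    by rewrite leq_add2r; apply: leq_expl; lia.
  by rewrite leq_mul2l /=; lia.
have nodes_sz : sz (tnodes (tl (tl s))) <= P.
  by apply: leq_trans nbV; apply: sz_tnodes; rewrite size_iota.
have t3 : T3 (add_nodes s) <= V ^ k3.
  by apply: leq_trans (H3 _) _; apply: leq_expl; rewrite /add_nodes sz_Nd; lia.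
have V4 : 4 <= V by lia.
have Vp a b : a <= b -> V ^ a <= V ^ b by move=> le; rewrite leq_pexp2l //; lia.
have v1 : V ^ k1 <= V ^ (k1 + k2 + k3) by apply: Vp; lia.
have v2 : V ^ k2 <= V ^ (k1 + k2 + k3) by apply: Vp; lia.
have v3 : V ^ k3 <= V ^ (k1 + k2 + k3) by apply: Vp; lia.
have v0 : V ^ 0 <= V ^ (k1 + k2 + k3) by apply: Vp.
rewrite expn0 in v0; rewrite expnD; set Z := V ^ (k1 + k2 + k3) in v0 v1 v2 v3 *.
have big : 100 * V <= V ^ 12.
  rewrite expnS mulnC leq_mul2l; apply/orP; right.
  apply: (@leq_trans (V ^ 4)); last by apply: Vp.
  by apply: (@leq_trans (4 ^ 4)) => //; rewrite leq_exp2r.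
have step1 : Z * (100 * V) <= Z * V ^ 12 by rewrite leq_mul2l big orbT.
apply: leq_trans step1.
have z1 : Z <= Z * V by rewrite leq_pmulr //; lia.
have z2 : V <= Z * V by rewrite leq_pmull.
have -> : Z * (100 * V) = 100 * (Z * V) by lia.
move: (Z * V) z1 z2 => ZV z1 z2; rewrite -/s; lia.
Qed.

Theorem theorem4p13 :
  exists (M : TM) (k : nat), forall phi : form,
    exists b : bool,
      tm_run M (2 ^ ((size (enc phi)).+2 ^ k)) (tm_init M (enc phi)) = Some b
      /\ (b = true <-> KA_valid phi).
Proof.
have [p [k Hp]] := solve_time; have [M HM] := stmt_TM p.
(* The tape simulation is quadratic, so [V ^ (2 * k + 6)] steps suffice, where the extra 6 covers
   the input length and constants. Its binary logarithm is c E^2 with E = N + 2, and c <= 2^c <= E^c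
   gives the exponent c + 2. *)
pose c := 14 * (2 * k + 6); exists M, (c + 2) => phi; set N := size (enc phi).
have [n hn Hn] := Hp phi.
set t := solve _ in Hn; exists (isnd t); split; last exact: solve_correct.
have [a [l [Ht Ha]]] : exists a l, ser t = a :: l /\ (a == S1) = isnd t.
  by case: (t) => [|u v]; [exists S0, [::]|exists S1, (ser u ++ ser v)].
rewrite -Ha; apply: (HM _ _ l (main (ser t)) n) => //; first by case: (phi).
rewrite -/N; set E := N.+2 in hn *; set V := 2 ^ (14 * E ^ 2) in hn.
have V2 : 2 ^ 5 <= V by rewrite leq_exp2l // /E expnS expn1; lia.
have NV : N <= V.
  apply: leq_trans (ltnW (ltn_expl N (isT : 1 < 2))) _.
  by rewrite leq_exp2l // /E expnS expn1; lia.
have Q0 : 0 < V ^ k by rewrite expn_gt0; apply/orP; left; lia.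
apply: (@leq_trans (V ^ (2 * k + 6))); last first.
  rewrite -expnM leq_exp2l // expnD mulnAC leq_mul2r; apply/orP; right.
  rewrite -/c; apply: leq_trans (ltnW (ltn_expl c (isT : 1 < 2))) _.
  exact: leq_expl.
have -> : V ^ (2 * k + 6) = (V ^ k * V ^ k) * (V ^ 5 * V).
  by rewrite -!expnD -expnSr -expnD; congr (V ^ _); lia.
have V5 : 32 <= V ^ 5.
  apply: leq_trans V2 _; rewrite -[X in X <= _]expn1 leq_pexp2l //; lia.
move: (V ^ k) (V ^ 5) hn Q0 V5 => Q V5 hn Q0 V50.
apply: (@leq_trans (Q * Q * (32 * V))); last by rewrite leq_mul2l leq_mul2r V50 !orbT.
move: V2 NV; rewrite -[2 ^ 5]/32 => V2 NV.
have h1 : n.+1 <= 2 * Q by lia.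
have h2 : 2 * (N + n.+1) + 4 <= 8 * (Q * V) by nia.
apply: leq_ltn_trans (leq_mul h1 h2) _; nia.
Qed.
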